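(* Let $\mathcal H(\mu)$ be a stratum of differentials in genus zero. Then $\mathcal H(\mu)$ does not contain a Zariski dense set of arithmetic points unless $\mathcal H(\mu)$ has only simple poles, a single pole, or a single zero.
   Context: For a partition $\mu=(\mu_1,\dots,\mu_l)$ of $-2$ into nonzero integers, the genus zero stratum $\mathcal H(\mu)$ is the moduli space of pairs $(X,\omega)$ where $X\cong\mathbb P^1$ is a compact Riemann surface of genus $0$ and $\omega$ is a meromorphic differential with divisor $\sum_i\mu_ip_i$ (labelled, pairwise distinct points $p_i$). It is an algebraic variety defined over $\mathbb Z$. Write $Z(\omega)$, $P(\omega)$ for the sets of zeros and poles. ''$\mathcal H(\mu)$ has only simple poles / a single pole / a single zero'' refers to the differentials it parametrizes, i.e. to the entries of $\mu$. A point $(X,\omega)\in\mathcal H(\mu)$ is arithmetic if it is defined over $\overline{\mathbb Q}$ and its periods are algebraic up to a common scalar: choosing a basis $\gamma_1,\dots,\gamma_d$ of $H_1(X\setminus P(\omega),Z(\omega);\mathbb Z)$, one has $[\int_{\gamma_1}\omega:\dots:\int_{\gamma_d}\omega]\in\mathbb P^{d-1}(\overline{\mathbb Q})$. *)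

(* Defs.v *)
From mathcomp Require Import all_boot all_order all_algebra.
From mathcomp Require Import all_classical all_reals all_analysis.
From mathcomp Require Import complex.
From mathcomp Require mpoly.

Set Implicit Arguments.
Unset Strict Implicit.
Unset Printing Implicit Defensive.

Import Order.TTheory GRing.Theory Num.Theory.
Import numFieldNormedType.Exports.

Local Open Scope classical_set_scope.
Local Open Scope ring_scope.

(* Points of P^1(C) are given by nonzero vectors of C^2 up to scaling; the
   affine coordinate of w is z = w 0 0 / w 0 1.  Two nonzero vectors define
   the same point iff their det2 vanishes. *)
Definition det2 (F : comPzRingType) (v w : 'rV[F]_2) : F :=
  v 0 0 * w 0 1 - v 0 1 * w 0 0.

(* A pair (X, omega) with X = P^1, labelled distinct points p_i and
   div omega = \sum_i mu_i p_i.  Once lifts of the p_i to C^2 are fixed (the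
   rows of diff_pt), such an omega is determined by the constant diff_scale, see
   [diff_form]. *)
Record differential (R : realType) (l : nat) (mu : 'I_l -> int) :=
  Differential {
    diff_scale : R[i];
    diff_pt : 'M[R[i]]_(l, 2);
    diff_scale_neq0 : diff_scale != 0;
    diff_pt_neq0 : forall i, row i diff_pt != 0;
    diff_pt_distinct :
      forall i j, i != j -> det2 (row i diff_pt) (row j diff_pt) != 0 }.

(* omega pulled back to C^2 minus the origin, at the point w on the tangent
   vector v.  On the affine chart w = (z, 1), v = (dz, 0) and with p_i lifted
   to (a_i, 1), it is diff_scale * \prod_i (z - a_i)^mu_i dz.  When
   \sum_i mu_i = -2 it is homogeneous of degree 0 and kills the radial
   direction v = w, so that it descends to P^1. *)
Definition diff_form (R : realType) (l : nat) (mu : 'I_l -> int)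
    (D : differential R mu) (w v : 'rV[R[i]]_2) : R[i] :=
  diff_scale D * (\prod_i det2 w (row i (diff_pt D)) ^ mu i) * det2 v w.

(* Some Moebius transformation g maps each p_i to the i-th point of D', and
   g^* omega' = omega. *)
Definition diff_iso (R : realType) (l : nat) (mu : 'I_l -> int)
    (D D' : differential R mu) : Prop :=
  exists g : 'M[R[i]]_2,
    [/\ g \in unitmx,
        forall i, det2 (row i (diff_pt D) *m g) (row i (diff_pt D')) = 0 &
        forall w v, diff_form D' (w *m g) (v *m g) = diff_form D w v].

(* The complex points of H(mu), as the set of isomorphism classes. *)
Definition stratum (R : realType) (l : nat) (mu : 'I_l -> int) : Type :=
  {A : set (differential R mu) | exists D, A = [set D' | diff_iso D D']}.

Definition iso_class (R : realType) (l : nat) (mu : 'I_l -> int)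
    (D : differential R mu) : stratum R mu :=
  exist _ [set D' | diff_iso D D'] (ex_intro _ D erefl).

(* The pairs [differential] are the points of an open subset of the affine
   space of dimension 1 + 2 l. *)
Definition diff_coord (R : realType) (l : nat) (mu : 'I_l -> int)
    (D : differential R mu) : 'rV[R[i]]_(1 + l * 2) :=
  row_mx (diff_scale D)%:M (mxvec (diff_pt D)).

(* H(mu) is the geometric quotient of this open subset by changes of lifts and
   of the coordinate on P^1, hence carries the quotient of the Zariski
   topology. *)
Definition zariski_closed (R : realType) (l : nat) (mu : 'I_l -> int)
    (Y : set (stratum R mu)) : Prop :=
  exists I : set (mpoly.mpoly (1 + l * 2) R[i]),
    forall D : differential R mu,
      Y (iso_class D) <-> (forall f, I f -> mpoly.meval (diff_coord D 0) f = 0).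

Definition zariski_dense (R : realType) (l : nat) (mu : 'I_l -> int)
    (S : set (stratum R mu)) : Prop :=
  forall Y : set (stratum R mu), zariski_closed Y -> S `<=` Y -> Y = setT.

Definition is_pole (R : realType) (l : nat) (mu : 'I_l -> int)
    (D : differential R mu) (w : 'rV[R[i]]_2) : Prop :=
  exists i, mu i < 0 /\ det2 w (row i (diff_pt D)) = 0.

Definition is_zero (R : realType) (l : nat) (mu : 'I_l -> int)
    (D : differential R mu) (w : 'rV[R[i]]_2) : Prop :=
  exists i, 0 < mu i /\ det2 w (row i (diff_pt D)) = 0.

Definition C1_real (R : realType) (V : normedModType R) (f : V -> R) : Prop :=
  forall v : V, (forall x, derivable f x v) /\ continuous (fun x => 'D_v f x).

Definition C1_map (R : realType) (V : normedModType R)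
    (f : V -> 'rV[R[i]]_2) : Prop :=
  forall j, C1_real (fun x => complex.Re (f x 0 j)) /\
            C1_real (fun x => complex.Im (f x 0 j)).

(* C^1 singular 1- and 2-simplices of P^1 minus the poles, given by lifts to
   C^2 minus the origin (which exist since simplices are contractible).  C^1 on
   a closed simplex means being the restriction of a C^1 map; only the values
   on the simplex matter. *)
Record simplex1 (R : realType) (l : nat) (mu : 'I_l -> int)
    (D : differential R mu) := Simplex1 {
  simplex1_lift :> R -> 'rV[R[i]]_2;
  simplex1_C1 : C1_map (simplex1_lift : R^o -> _);
  simplex1_avoid : forall t, 0 <= t <= 1 ->
    simplex1_lift t != 0 /\ ~ is_pole D (simplex1_lift t) }.

(* The standard 2-simplex has vertices (0, 0), (1, 0) and (0, 1), in this
   order. *)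
Record simplex2 (R : realType) (l : nat) (mu : 'I_l -> int)
    (D : differential R mu) := Simplex2 {
  simplex2_lift :> R * R -> 'rV[R[i]]_2;
  simplex2_C1 : C1_map (simplex2_lift : R^o * R^o -> _);
  simplex2_avoid : forall s t, 0 <= s -> 0 <= t -> s + t <= 1 ->
    simplex2_lift (s, t) != 0 /\ ~ is_pole D (simplex2_lift (s, t)) }.

(* Formal integral combinations of singular simplices; equality of chains is
   tested on coefficients, see [chain_coef]. *)
Definition chain1 (R : realType) (l : nat) (mu : 'I_l -> int)
    (D : differential R mu) := seq (int * simplex1 D).
Definition chain2 (R : realType) (l : nat) (mu : 'I_l -> int)
    (D : differential R mu) := seq (int * simplex2 D).

(* Two lifts define the same path in P^1. *)
Definition same_path (R : realType) (f g : R -> 'rV[R[i]]_2) : Prop :=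
  forall t, 0 <= t <= 1 -> det2 (f t) (g t) = 0.

Definition path_delta (R : realType) (f g : R -> 'rV[R[i]]_2) : int :=
  if `[< same_path f g >] then 1 else 0.

Definition chain_coef (R : realType) (l : nat) (mu : 'I_l -> int)
    (D : differential R mu) (c : chain1 D) (g : simplex1 D) : int :=
  \sum_(x <- c) x.1 * path_delta x.2 g.

(* The coefficient of g in the boundary of a 2-chain. *)
Definition boundary2_coef (R : realType) (l : nat) (mu : 'I_l -> int)
    (D : differential R mu) (s : chain2 D) (g : simplex1 D) : int :=
  \sum_(x <- s) x.1 * (path_delta (fun t => x.2 (1 - t, t)) g
                       - path_delta (fun t => x.2 (0, t)) g
                       + path_delta (fun t => x.2 (t, 0)) g).

(* The coefficient of the point q in the boundary of a 1-chain. *)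
Definition boundary1_coef (R : realType) (l : nat) (mu : 'I_l -> int)
    (D : differential R mu) (c : chain1 D) (q : 'rV[R[i]]_2) : int :=
  \sum_(x <- c) x.1 * ((det2 (x.2 1) q == 0)%:Z - (det2 (x.2 0) q == 0)%:Z).

(* Cycles relative to Z(omega). *)
Definition rel_cycle (R : realType) (l : nat) (mu : 'I_l -> int)
    (D : differential R mu) (c : chain1 D) : Prop :=
  forall q, q != 0 -> ~ is_zero D q -> boundary1_coef c q = 0.

(* c - c' is a boundary modulo the 1-chains of the space Z(omega). *)
Definition homologous (R : realType) (l : nat) (mu : 'I_l -> int)
    (D : differential R mu) (c c' : chain1 D) : Prop :=
  exists s : chain2 D, forall g : simplex1 D,
    ~ (forall t, 0 <= t <= 1 -> is_zero D (g t)) ->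
    chain_coef c g - chain_coef c' g = boundary2_coef s g.

Definition chain_comb (R : realType) (l : nat) (mu : 'I_l -> int)
    (D : differential R mu) (d : nat) (n : 'I_d -> int)
    (gam : 'I_d -> chain1 D) : chain1 D :=
  flatten [seq [seq (n j * x.1, x.2) | x <- gam j] | j <- enum 'I_d].

(* The classes of gam form a basis of H_1(X \ P(omega), Z(omega); Z). *)
Definition H1_basis (R : realType) (l : nat) (mu : 'I_l -> int)
    (D : differential R mu) (d : nat) (gam : 'I_d -> chain1 D) : Prop :=
  (forall j, rel_cycle (gam j)) /\
  (forall c, rel_cycle c ->
     exists! n : {ffun 'I_d -> int}, homologous c (chain_comb n gam)).

Definition cderive (R : realType) (f : R -> 'rV[R[i]]_2) (t : R)
    : 'rV[R[i]]_2 :=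
  \row_j Complex (derive1 (fun s => complex.Re (f s 0 j)) t)
                 (derive1 (fun s => complex.Im (f s 0 j)) t).

Definition path_integral (R : realType) (l : nat) (mu : 'I_l -> int)
    (D : differential R mu) (g : simplex1 D) : R[i] :=
  let h t := diff_form D (g t) (cderive g t) in
  Complex (Rintegral (@lebesgue_measure R) `[0, 1] (fun t => complex.Re (h t)))
          (Rintegral (@lebesgue_measure R) `[0, 1] (fun t => complex.Im (h t))).

Definition period (R : realType) (l : nat) (mu : 'I_l -> int)
    (D : differential R mu) (c : chain1 D) : R[i] :=
  \sum_(x <- c) x.1%:~R * path_integral x.2.

Definition is_algebraic (R : realType) (z : R[i]) : Prop :=
  algebraicOver (ratr : rat -> R[i]) z.

Definition over_Qbar (R : realType) (l : nat) (mu : 'I_l -> int)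
    (D : differential R mu) : Prop :=
  is_algebraic (diff_scale D) /\ forall i j, is_algebraic (diff_pt D i j).

(* [v 0 : ... : v (d-1)] is a point of P^(d-1)(Qbar). *)
Definition proj_algebraic (R : realType) (d : nat) (v : 'I_d -> R[i]) : Prop :=
  (exists j, v j != 0) /\
  exists2 a : R[i], a != 0 & forall j, is_algebraic (a * v j).

Definition algebraic_periods (R : realType) (l : nat) (mu : 'I_l -> int)
    (D : differential R mu) : Prop :=
  exists (d : nat) (gam : 'I_d -> chain1 D),
    H1_basis gam /\ proj_algebraic (fun j => period (gam j)).

(* Periods only depend on the isomorphism class, so they may be computed on
   the representative with coordinates in Qbar. *)
Definition arithmetic_point (R : realType) (l : nat) (mu : 'I_l -> int)
    (x : stratum R mu) : Prop :=
  exists D : differential R mu,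
    [/\ x = iso_class D, over_Qbar D & algebraic_periods D].

Definition only_simple_poles (l : nat) (mu : 'I_l -> int) : Prop :=
  forall i, mu i < 0 -> mu i = -1.
Definition single_pole (l : nat) (mu : 'I_l -> int) : Prop :=
  #|[pred i | mu i < 0]| = 1%N.
Definition single_zero (l : nat) (mu : 'I_l -> int) : Prop :=
  #|[pred i | 0 < mu i]| = 1%N.

(* Main.v *)
From HB Require Import structures.
Require Import Defs.
From mathcomp Require Import all_boot all_order all_algebra.
From mathcomp Require Import all_classical all_reals all_analysis.
From mathcomp Require Import perm complex polyrcf.
From mathcomp Require mpoly.
From mathcomp Require Import zify ring lra.
Import (canonicals) mpoly.

Set Implicit Arguments.
Unset Strict Implicit.
Unset Printing Implicit Defensive.

Import Order.TTheory GRing.Theory Num.Theory.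
Import numFieldNormedType.Exports.

(** Suppose that [mu] is of none of the three kinds. Then there are a pole [inf] of order at least
    2, a second pole [K] and two zeros [z1], [z2]. Let u be the coordinate of P^1 with [inf] at
    infinity, [z1] at 0 and [z2] at 1. Then omega = C prod (u - x_i)^mu_i du, and partial fractions
    give omega = C (dG + sum r_i du / (u - x_i)) with G rational ([pf_prim]) and r_i constants
    ([pf_res]). Two relative cycles suffice: a small loop around [K], of period 2 pi i C r_K
    ([loop_integral]), and an arc from [z1] to [z2], of period C (G(1) - G(0) + sum r_i W_i) with
    exp W_i = (1 - x_i) / (0 - x_i) ([arc_integral]).

    At an arithmetic point C, the x_i, the r_i and G(1) - G(0) are algebraic. If r_K is nonzero, the
    quotient of the two periods is algebraic too, so G(1) - G(0) is a linear form with algebraic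
    coefficients in 2 pi i and the W_i, which are logarithms of algebraic numbers. By Baker's
    theorem such a form is 0 as soon as it is algebraic. Hence (G(1) - G(0)) r_K = 0 at every
    arithmetic point ([arithmetic_key]).

    This equation is Zariski closed: its left side is a quotient of polynomials in the coordinates
    whose denominator vanishes nowhere, and depends only on the isomorphism class ([fracfun_reval],
    [cfg_iso]). It does not hold everywhere ([nonvanishing]): fix real positions of all points but
    [K] and let x_K = y tend to infinity. As [inf] has order at least 2, r_K grows at least linearly
    in y, whereas on [0, 1] the density of omega / C and the other r_i are O(1 / y). So G' is
    positive on [0, 1], and G(1) > G(0).

    Baker's theorem ([baker]) is proved by the method of Schneider and Lang in several variables.
    One may assume the logarithms lam_i linearly independent over the algebraic numbers. Let g be a
    basis of a number field of degree D on which the coefficients, cleared of denominators by N, act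
    by integer matrices B_i, and put Y = sum lam_i B_i. Then Y g = N b0 g, where b0 is the value of
    the form, and independence makes Y invertible. On C^D, the functions z . g, exp z_1, ..., exp
    z_D and their coordinate derivatives take values in the field at the lattice generated by the
    rows of Y. Siegel's lemma yields a nonzero polynomial in them vanishing to high order on a grid
    of lattice points. Its first nonvanishing derivative is bounded above by Rolle's theorem along
    lines ([hermite_bound]) and below by Liouville's inequality ([liouville]); the two bounds are
    incompatible ([lattice_contradiction]). *)

Section ParameterChoice.

(** * Choice of the numerical parameters in Baker's method *)

Local Open Scope nat_scope.

Lemma leq_expr m n e : m <= n -> m ^ e <= n ^ e.
Proof. by case: e => // e mn; rewrite leq_exp2r. Qed.

(** This follows from n^n n! <= (2n)! and binomial(2n, n) <= 4^n. *)
Lemma expnn_le_fact n : n ^ n <= 4 ^ n * n`!.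
Proof.
have H k : n ^ k * n`! <= (n + k)`!.
  elim: k => [|k IHk]; first by rewrite mul1n addn0.
  by rewrite expnS addnS factS -mulnA leq_mul //; lia.
have bin_le : 'C(n + n, n) <= 4 ^ n.
  rewrite -[4]/(2 ^ 2) -expnM mul2n -addnn (Pascal 1 1 (n + n)) /=.
  have nn : n < (n + n).+1 by lia.
  rewrite (bigD1 (Ordinal nn)) //= !exp1n !muln1; exact: leq_addr.
have := H n; rewrite -(bin_fact (leq_addl n n)) addnK mulnA.
rewrite leq_pmul2r ?fact_gt0 // => /leq_trans; apply.
by rewrite leq_mul2r bin_le orbT.
Qed.

Lemma fact_le_expnn n : n`! <= n ^ n.
Proof.
elim: n => // n IHn; rewrite factS expnS leq_mul2l /=.
by apply: leq_trans IHn _; rewrite leq_expr.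
Qed.

Lemma unknowns_le D s : 0 < D -> 0 < s -> 2 * s ^ D * D <= (2 * D * s) ^ D.+1.
Proof.
move=> D0 s0; rewrite expnS !expnMn.
have y0 : 0 < s * (2 ^ D * D ^ D) by rewrite !muln_gt0 !expn_gt0 D0 s0.
by have := leq_pmulr (2 * s ^ D * D) y0; congr (_ <= _); ring.
Qed.

Variables (D c : nat).
Hypotheses (D_gt0 : 0 < D) (c_gt0 : 0 < c).

(** Bound for an r-th derivative of (z . g)^a exp(b . z), with a and the b_h below L, on a box of
    side S. The factors account for the exponential, the falling factorials, the r linear forms
    produced by the derivations, and the remaining power of z . g. *)
Definition deriv_bound (S L r : nat) :=
  c ^ (D * D * L * S) * (L ^ L * (c + D * L * c) ^ r * (D * S * c) ^ L).
Definition coef_bound (S L T : nat) := L ^ D.+1 * deriv_bound S L (D * T).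

(** The first inequality is Siegel's count, two unknowns per equation. In the second, the left
    factors come from the denominators, the passage from lattice to coordinate directions, the
    interpolation bound and Liouville's inequality; 4 is 2 for real and imaginary parts times 2 for
    a strict margin. It holds because L has the order of T^(D / (D + 1)), which makes L^(S M)
    negligible against (S M)!. *)
Lemma baker_parameters : exists S L T,
  [/\ 0 < S, 0 < L, 0 < T, 2 * (T ^ D * S ^ D * D) <= L ^ D.+1 &
    forall W M, T <= W -> M <= W -> W <= D * M ->
      c ^ (D * D * L * S) * ((D * c) ^ W *
      (4 * (L ^ D.+1 * coef_bound S L T * deriv_bound S L (S * M + (W - M)))
         * M`! * S ^ (S * M)) *
      (D * (L ^ D.+1 * coef_bound S L T * deriv_bound S L W) ^ D.-1))
      < (S * M)`!].
Proof.
(* Apart from the powers with exponent S * M, the left side will be at most W^(k1 * W); [S] is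
   chosen large against [k1]. *)
pose k1 := 14 + D + D * (9 + D).
pose S := D * (2 * D.+1 * k1).+1.
have SE : S = D * (2 * D.+1 * k1).+1 by [].
have S_gt0 : 0 < S by rewrite muln_gt0 D_gt0.
clearbody S; pose lc := 2 * D * S; have lcE : lc = 2 * D * S by [].
pose k := 8 * D * D * c; have kE : k = 8 * D * D * c by [].
clearbody k.
(* Any [t] satisfying [t1] to [t7] would do; the sum is a convenient one. *)
pose t := (k * lc) ^ (2 * D.+1) + lc * (D * D * S * c) + 2 * D * c * lc + c + D * c + D * S * c + D.+4.
have t1 : (k * lc) ^ (2 * D.+1) <= t by rewrite /t; lia.
have t2 : lc * (D * D * S * c) <= t by rewrite /t; lia.
have t3 : 2 * D * c * lc <= t by rewrite /t; lia.
have t4 : c <= t by rewrite /t; lia.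
have t5 : D * c <= t by rewrite /t; lia.
have t6 : D * S * c <= t by rewrite /t; lia.
have t7 : D.+4 <= t by rewrite /t; lia.
have lc_gt0 : 0 < lc by rewrite !muln_gt0 D_gt0.
clearbody lc; move: t1 t2 t3 t4 t5 t6 t7; move: t => t t1 t2 t3 t4 t5 t6 t7.
have t_gt0 : 0 < t by lia.
pose T := t ^ D.+1; pose L := lc * t ^ D.
have L_gt0 : 0 < L by rewrite muln_gt0 lc_gt0 expn_gt0 t_gt0.
have T_gt0 : 0 < T by rewrite expn_gt0 t_gt0.
have tT : t <= T by rewrite -{1}[t]expn1 leq_pexp2l.
have LE : L ^ D.+1 = lc ^ D.+1 * T ^ D by rewrite expnMn -!expnM mulnC [D * _]mulnC mulnC.
exists S, L, T; split=> //.
  by rewrite LE lcE -(mulnA (T ^ D)) mulnCA [leqRHS]mulnC leq_mul2l mulnA unknowns_le ?orbT.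
move=> W M TW MW WDM.
have tW : t <= W by lia.
have W_gt0 : 0 < W by lia.
have LW x : lc * x <= t -> x * L <= W.
  by move=> xt; rewrite /L mulnA (leq_trans _ TW) // /T expnS leq_mul2r mulnC xt orbT.
(* Bookkeeping of logarithmic sizes in units of W log W: weights add under products. *)
pose le_wt x j := x <= W ^ (j * W).
have wtM x y i j : le_wt x i -> le_wt y j -> le_wt (x * y) (i + j).
  by move=> xi yj; rewrite /le_wt mulnDl expnD leq_mul.
have wt_le x y j : x <= y -> le_wt y j -> le_wt x j.
  by move=> xy; apply: leq_trans.
have wtW x : x <= W -> le_wt x 1.
  move=> xW; rewrite /le_wt mul1n (leq_trans xW) // -[leqLHS]expn1.
  by rewrite leq_pexp2l.
have wtX x e j : x <= W -> e <= j * W -> le_wt (x ^ e) j.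
  move=> xW eW; rewrite /le_wt.
  by apply: (leq_trans (leq_expr e xW)); rewrite leq_pexp2l.
have wtXM x i e : le_wt x i -> le_wt (x ^ e) (i * e).
  by move=> xi; rewrite /le_wt mulnAC expnM leq_expr.
have LWW : L <= W by rewrite -[L]mul1n; apply/LW/(leq_trans _ t2); rewrite muln1 leq_pmulr // !muln_gt0 D_gt0 S_gt0.
have w_wt : le_wt (c ^ (D * D * L * S)) 1.
  apply: (wtX); first exact: leq_trans tW.
  have -> : D * D * L * S = D * D * S * L by ring.
  rewrite mul1n; apply: (LW); apply: leq_trans t2; rewrite leq_mul2l.
  by apply/orP; right; rewrite leq_pmulr.
pose K0 := c + D * L * c.
have K0L : K0 <= 2 * D * c * L.
  rewrite /K0 (_ : 2 * D * c * L = D * c * L + D * L * c); last by ring.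
  by rewrite leq_add2r (leq_trans (leq_pmull c D_gt0)) // leq_pmulr.
have K0W : K0 <= W by apply: leq_trans K0L _; apply: (LW); rewrite mulnC.
have DSc_wt : le_wt ((D * S * c) ^ L) 1.
  by apply: (wtX); [lia | rewrite mul1n].
have LL_wt : le_wt (L ^ L) 1 by apply: (wtX) => //; rewrite mul1n.
have db_wt r j : r <= j * W -> le_wt (deriv_bound S L r) (1 + (1 + j + 1)).
  move=> rj; apply: (wtM _ _ _ _ w_wt); apply: (wtM _ _ _ _ _ DSc_wt).
  by apply: (wtM _ _ _ _ LL_wt); apply: (wtX).
have U_wt : le_wt (L ^ D.+1) 1.
  by apply: (wtX) => //; lia.
have P_wt : le_wt (coef_bound S L T) (4 + D).
  have -> : 4 + D = 1 + (1 + (1 + D + 1)) by lia.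
  by apply: (wtM) => //; apply: (db_wt); rewrite leq_mul2l TW orbT.
pose X := c ^ (D * D * L * S) * ((D * c) ^ W *
      (4 * (L ^ D.+1 * coef_bound S L T * deriv_bound S L (W - M)) * M`!) *
      (D * (L ^ D.+1 * coef_bound S L T * deriv_bound S L W) ^ D.-1)).
have DW : D.+4 <= W by apply: leq_trans t7 tW.
have X_wt : le_wt X k1.
  have X1 : le_wt X (1 + (1 + (1 + (1 + (4 + D) + (1 + (1 + 1 + 1))) + 1)
      + (1 + (1 + (4 + D) + (1 + (1 + 1 + 1))) * D.-1))).
    apply: (wtM _ _ _ _ w_wt); apply: (wtM); first apply: (wtM).
    - by apply: (wtX); [exact: leq_trans t5 tW | rewrite mul1n].
    - apply: (wtM); first apply: (wtM).
      + by apply: (wtW); apply: leq_trans DW; rewrite !ltnS.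
      + apply: (wtM); first exact: (wtM).
        by apply: (db_wt); rewrite mul1n leq_subr.
      + by apply: wt_le (fact_le_expnn M) _; apply: (wtX); rewrite ?mul1n.
    - apply: (wtM); first by apply: (wtW); apply: leq_trans DW; do 4!apply: leqW.
      apply: (wtXM); apply: (wtM); first exact: (wtM).
      by apply: (db_wt); rewrite mul1n.
  apply: leq_trans X1 _; rewrite leq_pexp2l // leq_mul2r; apply/orP; right.
  by rewrite /k1; move: D_gt0; clear; case: D => // d _ /=; nia.
set Q := S * M.
have QE : W * (2 * D.+1 * k1).+1 <= Q 
  by apply: leq_trans (leq_mul WDM (leqnn _)) _; rewrite /Q SE mulnAC.
(* Otherwise Q^Q <= 4^Q Q! and W <= D * M bound W^Q by X * (k * L)^Q. *)
rewrite ltnNge; apply/negP => H.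
have {H} H : W ^ Q <= X * (k * L) ^ Q.
  apply: (@leq_trans (D ^ Q * M ^ Q)); first by rewrite -expnMn leq_expr.
  have SQ : 0 < S ^ Q by rewrite expn_gt0 S_gt0.
  rewrite -(leq_pmul2l SQ) mulnCA -expnMn.
  apply: (@leq_trans (D ^ Q * (4 ^ Q * Q`!))).
    by rewrite leq_mul2l expnn_le_fact orbT.
  apply: (@leq_trans (D ^ Q * (4 ^ Q * (X * K0 ^ Q * S ^ Q)))).
    rewrite !leq_mul2l; apply/orP; right; apply/orP; right.
    apply: leq_trans H _; apply: eq_leq.
    by rewrite /X /deriv_bound -/K0 expnD; move: (S ^ Q) (K0 ^ Q); lia.
  have -> : D ^ Q * (4 ^ Q * (X * K0 ^ Q * S ^ Q)) =
    S ^ Q * (X * (D * (4 * K0)) ^ Q).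
    by rewrite !expnMn; move: (S ^ Q) (K0 ^ Q) (D ^ Q) (4 ^ Q); lia.
  rewrite !leq_mul2l; apply/orP; right; apply/orP; right.
  apply: leq_expr; apply: (@leq_trans (D * (4 * (2 * D * c * L)))).
    by rewrite !leq_mul2l K0L !orbT.
  by rewrite kE; apply: eq_leq; ring.
(* The exponent is twice D + 1 so that the constant (k * lc)^(2 * D.+1), at most t, costs one power
   of W on top of T^(2 * D), and one power of W out of 2 * D + 2 is still saved. *)
have kLW : (k * L) ^ (2 * D.+1) <= W ^ (2 * D).+1.
  rewrite expnMn [2 * D.+1]mulnC [L ^ _]expnM LE expnMn -!expnM mulnA -expnMn.
  rewrite [D.+1 * 2]mulnC [D * 2]mulnC expnS.
  by apply: leq_mul; [exact: leq_trans t1 tW | rewrite expnM leq_expr].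
have eE : 2 * D.+1 = (2 * D).+2 by rewrite mulnS.
move: QE kLW (leq_expr (2 * D.+1) H); rewrite eE; set e := (2 * D).+2 => QE kLW.
have kLW' : (k * L) ^ (Q * e) <= W ^ ((2 * D).+1 * Q).
  by rewrite [Q * e]mulnC expnM [leqRHS]expnM leq_expr.
rewrite expnMn -2!expnM.
move=> /leq_trans/(_ (leq_mul (leq_expr e X_wt) kLW')).
rewrite -expnM -expnD leq_exp2l; last by apply: leq_trans DW.
rewrite leqNgt => /negP; apply; rewrite [Q * e]mulnC mulSn ltn_add2r.
apply: leq_trans QE; rewrite (_ : W * (e * k1).+1 = W + k1 * W * e); last by ring.
by rewrite -[ltnLHS]add0n ltn_add2r.
Qed.
End ParameterChoice.

Local Open Scope ring_scope.

(** * Number fields as rational spans, acting on lattices by integer matrices *)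

Section NumberField.
Variable C : numClosedFieldType.

Definition rat_span (I : finType) (g : I -> C) (x : C) :=
  exists q : I -> rat, x = \sum_i ratr (q i) * g i.

(** The span of [g] is then a finite-dimensional subalgebra, which stands for the number field. *)
Definition rat_algebra (I : finType) (g : I -> C) :=
  rat_span g 1 /\ forall i j, rat_span g (g i * g j).

Lemma rat_spanD (I : finType) (g : I -> C) x y :
  rat_span g x -> rat_span g y -> rat_span g (x + y).
Proof.
move=> [q ->] [r ->]; exists (fun i => q i + r i).
by rewrite -big_split; apply: eq_bigr => i _; rewrite rmorphD mulrDl.
Qed.

Lemma rat_spanZ (I : finType) (g : I -> C) a x :
  rat_span g x -> rat_span g (ratr a * x).
Proof.
move=> [q ->]; exists (fun i => a * q i).
by rewrite mulr_sumr; apply: eq_bigr => i _; rewrite rmorphM mulrA.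
Qed.

Lemma rat_span_gen (I : finType) (g : I -> C) i : rat_span g (g i).
Proof.
exists (fun j => (j == i)%:R); rewrite (bigD1 i) //= eqxx rmorph1 mul1r.
by rewrite big1 ?addr0 // => j /negPf->; rewrite rmorph0 mul0r.
Qed.

Lemma rat_span0 (I : finType) (g : I -> C) : rat_span g 0.
Proof. by exists (fun => 0); rewrite big1 // => i _; rewrite rmorph0 mul0r. Qed.

Lemma rat_span_sum (I : finType) (g : I -> C) (J : finType) (f : J -> C) :
  (forall j, rat_span g (f j)) -> rat_span g (\sum_j f j).
Proof.
by move=> fP; apply: big_ind => //; [exact: rat_span0 | exact: rat_spanD].
Qed.

Lemma rat_span_sub (I J : finType) (g : I -> C) (h : J -> C) x :
  (forall i, rat_span h (g i)) -> rat_span g x -> rat_span h x.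
Proof.
by move=> gh [q ->]; apply: rat_span_sum => i; apply: rat_spanZ.
Qed.

Lemma rat_algebraM (I : finType) (g : I -> C) x y :
  rat_algebra g -> rat_span g x -> rat_span g y -> rat_span g (x * y).
Proof.
move=> [_ gM] [q ->] [r ->]; rewrite mulr_suml; apply: rat_span_sum => i.
rewrite mulr_sumr; apply: rat_span_sum => j.
by rewrite mulrACA -rmorphM; apply: rat_spanZ.
Qed.

(** Division by a polynomial of degree d that kills x puts every power of x in the span of the first
    d, so the products g_i x^j with j < d span an algebra. *)
Lemma rat_algebra_adjoin (I : finType) (g : I -> C) (x : C) :
  rat_algebra g -> algebraicOver (ratr : rat -> C) x ->
  exists (J : finType) (h : J -> C),
    [/\ rat_algebra h, forall y, rat_span g y -> rat_span h y & rat_span h x].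
Proof.
move=> gA [p p0 rpx].
pose d := (size p).-1.
have szp : (1 < size p)%N.
  rewrite ltnNge; apply: contraL rpx => szp.
  rewrite (size1_polyC szp) map_polyC /= rootC fmorph_eq0.
  by apply: contraNneq p0 => p00; rewrite (size1_polyC szp) p00.
have dE : d.+1 = size p by rewrite /d prednK // ltnW.
have powP k : rat_span (fun i : 'I_d => x ^+ i) (x ^+ k).
  have /(congr1 (fun q => (map_poly (ratr : rat -> C) q).[x])) :=
    divp_eq 'X^k p.
  rewrite /= rmorphD rmorphM /= hornerD hornerM (eqP (rpx)) mulr0 add0r.
  rewrite map_polyXn hornerXn => ->.
  exists (fun i : 'I_d => ('X^k %% p)`_i).
  rewrite (@horner_coef_wide _ d).
    by apply: eq_bigr => i _; rewrite coef_map.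
  by rewrite size_map_poly -ltnS dE ltn_modpN0.
pose h (j : I * 'I_d) := g j.1 * x ^+ j.2.
have hM u v : rat_span g u -> rat_span (fun i : 'I_d => x ^+ i) v ->
    rat_span h (u * v).
  move=> [q ->] [r ->]; rewrite mulr_suml; apply: rat_span_sum => i.
  rewrite mulr_sumr; apply: rat_span_sum => j.
  by rewrite mulrACA -rmorphM; apply/rat_spanZ/(rat_span_gen h (i, j)).
have [g1 gM] := gA.
exists (I * 'I_d)%type, h; split; first split.
- by rewrite -[1]mulr1 -{2}(expr0 x); apply: hM.
- move=> [i a] [j b]; rewrite /h /= mulrACA -exprD; exact: hM.
- by move=> y gy; rewrite -[y]mulr1 -(expr0 x); apply: hM.
- by rewrite -[x]mul1r -(expr1 x); apply: hM.
Qed.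

Lemma rat_algebra_exists (s : seq C) :
  (forall x, x \in s -> algebraicOver (ratr : rat -> C) x) ->
  exists n (g : 'I_n -> C), rat_algebra g /\ forall x, x \in s -> rat_span g x.
Proof.
move=> sP; suff [I [g [gA gs]]] : exists (I : finType) (g : I -> C),
    rat_algebra g /\ forall x, x \in s -> rat_span g x.
  exists #|I|, (fun i : 'I_#|I| => g (enum_val i)).
  have gg y : rat_span g y -> rat_span (fun i : 'I_#|I| => g (enum_val i)) y.
    apply: rat_span_sub => i.
    have := rat_span_gen (fun i : 'I_#|I| => g (enum_val i)) (enum_rank i).
    by rewrite enum_rankK.
  split; last by move=> x /gs/gg.
  by split; [apply: gg; case: gA | move=> i j; apply: gg; case: gA].
elim: s sP => [|x s IHs] sP.
  exists unit, (fun => 1); split=> //.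
  have u1 : rat_span (fun _ : unit => 1) 1 by exact: (rat_span_gen _ tt).
  by split=> // _ _; rewrite mulr1.
have [|I [g [gA gs]]] := IHs.
  by move=> y ys; apply: sP; rewrite inE ys orbT.
have [|J [h [hA gh hx]]] := rat_algebra_adjoin gA (_ : algebraicOver _ x).
  by apply: sP; rewrite inE eqxx.
exists J, h; split=> // y; rewrite inE => /orP[/eqP-> //|/gs]; exact: gh.
Qed.

Definition rat_free n (g : 'I_n -> C) :=
  forall q : 'I_n -> rat, \sum_i ratr (q i) * g i = 0 -> forall i, q i = 0.

(** A generating family of least length is free, since a relation would allow one element to be
    dropped. *)
Lemma rat_basis_exists (s : seq C) :
  (forall x, x \in s -> algebraicOver (ratr : rat -> C) x) ->
  exists n (g : 'I_n.+1 -> C),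
    [/\ rat_algebra g, rat_free g & forall x, x \in s -> rat_span g x].
Proof.
move=> /rat_algebra_exists sP.
pose P n := `[< exists g : 'I_n -> C,
  rat_algebra g /\ forall x, x \in s -> rat_span g x >].
have exP : exists n, P n.
  by case: sP => n [g gP]; exists n; apply/asboolP; exists g.
case: (ex_minnP exP) => -[|n] /asboolP[g [gA gs]] nmin.
  by case: gA => -[q /eqP]; rewrite big_ord0 oner_eq0.
exists n, g; split=> // q q0 j; apply/eqP/negPn/negP => qj.
suff : P n by move/nmin; rewrite ltnn.
apply/asboolP; exists (fun i => g (lift j i)).
have gg y : rat_span g y -> rat_span (fun i => g (lift j i)) y.
  apply: rat_span_sub => i; case: (unliftP j i) => [i' ->|->].
    exact: (rat_span_gen (fun i => g (lift j i))).
  have qj' : ratr (q j) != 0 :> C by rewrite fmorph_eq0.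
  exists (fun i => - (q j)^-1 * q (lift j i)).
  move: q0; rewrite (bigD1_ord j) //= => /eqP; rewrite addr_eq0 => /eqP H.
  apply: (mulfI qj'); rewrite H mulr_sumr -sumrN; apply: eq_bigr => k _.
  by rewrite rmorphM rmorphN fmorphV /=; field.
split; last by move=> x /gs/gg.
by split; [apply: gg; case: gA | move=> i k; apply: gg; case: gA].
Qed.

(** Multiplication by x on the lattice generated by the entries of [g]. Integrality and size of
    algebraic numbers are read off such integer matrices. *)
Definition int_acts n (g : 'cV[C]_n) (x : C) (M : 'M[int]_n) :=
  map_mx intr M *m g = x *: g.

Lemma int_acts_span n (g : 'I_n.+1 -> C) x :
  rat_algebra g -> rat_span g x ->
  exists N : nat, (0 < N)%N /\
    exists M, int_acts (\col_i g i) (N%:R * x) M.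
Proof.
move=> gA gx.
have /choice[q qE] i : exists q : 'I_n.+1 -> rat,
    x * g i = \sum_j ratr (q j) * g j.
  by apply: rat_algebraM => //; exact: rat_span_gen.
pose N := \prod_i \prod_j `|denq (q i j)|%N.
exists N; split; first by
  do 2![rewrite prodn_gt0 // => ?]; rewrite absz_gt0 denq_neq0.
have qN i j : exists z : int, N%:R * q i j = z%:~R.
  have /dvdnP[k ->] : (`|denq (q i j)| %| N)%N.
    by rewrite /N (bigD1 i) //= (bigD1 j) //= !dvdn_mulr.
  exists (k%:Z * numq (q i j)); rewrite -[X in _ * X = _]divq_num_den.
  rewrite natrM intrM mulrA.
  have -> : (`|denq (q i j)|%N%:R : rat) = (denq (q i j))%:~R.
    by rewrite -[RHS](ger0_norm (_ : 0 <= _)) ?ler0z ?denq_ge0 // -intr_norm.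
  have d0 : ((denq (q i j))%:Q) != 0 by rewrite intr_eq0 denq_neq0.
  by field.
have /choice[M ME] i : exists f : 'I_n.+1 -> int,
    forall j, N%:R * q i j = (f j)%:~R by case: (choice (qN i)) => f; exists f.
exists (\matrix_(i, j) M i j); apply/colP => i; rewrite !mxE -mulrA qE mulr_sumr.
apply: eq_bigr => j _; rewrite !mxE mulrA -(ratr_nat C) -rmorphM ME.
by congr (_ * _); exact/esym/ratr_int.
Qed.

(** Scaling a rational basis by a common denominator of its own multiplication tables makes its
    entries act integrally as well. *)
Lemma int_lattice_exists (s : seq C) :
  (forall x, x \in s -> algebraicOver (ratr : rat -> C) x) ->
  exists n (g : 'cV[C]_n.+1),
    [/\ forall v : 'rV[int]_n.+1, map_mx intr v *m g = 0 -> v = 0,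
        forall i, exists M, int_acts g (g i 0) M &
        forall x, x \in s -> exists N : nat, (0 < N)%N /\
          exists M, int_acts g (N%:R * x) M].
Proof.
move=> /rat_basis_exists[n [g [gA gF gs]]].
have /choice[N NP] i := int_acts_span gA (rat_span_gen g i).
pose Nt := (\prod_i N i)%N.
have Nt0 : (Nt%:R : C) != 0.
  rewrite pnatr_eq0 -lt0n prodn_gt0 // => i; by case: (NP i).
exists n, (Nt%:R *: \col_i g i); split.
- move=> v; rewrite -scalemxAr => /eqP; rewrite scaler_eq0 (negPf Nt0) /=.
  move=> /eqP/matrixP/(_ 0 0); rewrite !mxE => v0; apply/rowP => i.
  have /gF/(_ i)/eqP : \sum_i ratr ((v 0 i)%:~R) * g i = 0.
    by rewrite -[RHS]v0; apply: eq_bigr => j _; rewrite !mxE ratr_int.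
  by rewrite intr_eq0 mxE => /eqP.
- move=> i; have [_ [M HM]] := NP i.
  exists (((\prod_(j | j != i) N j)%N%:R : int) *: M); rewrite /int_acts !mxE.
  rewrite -scalemxAr !map_mxZ -scalemxAl HM !scalerA; congr (_ *: _).
  by rewrite /Nt (bigD1 i) //= natrM rmorph_nat; ring.
- move=> x /gs gx; have [N' [N'0 [M HM]]] := int_acts_span gA gx.
  exists N'; split=> //; exists M.
  by rewrite /int_acts -scalemxAr HM !scalerA mulrC.
Qed.

End NumberField.

(** * Siegel's lemma *)

Section Siegel.
Local Open Scope nat_scope.

(** Pigeonhole principle, with B = #|J| * H: at least (B + 1)^(2 #|I|) vectors have entries in
    [0, B], and the system takes at most (B^2 + 1)^#|I| values on them. The difference of two
    vectors with equal values is a solution. *)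
Lemma siegel (I J : finType) (A : I -> J -> int) (H : nat) :
  0 < #|I| -> 2 * #|I| <= #|J| -> 0 < H ->
  (forall i j, `|A i j| <= H) ->
  exists p : J -> int,
    [/\ exists j, p j != 0%R, forall i, (\sum_j A i j * p j)%R = 0%R
      & forall j, `|p j| <= #|J| * H].
Proof.
move=> I0 IJ H0 AH; set U := #|J| in IJ *; pose B := U * H.
have U0 : 0 < U by lia.
have B0 : 0 < B by rewrite muln_gt0 U0.
(* Replacing x by B - x at a negative coefficient shifts each linear form by a constant and keeps
   all terms natural numbers. *)
pose term i j (x : nat) := if (0 <= A i j)%R then `|A i j| * x
                           else `|A i j| * (B - x).
have termP i (f : {ffun J -> 'I_B.+1}) : \sum_j term i j (f j) < (B * B).+1.
  rewrite ltnS; apply: (@leq_trans (\sum_(j : J) H * B)); last first.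
    by rewrite sum_nat_const mulnA.
  apply: leq_sum => j _.
  by rewrite /term; case: ifP => _; apply: leq_mul => //;
    [rewrite -ltnS | rewrite leq_subr].
pose F (f : {ffun J -> 'I_B.+1}) := [ffun i => Ordinal (termP i f)].
have /injectivePn[f [f' ff' /ffunP Fff]] : ~~ injectiveb F.
  apply/negP => /injectiveP /leq_card; apply/negP; rewrite -ltnNge.
  rewrite !card_ffun !card_ord.
  apply: (@leq_trans (B.+1 ^ (2 * #|I|))); last by rewrite leq_pexp2l.
  rewrite expnM ltn_exp2r //; lia.
exists (fun j => ((f j : nat)%:Z - (f' j : nat)%:Z)%R); split.
- apply/existsP; apply: contraNT ff' => /existsPn f0; apply/eqP/ffunP => j.
  by have := f0 j; rewrite negbK subr_eq0 => /eqP[] ?; exact/val_inj.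
- move=> i; have := Fff i; rewrite !ffunE => /(congr1 val) /= E.
  apply/eqP; rewrite -subr_eq0 subr0; apply/eqP.
  transitivity (\sum_j ((term i j (f j))%:Z - (term i j (f' j))%:Z))%R.
    apply: eq_bigr => j _; rewrite /term.
    have fB : (f j <= B)%N by rewrite -ltnS.
    have fB' : (f' j <= B)%N by rewrite -ltnS.
    case: ifP => [A0|/negbT]; first by rewrite !PoszM gez0_abs // mulrBr.
    rewrite -ltNge => A0; rewrite !PoszM ltz0_abs // -!subzn //; ring.
  by rewrite big_split /= sumrN -!(big_morph Posz PoszD (erefl _)) E subrr.
- move=> j; have := ltn_ord (f j); have := ltn_ord (f' j); rewrite -/B; lia.
Qed.

End Siegel.

(** * Liouville's inequality *)

Lemma det_row_bound n (M : 'M[int]_n) (B : nat) :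
  (forall i, \sum_j `|M i j|%N <= B)%N -> (`|\det M|%N <= B ^ n)%N.
Proof.
elim: n M => [|n IHn] M MB; first by rewrite det_mx00.
rewrite (expand_det_row M ord0) expnS; apply: (@leq_trans
  (\sum_j `|M ord0 j| * B ^ n)%N); last by rewrite -big_distrl leq_mul2r MB orbT.
rewrite -lez_nat abszE; apply: le_trans (ler_norm_sum _ _ _) _.
rewrite (big_morph Posz PoszD (erefl _)) ler_sum // => j _.
rewrite /cofactor !normrM normrX normrN1 expr1n mul1r PoszM ler_wpM2l //.
rewrite -abszE lez_nat; apply: IHn => k.
apply: leq_trans (MB (lift ord0 k)); rewrite [leqRHS](bigD1_ord j) //=.
by rewrite (leq_trans _ (leq_addl _ _)) // leq_sum // => i _; rewrite !mxE.
Qed.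

Section Liouville.
Variables (C : numClosedFieldType) (n : nat) (g : 'cV[C]_n.+1).

(** The largest row sum of an integer matrix by which x acts is subadditive and submultiplicative;
    it takes the place of the size of the conjugates. *)
Definition int_size (x : C) (B : nat) :=
  exists M, int_acts g x M /\ forall i, (\sum_j `|M i j|%N <= B)%N.

Lemma int_size_le x B B' : (B <= B')%N -> int_size x B -> int_size x B'.
Proof. by move=> BB [M [gM MB]]; exists M; split=> // i; apply: leq_trans BB. Qed.

Lemma int_sizeD x y B B' :
  int_size x B -> int_size y B' -> int_size (x + y) (B + B').
Proof.
move=> [M [gM MB]] [N [gN NB]]; exists (M + N); split.
  by rewrite /int_acts map_mxD mulmxDl gM gN scalerDl.
move=> i; apply: leq_trans (leq_add (MB i) (NB i)); rewrite -big_split.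
by apply: leq_sum => j _ /=; rewrite mxE -lez_nat PoszD !abszE ler_normD.
Qed.

Lemma int_sizeM x y B B' :
  int_size x B -> int_size y B' -> int_size (x * y) (B * B').
Proof.
move=> [M [gM MB]] [N [gN NB]]; exists (M *m N); split.
  by rewrite /int_acts map_mxM -mulmxA gN -scalemxAr gM scalerA mulrC.
move=> i; apply: (@leq_trans (\sum_k `|M i k| * B')%N); last first.
  by rewrite -big_distrl leq_mul2r MB orbT.
apply: (@leq_trans (\sum_k \sum_j `|M i k| * `|N k j|)%N); last first.
  by apply: leq_sum => k _; rewrite -big_distrr leq_mul2l NB orbT.
rewrite exchange_big; apply: leq_sum => j _; rewrite mxE.
rewrite -lez_nat abszE; apply: le_trans (ler_norm_sum _ _ _) _.
by rewrite (big_morph Posz PoszD (erefl _)) ler_sum // => k _; rewrite PoszM !abszE normrM.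
Qed.

Lemma int_size_int (z : int) : int_size z%:~R `|z|.
Proof.
exists (z%:M); split; first by rewrite /int_acts map_scalar_mx mul_scalar_mx.
move=> i; rewrite (bigD1 i) //= !mxE eqxx big1 ?addn0 // => j ji.
by rewrite !mxE eq_sym (negPf ji).
Qed.

Lemma int_acts_size x M : int_acts g x M -> exists B, int_size x B.
Proof.
move=> gM; exists (\sum_i \sum_j `|M i j|)%N; exists M; split=> // i.
by rewrite [leqRHS](bigD1 i) //= leq_addr.
Qed.

Hypothesis g_free : forall v : 'rV[int]_n.+1, map_mx intr v *m g = 0 -> v = 0.

Lemma max_entry : exists i, g i 0 != 0 /\ forall j, `|g j 0| <= `|g i 0|.
Proof.
have [i imax] : exists i, forall j, `|g j 0| <= `|g i 0|.
    suff H m (f : 'I_m.+1 -> C) : exists i, forall j, `|f j| <= `|f i|.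
      exact: (H n (fun j => g j 0)).
    elim: m f => [|m IHm] f.
      by exists ord0 => j; rewrite ord1.
    have [i imax] := IHm (fun j => f (lift ord0 j)).
    have [le|/ltW le] := real_leP (normr_real (f ord0))
                                  (normr_real (f (lift ord0 i))).
      by exists (lift ord0 i) => j; case: (unliftP ord0 j) => [k|] ->.
    exists ord0 => j; case: (unliftP ord0 j) => [k|] -> //.
    exact: le_trans (imax k) le.
exists i; split=> //; apply: contraT; rewrite negbK => /eqP gi0.
have /(_ (delta_mx 0 0)) := g_free.
suff -> : g = 0 by rewrite mulmx0 => /(_ erefl)/matrixP/(_ 0 0); rewrite !mxE.
apply/colP => j; rewrite mxE; apply/eqP; rewrite -normr_le0.
by rewrite (le_trans (imax j)) // gi0 normr0.
Qed.

(** For the matrix M of x, det M is a nonzero integer and det M * g_i = x * sum_j adj(M)_ij g_j. If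
    g_i has the largest modulus, the sum is at most |g_i| times n + 1 minors, each of modulus at
    most B^n. *)
Lemma liouville x B : int_size x B -> x != 0 ->
  1 <= `|x| * (n.+1 * B ^ n)%N%:R.
Proof.
move=> [M [gM MB]] x0; have [i [gi0 gi]] := max_entry.
have detM : \det M != 0.
  apply/negP => /det0P[v v0 vM]; case/eqP: v0; apply: g_free.
  apply/eqP; rewrite -(can_eq (scalerK x0)) scaler0 scalemxAr -gM mulmxA.
  by rewrite -map_mxM vM map_mx0 mul0mx.
have : (\det M)%:~R * g i 0 = x * \sum_j (\adj M i j)%:~R * g j 0.
  have := congr1 (mulmx (map_mx intr (\adj M))) gM.
  rewrite mulmxA -map_mxM mul_adj_mx map_scalar_mx mul_scalar_mx -scalemxAr.
  move=> /matrixP/(_ i 0); rewrite !mxE => ->; congr (_ * _).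
  by apply: eq_bigr => j _; rewrite mxE.
move=> /(congr1 Num.norm); rewrite !normrM => E.
rewrite -(ler_pM2r (_ : 0 < `|g i 0|)) ?normr_gt0 // mul1r.
apply: (@le_trans _ _ (`|(\det M)%:~R| * `|g i 0|)).
  rewrite ler_peMl // -intr_norm ler1z; lia.
rewrite E -mulrA ler_wpM2l //; apply: le_trans (ler_norm_sum _ _ _) _.
rewrite natrM -mulrA.
have -> : (n.+1%:R : C) = \sum_(j < n.+1) 1 by rewrite sumr_const card_ord.
rewrite mulr_suml.
apply: ler_sum => j _; rewrite mul1r normrM ler_pM //.
rewrite -intr_norm -[(_ ^ _)%:R]mulrz_nat ler_int mxE /cofactor normrM normrX.
rewrite normrN1 expr1n mul1r; rewrite -abszE natz lez_nat; apply: det_row_bound => k.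
apply: leq_trans (MB (lift j k)); rewrite [leqRHS](bigD1_ord i) //=.
by rewrite (leq_trans _ (leq_addl _ _)) // leq_sum // => l _; rewrite !mxE.
Qed.

End Liouville.

(** * Rolle's theorem with multiplicities, and an interpolation bound *)

Section Rolle.
Variables (R : realType) (h : nat -> R -> R).
Hypothesis dh : forall (n : nat) (t : R), is_derive t 1 (h n) (h n.+1 t).

(* Zeros counted with multiplicity: r equal consecutive terms of x are a zero
   of order r. *)
Definition rolle_zeros (a b : R) (k N : nat) := exists x : nat -> R,
  [/\ forall i j, (i <= j)%N -> (j < N)%N -> x i <= x j,
      forall i, (i < N)%N -> a <= x i <= b &
      forall i j, (i <= j)%N -> (j < N)%N -> x i = x j ->
        h (k + (j - i))%N (x i) = 0].

(** Consecutive zeros that differ give a zero of the derivative strictly between them; equal ones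
    give a zero at the same point, of order one less. Strictness ensures that equal terms of the new
    sequence come only from multiple zeros of the old one. *)
Lemma rolle_zeros_derive a b k N :
  rolle_zeros a b k N.+1 -> rolle_zeros a b k.+1 N.
Proof.
move=> [x [x_le xab x0]].
have /choice[y yP] i : exists y, (i < N)%N ->
    [/\ x i <= y <= x i.+1, h k.+1 y = 0 &
        y = x i \/ y = x i.+1 -> x i = x i.+1].
  have [iN|] := ltnP i N; last by exists 0.
  have := x_le i i.+1 (leqnSn i) iN; rewrite le_eqVlt => /orP[/eqP xE|xlt].
    exists (x i); rewrite -xE lexx; split=> //.
    by have := x0 i i.+1 (leqnSn i) iN xE; rewrite subSnn addn1.
  have [|||c /[!in_itv]/= /andP[ac cb] [_ c0]] := @Rolle R (h k) _ _ xlt.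
  - by move=> c _; have [] := dh k c.
  - apply: derivable_within_continuous => c _; by have [] := dh k c.
  - rewrite -[k]addn0 -{1}(subnn i) x0 //; last by apply: ltnW.
    by rewrite -(subnn i.+1) x0.
  exists c => _; rewrite !ltW //; split=> //.
    by rewrite -c0; apply/esym; have [] := dh k c.
  by case=> cE; [move: ac|move: cb]; rewrite cE ltxx.
exists y; split.
- move=> i j; rewrite leq_eqVlt => /orP[/eqP-> //|ij jN].
  have [/andP[_ yi] _ _] := yP i (ltn_trans ij jN).
  have [/andP[yj _] _ _] := yP j jN.
  apply: le_trans yi (le_trans _ yj); exact: (x_le i.+1 j ij (ltnW jN)).
- move=> i iN; have [/andP[yi yi'] _ _] := yP i iN.
  have /andP[xa _] := xab i (ltnW iN); have /andP[_ xb] := xab i.+1 iN.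
  by rewrite (le_trans xa yi) (le_trans yi' xb).
- move=> i j; rewrite leq_eqVlt => /orP[/eqP<- iN _|ij jN yij].
    by rewrite subnn addn0; case: (yP i iN).
  have [/andP[_ yi] _ xi] := yP i (ltn_trans ij jN).
  have [/andP[yj _] _ xj] := yP j jN.
  have xx := x_le i.+1 j ij (ltnW jN).
  have yxi : y i = x i.+1.
    by apply/eqP; rewrite eq_le yi yij (le_trans xx yj).
  have yxj : y j = x j.
    by apply/eqP; rewrite eq_le yj -yij (le_trans yi xx).
  have xi' := xi (or_intror yxi); have xj' := xj (or_introl yxj).
  have xij : x i = x j.+1 by rewrite xi' -yxi yij yxj xj'.
  have := x0 i j.+1 (leqW (ltnW ij)) jN xij.
  by rewrite yxi -xi' (subSn (ltnW ij)) addnS addSn.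
Qed.

Lemma rolle_iter a b N : rolle_zeros a b 0 N.+1 ->
  exists2 c, a <= c <= b & h N c = 0.
Proof.
have H k m : rolle_zeros a b k m.+1 -> exists2 c, a <= c <= b & h (k + m)%N c = 0.
  elim: m k => [|m IHm] k.
    move=> [x [_ xab x0]]; exists (x 0); first exact: xab.
    by have := x0 0 0 (leqnn _) (ltnSn _) erefl.
  by move=> /rolle_zeros_derive/IHm; rewrite addSnnS.
exact: H.
Qed.

End Rolle.

Lemma derivn_XsubC_exp (R : comNzRingType) (s : R) M (q : {poly R}) :
  (forall n, (n < M)%N -> ((('X - s%:P) ^+ M * q)^`(n)).[s] = 0) /\
  ((('X - s%:P) ^+ M * q)^`(M)).[s] = M`!%:R * q.[s].
Proof.
elim: M q => [|M IHM] q.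
  by split=> //; rewrite derivn0 !mul1r.
have E : (('X - s%:P) ^+ M.+1 * q)^`() =
    ('X - s%:P) ^+ M * (M.+1%:R *: q + ('X - s%:P) * q^`()).
  rewrite derivM deriv_exp derivXsubC mul1r /= scaler_nat exprS.
  by rewrite mulrDr mulrnAr mulrnAl mulrA [_ ^+ M * ('X - _)]mulrC.
have [H1 H2] := IHM (M.+1%:R *: q + ('X - s%:P) * q^`()).
split=> [[|n] nM|].
- by rewrite derivn0 hornerM horner_exp hornerXsubC subrr expr0n mul0r.
- by rewrite /derivn iterSr -/(derivn n _) E H1.
- rewrite /derivn iterSr -/(derivn M _) E H2 hornerD hornerZ hornerM hornerXsubC.
  by rewrite subrr mul0r addr0 mulrA -natrM mulnC -factS.
Qed.

Lemma derivn_monic (R : nzRingType) (q : {poly R}) n :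
  q \is monic -> size q = n.+1 -> q^`(n) = n`!%:R%:P.
Proof.
move=> /monicP qm qs; apply/polyP => i; rewrite coef_derivn coefC.
case: i => [|i] /=.
  by rewrite addn0 ffactnn -qm lead_coefE qs /=.
by rewrite nth_default ?mul0rn // qs; lia.
Qed.

Section Hermite.
Variables (R : realType) (g : nat -> R -> R).
Hypothesis dg : forall (n : nat) (t : R), is_derive t 1 (g n) (g n.+1 t).

(** Let Q = prod_(s < S) (X - s)^M and subtract from g the multiple c Q for which the M-th
    derivative at s0 vanishes too. The difference has S M + 1 zeros with multiplicity, so at some
    point of [0, S] its derivative of order S M vanishes, that is, the one of g equals c (S M)!.
    This bounds c, hence the M-th derivative at s0. *)
Lemma hermite_bound (S M s0 : nat) (A : R) :
  (0 < M)%N -> (s0 < S)%N ->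
  (forall s j, (s < S)%N -> (j < M)%N -> g j s%:R = 0) ->
  (forall t, 0 <= t <= S%:R -> `|g (S * M)%N t| <= A) ->
  `|g M s0%:R| * ((S * M)`!)%:R <= A * (M`!)%:R * (S ^ (S * M))%:R.
Proof.
move=> M0 s0S g0 gA.
pose q := \prod_(s < S | s != s0 :> nat) ('X - (s%:R : R)%:P) ^+ M.
pose Q : {poly R} := ('X - (s0%:R)%:P) ^+ M * q.
have QE : Q = \prod_(s < S) ('X - (s%:R : R)%:P) ^+ M.
  by rewrite (bigD1 (Ordinal s0S)).
have [Qlow QM] := derivn_XsubC_exp s0%:R M q; rewrite -/Q in Qlow QM.
have qs0 : q.[s0%:R] != 0.
  rewrite horner_prod; apply/prodf_neq0 => s ss0.
  rewrite horner_exp hornerXsubC expf_neq0 // subr_eq0 eqr_nat.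
  by rewrite eq_sym.
have Q0 s : (s < S)%N -> forall n, (n < M)%N -> (Q^`(n)).[s%:R] = 0.
  move=> sS n nM; rewrite QE (bigD1 (Ordinal sS)) //=.
  have [Qs _] := derivn_XsubC_exp s%:R M
    (\prod_(i < S | i != Ordinal sS) ('X - (i%:R : R)%:P) ^+ M).
  exact: Qs.
have Qmonic : Q \is monic.
  by rewrite QE monic_prod // => i _; rewrite monic_exp // monicXsubC.
have Qsize : size Q = (S * M).+1.
  rewrite QE; elim: (S) => [|n IHn]; first by rewrite big_ord0 size_poly1.
  rewrite big_ord_recr /= size_Mmonic ?monic_exp ?monicXsubC //.
    by rewrite IHn size_exp_XsubC mulSn; lia.
  by rewrite -size_poly_eq0 IHn.
pose c := g M s0%:R / (M`!%:R * q.[s0%:R]).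
have fM : (M`!%:R : R) != 0 by rewrite pnatr_eq0 -lt0n fact_gt0.
pose h n t := g n t - c * (Q^`(n)).[t].
have dh (n : nat) (t : R) : is_derive t 1 (h n) (h n.+1 t).
  have dQ : is_derive t 1 (horner (Q^`(n))) (Q^`(n.+1)).[t].
    apply: DeriveDef; first exact: derivable_horner.
    by rewrite -derive1E -derivE derivnS.
  have := is_deriveB (dg n t) (is_deriveZ c dQ).
  by [].
(* The sorted list of zeros: every s < S occurs M times, except s0, which occurs M + 1 times. *)
pose v i := if (i <= s0 * M + M)%N then minn (i %/ M) s0 else (i.-1 %/ M)%N.
have vP i : (v i * M + (s0 < v i) <= i < (v i).+1 * M + (s0 <= v i))%N.
  rewrite /v; case: (leqP i (s0 * M + M)) => iM.
    have iE := divn_eq i M; have iM' := ltn_pmod i M0.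
    have [ds|ds] := leqP (i %/ M) s0.
      move: (i %/ M)%N (i %% M)%N iE iM' ds => d r iE iM' ds.
      by rewrite mulSn; case: (s0 <= d)%N; lia.
    move: (i %/ M)%N (i %% M)%N iE iM' ds => d r iE iM' ds.
    by rewrite ltnn leqnn mulSn; nia.
  have sd : (s0 < i.-1 %/ M)%N by rewrite leq_divRL // mulSn addnC; lia.
  have iE := divn_eq i.-1 M; have iM' := ltn_pmod i.-1 M0.
  rewrite sd (ltnW sd) !addn1 mulSn ltnS; lia.
have : exists2 t, 0 <= t <= S%:R & h (S * M)%N t = 0.
  apply: (rolle_iter dh); exists (fun i => (v i)%:R); split.
  - move=> i j ij jS; rewrite ler_nat leqNgt; apply/negP => vv.
    have := vP i; have := vP j; nia.
  - move=> i iS; rewrite ler0n ler_nat; have := vP i; nia.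
  - move=> i j ij jS /eqP; rewrite eqr_nat => /eqP vij; rewrite add0n.
    have vi := vP i; have vj := vP j; rewrite -vij in vj.
    have vS : (v i < S)%N by nia.
    have [ji|ji] := ltnP (j - i) M; first by rewrite /h g0 // Q0 // mulr0 subr0.
    have vs : v i = s0 by nia.
    have -> : (j - i = M)%N by rewrite vs in vi vj; nia.
    by rewrite /h vs QM /c divfK ?subrr // mulf_neq0.
move=> [t tS /eqP]; rewrite subr_eq0 => /eqP gt.
have := gA t tS; rewrite gt derivn_monic // hornerC /c.
rewrite normrM normrM normfV normrM !normr_nat => H.
have q_le : `|q.[s0%:R]| <= (S ^ (S * M))%:R.
  rewrite horner_prod normr_prod [(S * M)%N]mulnC expnM natrX.
  apply: (@le_trans _ _ (\prod_(s < S | s != s0 :> nat) (S ^ M)%:R)).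
    apply: ler_prod => s _; rewrite normr_ge0 horner_exp hornerXsubC normrX.
    rewrite natrX lerXn2r ?nnegrE //; have := ltn_ord s => sS.
    rewrite ler_norml; apply/andP; split.
      by rewrite lerBrDr addrC lerBlDr -natrD ler_nat; lia.
    by rewrite lerBlDr -natrD ler_nat; lia.
  have c1 : 1 <= ((S ^ M)%:R : R) by rewrite ler1n expn_gt0; lia.
  apply: (@le_trans _ _ (\prod_(s < S) (S ^ M)%:R)).
    by rewrite [leRHS](bigD1 (Ordinal s0S)) //= ler_peMl // prodr_ge0.
  by rewrite prodr_const card_ord.
have qn0 : 0 < `|q.[s0%:R]| by rewrite normr_gt0.
have Mn0 : 0 < (M`!%:R : R) by rewrite ltr0n fact_gt0.
have -> : `|g M s0%:R| * ((S * M)`!)%:R =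
  (`|g M s0%:R| / (M`!%:R * `|q.[s0%:R]|) * ((S * M)`!)%:R)
    * M`!%:R * `|q.[s0%:R]|.
  by field; rewrite fM normr_eq0 qs0.
by apply: ler_pM q_le; rewrite ?ler_wpM2r // !mulr_ge0 // invr_ge0 mulr_ge0.
Qed.
End Hermite.

Local Open Scope complex_scope.

(** * The complex exponential, and derivatives of complex functions of a real variable *)

Section ComplexParts.
Variable R : realType.
Implicit Types (x y z : R[i]).

Lemma cReD x y : complex.Re (x + y) = complex.Re x + complex.Re y.
Proof. by case: x; case: y. Qed.
Lemma cImD x y : complex.Im (x + y) = complex.Im x + complex.Im y.
Proof. by case: x; case: y. Qed.
Lemma cReN x : complex.Re (- x) = - complex.Re x.
Proof. by case: x. Qed.
Lemma cImN x : complex.Im (- x) = - complex.Im x.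
Proof. by case: x. Qed.
Lemma cReM x y : complex.Re (x * y) =
  complex.Re x * complex.Re y - complex.Im x * complex.Im y.
Proof. by case: x; case: y. Qed.
Lemma cImM x y : complex.Im (x * y) =
  complex.Re x * complex.Im y + complex.Im x * complex.Re y.
Proof. by case: x; case: y. Qed.
Lemma cReV x : complex.Re x^-1 =
  complex.Re x / (complex.Re x ^+ 2 + complex.Im x ^+ 2).
Proof. by case: x. Qed.
Lemma cImV x : complex.Im x^-1 =
  - complex.Im x / (complex.Re x ^+ 2 + complex.Im x ^+ 2).
Proof. by case: x => a b; rewrite mulNr. Qed.
Lemma complex_eq x y :
  complex.Re x = complex.Re y -> complex.Im x = complex.Im y -> x = y.
Proof. by case: x; case: y => /= ? ? ? ? -> ->. Qed.
Lemma Re_nat n : complex.Re (n%:R : R[i]) = n%:R.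
Proof. by elim: n => [|n IHn] //; rewrite -addn1 !natrD cReD IHn. Qed.
Lemma Im_nat n : complex.Im (n%:R : R[i]) = 0.
Proof. by elim: n => [|n IHn] //; rewrite -addn1 !natrD cImD IHn addr0. Qed.
Lemma natrC n : (n%:R : R)%:C = n%:R.
Proof. by apply: complex_eq; rewrite /= ?Re_nat ?Im_nat. Qed.
Lemma Re_le_norm x (A : R) : `|x| <= A%:C -> `|complex.Re x| <= A.
Proof. by move=> xA; rewrite -lecR (le_trans (normc_ge_Re x)). Qed.
Lemma norm_i : `|'i%C| = 1 :> R[i].
Proof. by rewrite normc_def /= expr0n expr1n add0r sqrtr1. Qed.
Lemma norm_real (a : R) : `|a%:C| = `|a|%:C :> R[i].
Proof. by rewrite normc_def /= expr0n addr0 sqrtr_sqr. Qed.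
Lemma Im_le_norm x (A : R) : `|x| <= A%:C -> `|complex.Im x| <= A.
Proof.
move=> xA; have -> : complex.Im x = complex.Re (x * -'i%C).
  by case: (x) => a b /=; ring.
by apply: Re_le_norm; rewrite normrM normrN norm_i mulr1.
Qed.
Lemma norm_le_ReIm x : `|x| <= (`|complex.Re x| + `|complex.Im x|)%:C.
Proof.
rewrite [in leLHS](complexE x); apply: le_trans (ler_normD _ _) _.
by rewrite normrM norm_i mul1r !norm_real -rmorphD.
Qed.

Definition cexp z : R[i] :=
  (expR (complex.Re z) * cos (complex.Im z))
  +i* (expR (complex.Re z) * sin (complex.Im z)).

Lemma cexp0 : cexp 0 = 1.
Proof. by rewrite /cexp /= expR0 cos0 sin0 mulr1 mulr0. Qed.

Lemma cexpD x y : cexp (x + y) = cexp x * cexp y.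
Proof.
apply: complex_eq; rewrite /= ?cReM ?cImM /= cReD cImD expRD ?cosD ?sinD /=; ring.
Qed.

Lemma cexp_neq0 x : cexp x != 0.
Proof.
apply/eqP => x0; have := cexpD x (- x).
by rewrite subrr cexp0 x0 mul0r => /eqP; rewrite oner_eq0.
Qed.

Lemma cexpN x : cexp (- x) = (cexp x)^-1.
Proof.
by apply: (mulfI (cexp_neq0 x)); rewrite -cexpD subrr cexp0 divff // cexp_neq0.
Qed.

Lemma cexp_sum (I : finType) (f : I -> R[i]) :
  cexp (\sum_i f i) = \prod_i cexp (f i).
Proof. exact: (big_morph cexp cexpD cexp0). Qed.

Lemma cexp_natM n x : cexp (n%:R * x) = cexp x ^+ n.
Proof.
elim: n => [|n IHn]; first by rewrite mul0r cexp0.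
by rewrite -addn1 natrD mulrDl mul1r cexpD IHn addn1 exprSr.
Qed.

Lemma cexp_intM (n : int) x : cexp (n%:~R * x) = cexp x ^ n.
Proof.
case: n => n; first exact: cexp_natM.
by rewrite NegzE mulrNz mulNr cexpN cexp_natM exprnN.
Qed.

Lemma norm_cexp x : `|cexp x| = (expR (complex.Re x))%:C.
Proof.
by rewrite normc_def /= !exprMn -mulrDr cos2Dsin2 mulr1 sqrtr_sqr ger0_norm ?expR_ge0.
Qed.

End ComplexParts.

Section ComplexDerive.
Variable R : realType.
Implicit Types (f g : R -> R[i]) (t : R).

Definition is_cderive f t (d : R[i]) :=
  is_derive t 1 (fun s => complex.Re (f s)) (complex.Re d) /\
  is_derive t 1 (fun s => complex.Im (f s)) (complex.Im d).

Lemma is_cderive_eq f t d d' : is_cderive f t d -> d = d' -> is_cderive f t d'.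
Proof. by move=> ? <-. Qed.

Lemma is_cderive_cst (c : R[i]) t : is_cderive (fun=> c) t 0.
Proof. by split; exact: is_derive_cst. Qed.

Lemma is_cderive_real t : is_cderive (fun s => s%:C) t 1.
Proof. by split; [exact: is_derive_id | exact: is_derive_cst]. Qed.

Lemma is_cderiveD f g t df dg : is_cderive f t df -> is_cderive g t dg ->
  is_cderive (fun s => f s + g s) t (df + dg).
Proof.
move=> [f1 f2] [g1 g2]; split.
- rewrite (_ : (fun s => _) = (fun s => complex.Re (f s)) \+ (fun s => complex.Re (g s))).
    by rewrite cReD; exact: is_deriveD.
  by apply/funext => s; rewrite cReD.
- rewrite (_ : (fun s => _) = (fun s => complex.Im (f s)) \+ (fun s => complex.Im (g s))).
    by rewrite cImD; exact: is_deriveD.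
  by apply/funext => s; rewrite cImD.
Qed.

Lemma is_cderiveM f g t df dg : is_cderive f t df -> is_cderive g t dg ->
  is_cderive (fun s => f s * g s) t (df * g t + f t * dg).
Proof.
move=> [f1 f2] [g1 g2]; split.
- rewrite (_ : (fun s => _) =
    (fun s => complex.Re (f s)) * (fun s => complex.Re (g s)) -
    (fun s => complex.Im (f s)) * (fun s => complex.Im (g s))).
    apply: (is_derive_eq (is_deriveB (is_deriveM f1 g1) (is_deriveM f2 g2))).
    rewrite cReD !cReM /GRing.scale /=; ring.
  by apply/funext => s; rewrite cReM.
- rewrite (_ : (fun s => _) =
    (fun s => complex.Re (f s)) * (fun s => complex.Im (g s)) +
    (fun s => complex.Im (f s)) * (fun s => complex.Re (g s))).
    apply: (is_derive_eq (is_deriveD (is_deriveM f1 g2) (is_deriveM f2 g1))).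
    rewrite cImD !cImM /GRing.scale /=; ring.
  by apply/funext => s; rewrite cImM.
Qed.

Lemma is_cderiveZ (c : R[i]) f t df : is_cderive f t df ->
  is_cderive (fun s => c * f s) t (c * df).
Proof.
move=> fd; apply: is_cderive_eq (is_cderiveM (is_cderive_cst c t) fd) _.
by rewrite mul0r add0r.
Qed.

Lemma is_cderive_sum (I : Type) (r : seq I) (F : I -> R -> R[i]) t dF :
  (forall i, is_cderive (F i) t (dF i)) ->
  is_cderive (fun s => \sum_(i <- r) F i s) t (\sum_(i <- r) dF i).
Proof.
move=> FP; elim: r => [|i r IHr].
  rewrite big_nil (_ : (fun s => _) = fun=> 0); first exact: is_cderive_cst.
  by apply/funext => s; rewrite big_nil.
rewrite big_cons (_ : (fun s => _) = fun s => F i s + \sum_(j <- r) F j s).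
  exact: is_cderiveD.
by apply/funext => s; rewrite big_cons.
Qed.

Lemma is_cderiveX f t df n : is_cderive f t df ->
  is_cderive (fun s => f s ^+ n) t (n%:R * f t ^+ n.-1 * df).
Proof.
move=> fd; elim: n => [|n IHn].
  by apply: is_cderive_eq (is_cderive_cst 1 t) _; rewrite !mul0r.
rewrite (_ : (fun s => _) = fun s => f s * f s ^+ n); last first.
  by apply/funext => s; rewrite exprS.
apply: is_cderive_eq (is_cderiveM fd IHn) _.
by case: n {IHn} => [|n] /=; rewrite ?expr0 ?exprS ?mulrS; ring.
Qed.

Lemma is_cderive_cexp f t df : is_cderive f t df ->
  is_cderive (fun s => cexp (f s)) t (cexp (f t) * df).
Proof.
move=> [f1 f2].
have dE : is_derive t 1 (fun s => expR (complex.Re (f s)))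
    (complex.Re df * expR (complex.Re (f t))).
  by apply: is_derive_eq (is_derive1_comp (is_derive_expR _) f1) _; rewrite mulrC.
have dC : is_derive t 1 (fun s => cos (complex.Im (f s)))
    (- complex.Im df * sin (complex.Im (f t))).
  by apply: is_derive_eq (is_derive1_comp (is_derive_cos _) f2) _; ring.
have dS : is_derive t 1 (fun s => sin (complex.Im (f s)))
    (complex.Im df * cos (complex.Im (f t))).
  by apply: is_derive_eq (is_derive1_comp (is_derive_sin _) f2) _; ring.
split.
- apply: (is_derive_eq (is_deriveM dE dC)).
  rewrite cReM /cexp /GRing.scale /=; ring.
- apply: (is_derive_eq (is_deriveM dE dS)).
  rewrite cImM /cexp /GRing.scale /=; ring.
Qed.

End ComplexDerive.

(* [dexp a q l e] is the value at a point where L = l and exp (b . z) = e of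
   the derivative of L^a exp (b . z) along directions v_1, ..., v_r, where
   q = \prod_i (L v_i *: 'X + b . v_i): indeed L^a = a! [u^a] exp (u L). *)
Definition dexp (C : comNzRingType) (a : nat) (q : {poly C}) (l e : C) : C :=
  e * \sum_(j < a.+1) (a ^_ (a - j))%:R * q`_(a - j) * l ^+ j.

(** * Size of the derivatives of a monomial *)

Section NormPredicate.
Variables (C : comNzRingType) (N : C -> nat -> Prop).
Hypotheses (N_le : forall x B B', (B <= B')%N -> N x B -> N x B')
  (N_D : forall x y B B', N x B -> N y B' -> N (x + y) (B + B')%N)
  (N_M : forall x y B B', N x B -> N y B' -> N (x * y) (B * B')%N)
  (N_nat : forall n, N n%:R n).

Lemma N_sum (I : finType) (f : I -> C) B :
  (forall i, N (f i) B) -> N (\sum_i f i) (#|I| * B)%N.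
Proof.
move=> fB; rewrite cardE -[index_enum I]enumT.
elim: (enum I) => [|i s IHs]; first by rewrite big_nil mul0n -[0]/(0%:R).
by rewrite big_cons mulSn; apply: N_D.
Qed.

Lemma N_X x B n : N x B -> N (x ^+ n) (B ^ n)%N.
Proof.
by move=> xB; elim: n => [|n IHn]; [exact: (N_nat 1) | rewrite exprS expnS; apply: N_M].
Qed.

Lemma N_prod (I : finType) (f : I -> C) B :
  (forall i, N (f i) B) -> N (\prod_i f i) (B ^ #|I|)%N.
Proof.
move=> fB; rewrite cardE -[index_enum I]enumT.
elim: (enum I) => [|i s IHs]; first by rewrite big_nil; exact: (N_nat 1).
by rewrite big_cons expnS; apply: N_M.
Qed.

Lemma N_lin_prod (T : Type) (s : seq T) (u v : T -> C) A B :
  (forall x, N (u x) A) -> (forall x, N (v x) B) ->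
  forall i, N (\prod_(x <- s) (u x *: 'X + (v x)%:P))`_i ((B + A) ^ size s)%N.
Proof.
move=> uA vB; elim: s => [|x s IHs] i.
  rewrite big_nil coefC; case: eqP => _; first exact: (N_nat 1).
  exact: N_le (N_nat 0).
rewrite big_cons mulrDl -scalerAl coefD coefZ coefXM mul_polyC coefZ expnS mulnDl.
rewrite addrC; apply: N_D; first exact: N_M.
apply: N_M => //; case: i => [|i] //=; exact: N_le (N_nat 0).
Qed.

(** Stated for an arbitrary subadditive and submultiplicative size, so as to serve for both
    [int_size] and the absolute value. *)
Lemma N_dexp L a (q : {poly C}) l e Bq Bl Be : (a < L)%N -> (0 < Bl)%N ->
  (forall i, N q`_i Bq) -> N l Bl -> N e Be ->
  N (dexp a q l e) (Be * (L ^ L * Bq * Bl ^ L))%N.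
Proof.
move=> aL Bl0 qB lB eB; apply: N_M => //.
apply: (@N_le _ (#|'I_a.+1| * (a`! * Bq * Bl ^ L))).
  rewrite card_ord !mulnA -factS !leq_mul2r; do ?[apply/orP; right].
  by rewrite (leq_trans (fact_le_expnn _)) // (leq_trans (leq_expr _ aL)) //
             leq_pexp2l //; lia.
apply: N_sum => j; apply: N_M; first apply: N_M => //.
  by apply: N_le (N_nat _); rewrite ffact_factd ?leq_subr // leq_div.
apply: N_le (N_X _ lB); rewrite leq_pexp2l // ltnW // (leq_ltn_trans _ aL) //.
by rewrite -ltnS.
Qed.

End NormPredicate.

(** * The auxiliary function of Baker's method *)

Section Auxiliary.
Variables (R : realType) (n : nat) (g : 'cV[R[i]]_n.+1).
Local Notation C := R[i].
Local Notation D := n.+1.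
Implicit Types (v z : 'rV[C]_D).

Definition lform v : C := (v *m g) 0 0.
Definition dot (b : 'I_D -> nat) v : C := \sum_h (b h)%:R * v 0 h.
(** The factor by which the derivation along v multiplies exp(u (z . g) + b . z), as a polynomial in
    u. *)
Definition dir b v : {poly C} := lform v *: 'X + (dot b v)%:P.

Lemma lformD (a : C) u v : lform (a *: u + v) = a * lform u + lform v.
Proof. by rewrite /lform mulmxDl -scalemxAl !mxE. Qed.

Lemma dotD b (a : C) u v : dot b (a *: u + v) = a * dot b u + dot b v.
Proof.
rewrite /dot mulr_sumr -big_split; apply: eq_bigr => h _.
by rewrite !mxE /=; ring.
Qed.

Lemma dirD b (a : C) u v : dir b (a *: u + v) = a *: dir b u + dir b v.
Proof.
rewrite /dir lformD dotD scalerDl polyCD polyCM -mul_polyC scalerDr.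
by rewrite -!mul_polyC polyCM; ring.
Qed.

Variables (L : nat).
Definition aux_index := ('I_L * {ffun 'I_D -> 'I_L})%type.
Implicit Type k : aux_index.
Definition expo k (h : 'I_D) : nat := k.2 h.
Variable p : aux_index -> int.

(** [vs] lists directions of derivation: this is the iterated derivative along [vs] of a polynomial
    with coefficients [p] in z . g and the exp z_h. It is symmetric and multilinear in [vs]. *)
Definition auxfun (vs : seq 'rV[C]_D) z : C :=
  \sum_(k : aux_index) (p k)%:~R *
    dexp k.1 (\prod_(v <- vs) dir (expo k) v) (lform z) (cexp (dot (expo k) z)).

Lemma dexpD a (c : C) (q q' : {poly C}) l e :
  dexp a (c *: q + q') l e = c * dexp a q l e + dexp a q' l e.
Proof.
rewrite /dexp mulrCA -mulrDr; congr (_ * _); rewrite mulr_sumr -big_split.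
by apply: eq_bigr => j _; rewrite coefD coefZ /=; ring.
Qed.

Lemma auxfun_perm vs vs' z : perm_eq vs vs' -> auxfun vs z = auxfun vs' z.
Proof. by move=> vv; apply: eq_bigr => k _; rewrite (perm_big _ vv). Qed.

Lemma auxfunD (a : C) u v vs z :
  auxfun (a *: u + v :: vs) z = a * auxfun (u :: vs) z + auxfun (v :: vs) z.
Proof.
rewrite /auxfun mulr_sumr -big_split; apply: eq_bigr => k _ /=.
rewrite !big_cons dirD mulrDl -scalerAl dexpD; ring.
Qed.

Lemma auxfun0 vs z : auxfun (0 :: vs) z = 0.
Proof.
have := auxfunD 1 0 0 vs z; rewrite scaler0 addr0 mul1r.
by move/eqP; rewrite addrC -subr_eq subrr eq_sym => /eqP.
Qed.

Lemma auxfun_sum (I : finType) (a : I -> C) (u : I -> 'rV[C]_D) vs z :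
  auxfun (\sum_i a i *: u i :: vs) z = \sum_i a i * auxfun (u i :: vs) z.
Proof.
rewrite -[index_enum I]enumT; elim: (enum I) => [|i s IHs].
  by rewrite !big_nil auxfun0.
by rewrite !big_cons auxfunD IHs.
Qed.

(** The exponential contributes the constant term of [dir]. The power of [lform] contributes its
    term in ['X], because shifting the coefficients by one matches l^j with its derivative through
    a^_(a - j) = a^_(a - j - 1) * (j + 1). *)
Lemma is_cderive_auxfun vs z v (t : R) :
  is_cderive (fun s => auxfun vs (z + s%:C *: v)) t
    (auxfun (v :: vs) (z + t%:C *: v)).
Proof.
apply: is_cderive_sum => k; apply: is_cderiveZ; rewrite big_cons.
set q := \prod_(w <- vs) _; set a := k.1 : nat.
have dl : is_cderive (fun s => lform (z + s%:C *: v)) t (lform v).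
  rewrite (_ : (fun s => _) = fun s => lform v * s%:C + lform z).
    apply: is_cderive_eq (is_cderiveD (is_cderiveZ _ (is_cderive_real t)) (is_cderive_cst _ _)) _.
    by rewrite addr0 mulr1.
  by apply/funext => s; rewrite addrC lformD mulrC.
have dd : is_cderive (fun s => dot (expo k) (z + s%:C *: v)) t (dot (expo k) v).
  rewrite (_ : (fun s => _) = fun s => dot (expo k) v * s%:C + dot (expo k) z).
    apply: is_cderive_eq (is_cderiveD (is_cderiveZ _ (is_cderive_real t)) (is_cderive_cst _ _)) _.
    by rewrite addr0 mulr1.
  by apply/funext => s; rewrite addrC dotD mulrC.
set l := lform (z + t%:C *: v); set e := cexp (dot (expo k) (z + t%:C *: v)).
apply: is_cderive_eq.
  apply: is_cderiveM; first exact: is_cderive_cexp dd.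
  apply: is_cderive_sum => j; apply: is_cderiveZ; exact: is_cderiveX dl.
rewrite -/e -/l /dexp -mulrA -mulrDr; congr (_ * _).
have -> : \sum_(j < a.+1) (a ^_ (a - j))%:R * (dir (expo k) v * q)`_(a - j) * l ^+ j =
  lform v * (\sum_(j < a.+1) (a ^_ (a - j))%:R * ('X * q)`_(a - j) * l ^+ j)
  + dot (expo k) v * \sum_(j < a.+1) (a ^_ (a - j))%:R * q`_(a - j) * l ^+ j.
  rewrite !mulr_sumr -big_split; apply: eq_bigr => j _ /=.
  rewrite (_ : dir _ v * q = lform v *: ('X * q) + dot (expo k) v *: q).
    by rewrite coefD !coefZ; ring.
  by rewrite /dir mulrDl mul_polyC scalerAl.
rewrite addrC; congr (_ + _).
rewrite mulr_sumr [LHS]big_ord_recl /= !mul0r mulr0 add0r.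
rewrite [RHS]big_ord_recr /= subnn coefXM /= !(mulr0, mul0r) addr0.
apply: eq_bigr => j _; have ja : (j < a)%N by [].
rewrite /bump /= add1n coefXM subn_eq0 leqNgt ja /= -subnS.
have -> : (a ^_ (a - j) = a ^_ (a - j.+1) * j.+1)%N.
  by rewrite -{1}(subnSK ja) ffactnSr; congr (_ * _)%N; lia.
rewrite natrM; ring.
Qed.

End Auxiliary.

Section Nonvanishing.
Variables (R : realType) (n L : nat) (g : 'cV[R[i]]_n.+1).
Local Notation C := R[i].
Local Notation D := n.+1.
Hypothesis g_neq0 : forall i, g i 0 != 0.
Variable p : aux_index n L -> int.

Definition unit_dir (h : 'I_D) : 'rV[C]_D := delta_mx 0 h.

Lemma lform_unit h : lform g (unit_dir h) = g h 0.
Proof. by rewrite /lform /unit_dir -rowE mxE. Qed.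

Lemma dot_unit b h : dot b (unit_dir h : 'rV[C]_D) = (b h)%:R.
Proof.
rewrite /dot (bigD1 h) //= big1 ?addr0 => [|i /negPf ih].
  by rewrite mxE !eqxx mulr1.
by rewrite mxE ih andbF mulr0.
Qed.

Let functional (Q : aux_index n L -> {poly C}) : C :=
  \sum_k (p k)%:~R * dexp k.1 (Q k) 0 1.
Let annihilated (Q : aux_index n L -> {poly C}) := forall hs : seq 'I_D,
  functional (fun k => \prod_(h <- hs) dir g (expo k) (unit_dir h) * Q k) = 0.

(** Were all derivatives zero, the functional sum_k p_k a! [u^a] Q_k, with a = k.1, would kill every
    product Q of the polynomials [fac]. Let b0 be the exponent of k0 and a0 the largest a with p (a,
    b0) nonzero. The product [Q] below is divisible by u^L at every b other than b0, and by exactly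
    u^a0 at b0, so only the term (a0, b0) survives. *)
Lemma auxfun_nonvanishing k0 : p k0 != 0 ->
  exists hs, auxfun g p (map unit_dir hs) 0 != 0.
Proof.
move=> pk0; apply: contrapT => /forallNP H.
have H1 : annihilated (fun=> 1).
  have l0 : lform g 0 = 0 by rewrite /lform mul0mx mxE.
  have d0 b : dot b (0 : 'rV[C]_D) = 0.
    by rewrite /dot big1 // => h _; rewrite mxE mulr0.
  move=> hs; transitivity (auxfun g p (map unit_dir hs) 0).
    by apply: eq_bigr => k _; rewrite mulr1 big_map l0 d0 cexp0.
  exact/eqP/negPn/negP/H.
pose fac (h : 'I_D) (x : nat) (k : aux_index n L) : {poly C} := dir g (expo k) (unit_dir h) - x%:R%:P.
have eqA Q Q' : Q =1 Q' -> annihilated Q -> annihilated Q'.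
  by move=> /funext->.
have Hfac h x Q : annihilated Q -> annihilated (fun k => fac h x k * Q k).
  move=> QP hs; have Qh := QP (h :: hs); have Q0 := QP hs.
  transitivity (1 * functional (fun k => \prod_(h <- h :: hs) dir g (expo k)
    (unit_dir h) * Q k) + (- x%:R) * functional (fun k => \prod_(h <- hs)
    dir g (expo k) (unit_dir h) * Q k)); last by rewrite Qh Q0 !mulr0 addr0.
  rewrite /functional !mulr_sumr -big_split; apply: eq_bigr => k _ /=.
  rewrite [_ + _](_ : _ = (p k)%:~R * (- x%:R * dexp k.1 (\prod_(h <- hs)
    dir g (expo k) (unit_dir h) * Q k) 0 1 + dexp k.1 (\prod_(h <- h :: hs)
    dir g (expo k) (unit_dir h) * Q k) 0 1)); last by ring.
  rewrite -dexpD big_cons /fac -mul_polyC polyCN; congr (_ * dexp _ _ _ _).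
  by ring.
have HfacX h x e Q : annihilated Q -> annihilated (fun k => fac h x k ^+ e * Q k).
  move=> QP; elim: e => [|e IHe].
    by apply: eqA QP => k; rewrite mul1r.
  by apply: eqA (Hfac h x _ IHe) => k; rewrite exprS -mulrA.
have [a0 [pa0 a0max]] : exists a0 : 'I_L, p (a0, k0.2) != 0 /\
    forall a : 'I_L, (a0 < a)%N -> p (a, k0.2) = 0.
  have pk0' : p (k0.1, k0.2) != 0 by rewrite -surjective_pairing.
  case: (@arg_maxnP _ k0.1 (fun a => p (a, k0.2) != 0) val pk0') => a0 pa0 am.
  exists a0; split=> // a a0a; apply: contraTeq a0a => /am; rewrite -leqNgt.
  exact.
pose b0 := k0.2.
have /choice[hb hbP] (b : {ffun 'I_D -> 'I_L}) :
    exists h, b != b0 -> b h != b0 h.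
  have [->|bb] := eqVneq b b0; first by exists 0.
  have [h bh] : exists h, b h != b0 h.
    apply/existsP; apply: contraNT bb => /existsPn bb; apply/eqP/ffunP => h.
    by have := bb h; rewrite negbK => /eqP.
  by exists h.
pose Q (k : aux_index n L) := \prod_(b : {ffun 'I_D -> 'I_L} | b != b0) fac (hb b) (b (hb b)) k ^+ L *
  fac 0 (b0 0) k ^+ a0.
have /(_ [::]) : annihilated Q.
  apply: (eqA (fun k => \prod_(b <- [seq b <- index_enum _ | b != b0])
    fac (hb b) (b (hb b)) k ^+ L * fac 0 (b0 0) k ^+ a0)).
    by move=> k; rewrite /Q big_filter.
  elim: (seq.filter _ _) => [|b s IHs].
    by apply: eqA (HfacX 0 (b0 0) a0 _ H1) => k; rewrite big_nil mul1r mulr1.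
  by apply: eqA (HfacX (hb b) (b (hb b)) L _ IHs) => k; rewrite big_cons -mulrA.
rewrite /functional (bigD1 (a0, b0)) //= [X in _ + X]big1 => [|k kk].
  rewrite addr0 big_nil mul1r => /eqP; apply/negP.
  rewrite mulf_neq0 ?intr_eq0 // /dexp mul1r big_ord_recl /=.
  rewrite big1 ?addr0 => [|j _]; last by rewrite expr0n /= mulr0.
  have facE h x : fac h x (a0, b0) = g h 0 *: 'X + ((b0 h)%:R - x%:R)%:P.
    by rewrite /fac /dir lform_unit dot_unit polyCB addrA.
  rewrite subn0 ffactnn mulr1 mulf_neq0 ?pnatr_eq0 -?lt0n ?fact_gt0 // /Q.
  rewrite facE subrr addr0 exprZn -scalerAr coefZ coefMXn ltnn subnn.
  rewrite mulf_neq0 ?expf_neq0 // -horner_coef0 horner_prod.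
  apply/prodf_neq0 => b /hbP bb.
  rewrite horner_exp expf_neq0 // facE hornerD hornerZ hornerX hornerC mulr0.
  by rewrite add0r subr_eq0 eqr_nat eq_sym.
rewrite big_nil mul1r; apply/eqP; rewrite mulf_eq0; apply/orP.
case: k kk => a b; rewrite xpair_eqE negb_and => kk /=.
have coef0 : (Q (a, b))`_a = 0 ->
    dexp a (Q (a, b)) 0 1 == 0.
  move=> Qa; rewrite /dexp mul1r big_ord_recl /= subn0 Qa mulr0 mul0r add0r.
  by rewrite big1 // => j _; rewrite expr0n /= mulr0.
have facE h : fac h (b h) (a, b) = g h 0 *: 'X.
  by rewrite /fac /dir lform_unit dot_unit addrK.
have [bb|bb] := eqVneq b b0; last first.
  right; apply: coef0; rewrite /Q (bigD1 b) //= facE exprZn -!scalerAl coefZ.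
  by rewrite -mulrA coefXnM ltn_ord mulr0.
have [aa|aa|aa] := ltngtP a a0.
- right; apply: coef0; rewrite /Q -bb facE exprZn -scalerAr coefZ coefMXn aa.
  by rewrite mulr0.
- by left; rewrite bb intr_eq0 a0max.
- by move: kk; rewrite bb eqxx orbF; case/eqP; apply/val_inj.
Qed.

End Nonvanishing.

(** * Extrapolation on the lattice generated by the rows of [Y] *)

Section Contradiction.
Variables (R : realType) (n : nat) (g : 'cV[R[i]]_n.+1).
Variables (Y Z : 'M[R[i]]_n.+1) (b0 : R[i]) (N c : nat).
Local Notation C := R[i].
Local Notation D := n.+1.
Hypotheses
  (g_free : forall v : 'rV[int]_D, map_mx intr v *m g = 0 -> v = 0)
  (g_size : forall i, int_size g (g i 0) c)
  (bg_size : forall i, int_size g (b0 * g i 0) c)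
  (Yg : Y *m g = b0 *: g)
  (ZY : Z *m Y = 1%:M)
  (N_gt0 : (0 < N)%N) (N_le : (N <= c)%N)
  (eY_size : forall k h, int_size g (N%:R * cexp (Y k h)) c)
  (bg_le : forall k, `|b0 * g k 0| <= c%:R)
  (Y_le : forall k h, `|Y k h| <= c%:R)
  (Z_le : forall k h, `|Z k h| <= c%:R)
  (eY_le : forall k h, expR `|complex.Re (Y k h)| <= c%:R).

Let c_gt0 : (0 < c)%N. Proof. exact: leq_trans N_gt0 N_le. Qed.

Let g_neq0 i : g i 0 != 0.
Proof.
apply/eqP => gi0; have /matrixP/(_ 0 i)/eqP : delta_mx 0 i = 0 :> 'rV[int]_D.
  apply: g_free; apply/matrixP => j k; rewrite !ord1 map_delta_mx -rowE mxE.
  by rewrite gi0 mxE.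
by rewrite !mxE !eqxx.
Qed.

(** At integral combinations of these vectors, [lform] and the exponentials of the coordinates lie
    in the number field, by [Yg] and [eY_size]. *)
Definition lat_dir (k : 'I_D) : 'rV[C]_D := row k Y.
Definition lat_pt (x : 'I_D -> R) : 'rV[C]_D := \sum_k (x k)%:C *: lat_dir k.

Lemma lform_lat k : lform g (lat_dir k) = b0 * g k 0.
Proof. by rewrite /lform -row_mul Yg !mxE. Qed.

Lemma dot_lat b k : dot b (lat_dir k) = \sum_h (b h)%:R * Y k h.
Proof. by apply: eq_bigr => h _; rewrite mxE. Qed.

Lemma lform_pt x : lform g (lat_pt x) = \sum_k (x k)%:C * (b0 * g k 0).
Proof.
rewrite /lform /lat_pt mulmx_suml summxE; apply: eq_bigr => k _.
by rewrite -scalemxAl mxE -lform_lat.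
Qed.

Lemma dot_pt b x : dot b (lat_pt x) =
  \sum_k \sum_h (x k)%:C * (b h)%:R * Y k h.
Proof.
rewrite /dot exchange_big; apply: eq_bigr => h _ /=.
rewrite summxE mulr_sumr; apply: eq_bigr => k _; rewrite !mxE; ring.
Qed.

Let norm_le (x : C) (B : nat) := `|x| <= B%:R.

Section Grid.
Variables (S L : nat).
Hypotheses (S_gt0 : (0 < S)%N) (L_gt0 : (0 < L)%N).
Let w := (D * D * L * S)%N.

Lemma dexp_scale a q l e (m : C) : m * dexp a q l e = dexp a q l (m * e).
Proof. by rewrite /dexp mulrA. Qed.

(** At a grid point the exponential is a product over k and h of powers exp(Y_kh)^(s_k b_h), each
    exponent being at most L * S; so N^w clears all denominators. *)
Lemma dexp_int_size (hs : seq 'I_D) (s : 'I_D -> nat) (k : aux_index n L) :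
  (forall i, (s i < S)%N) ->
  int_size g (N%:R ^+ w * dexp k.1
     (\prod_(v <- map (unit_dir R (n:=n)) hs) dir g (expo k) v)
     (lform g (lat_pt (fun i => (s i)%:R)))
     (cexp (dot (expo k) (lat_pt (fun i => (s i)%:R)))))
    (deriv_bound D c S L (size hs)).
Proof.
move=> sS; rewrite dexp_scale big_map /deriv_bound.
have sle := @int_size_le C n g; have sD := @int_sizeD C n g.
have sM := @int_sizeM C n g.
have sn m : int_size g m%:R m by exact: (int_size_int g m).
apply: (N_dexp sle sD sM sn) => //.
- by rewrite !muln_gt0 S_gt0 c_gt0.
- have := @N_lin_prod _ _ sle sD sM sn _ hs (fun h => g h 0)
    (fun h => (expo k h)%:R) c (D * L * c) g_size.
  have eL h : int_size g (expo k h)%:R (D * L * c).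
    apply: (sle) (sn _); apply: ltnW; apply: leq_trans (ltn_ord _) _.
    by rewrite -mulnA mulnCA leq_pmulr // muln_gt0 c_gt0.
  move=> /(_ eL) H i; rewrite addnC.
  rewrite (eq_bigr (fun h => g h 0 *: 'X + ((expo k h)%:R)%:P)); first exact: H.
  by move=> h _; rewrite /dir lform_unit dot_unit.
- rewrite lform_pt -mulnA -[D in (D * _)%N]card_ord; apply: (N_sum sD sn) => i.
  rewrite natrC; apply: (sM) => //; apply: (sle) (sn _); exact: ltnW.
- rewrite dot_pt cexp_sum.
  have -> : N%:R ^+ w = \prod_(i : 'I_D) \prod_(h : 'I_D) (N%:R : C) ^+ (L * S).
    rewrite !prodr_const !card_ord -!exprM; congr (_ ^+ _); rewrite /w; lia.
  rewrite -big_split /=; rewrite /w.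
  have -> : (c ^ (D * D * L * S) = ((c ^ (L * S)) ^ #|'I_D|) ^ #|'I_D|)%N.
    by rewrite -!expnM !card_ord; congr expn; lia.
  apply: (N_prod sM sn) => i; rewrite cexp_sum -big_split /=.
  apply: (N_prod sM sn) => h; set m := (s i * expo k h)%N.
  have mLS : (m <= L * S)%N.
    by rewrite mulnC; apply: leq_mul; [exact: ltnW | apply: ltnW; exact: ltn_ord].
  rewrite natrC -natrM -/m cexp_natM -(subnK mLS) exprD -mulrA -exprMn expnD.
  apply: (sM); last exact: (N_X sM sn).
  by apply: (sle) (N_X sM sn _ (sn N)); exact: leq_expr.
Qed.

(** The analytic counterpart, in lattice directions and at all real points of the box, as needed on
    the segments where Rolle's theorem is used. *)
Lemma dexp_norm_le (ks : seq 'I_D) (x : 'I_D -> R) (k : aux_index n L) :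
  (forall i, 0 <= x i <= S%:R) ->
  `|dexp k.1 (\prod_(v <- map lat_dir ks) dir g (expo k) v)
     (lform g (lat_pt x)) (cexp (dot (expo k) (lat_pt x)))|
  <= (deriv_bound D c S L (size ks))%:R.
Proof.
move=> xS; rewrite big_map /deriv_bound.
have sle (u : C) B B' : (B <= B')%N -> norm_le u B -> norm_le u B'.
  by move=> BB /le_trans; apply; rewrite ler_nat.
have sD (u v : C) B B' : norm_le u B -> norm_le v B' -> norm_le (u + v) (B + B')%N.
  by move=> uB vB; rewrite /norm_le natrD (le_trans (ler_normD _ _)) // lerD.
have sM (u v : C) B B' : norm_le u B -> norm_le v B' -> norm_le (u * v) (B * B')%N.
  by move=> uB vB; rewrite /norm_le natrM normrM ler_pM.
have sn m : norm_le m%:R m by rewrite /norm_le normr_nat.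
have xle i : norm_le (x i)%:C S.
  have /andP[x0 xS'] := xS i.
  by rewrite /norm_le norm_real ger0_norm // -natrC lecR.
apply: (N_dexp sle sD sM sn) => //.
- by rewrite !muln_gt0 S_gt0 c_gt0.
- have := @N_lin_prod _ _ sle sD sM sn _ ks (fun h => b0 * g h 0)
    (fun h => dot (expo k) (lat_dir h)) c (D * L * c) bg_le.
  have eL h : norm_le (dot (expo k) (lat_dir h)) (D * L * c).
    rewrite dot_lat -mulnA -[D in (D * _)%N]card_ord; apply: (N_sum sD sn) => i.
    by apply: (sM) (Y_le _ _); apply: (sle _ _ _ (ltnW (ltn_ord (k.2 i))) (sn _)).
  move=> /(_ eL) H i; rewrite addnC.
  rewrite (eq_bigr (fun h => (b0 * g h 0) *: 'X + (dot (expo k) (lat_dir h))%:P)).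
    exact: H.
  by move=> h _; rewrite /dir lform_lat.
- rewrite lform_pt -mulnA -[D in (D * _)%N]card_ord; apply: (N_sum sD sn) => i.
  exact: (sM _ _ _ _ (xle i) (bg_le i)).
- rewrite dot_pt cexp_sum.
  have -> : (c ^ (D * D * L * S) = ((c ^ (L * S)) ^ #|'I_D|) ^ #|'I_D|)%N.
    by rewrite -!expnM !card_ord; congr expn; lia.
  apply: (N_prod sM sn) => i; rewrite cexp_sum.
  apply: (N_prod sM sn) => h; have /andP[x0 xS'] := xS i.
  rewrite /norm_le -[X in _ <= X]natrC norm_cexp lecR -mulrA -[(expo k h)%:R]natrC.
  rewrite !cReM !cImM /= !mul0r !subr0.
  rewrite natrX; apply: le_trans (lerXn2r _ _ _ (eY_le i h)); rewrite ?nnegrE ?expR_ge0 //.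
  rewrite -expRM_natl ler_expR.
  apply: (@le_trans _ _ (x i * ((expo k h)%:R * `|complex.Re (Y i h)|))).
    by do 2?rewrite ler_wpM2l ?ler_norm.
  rewrite mulrA ler_wpM2r // mulnC natrM ler_pM //.
  by rewrite ler_nat ltnW // ltn_ord.
Qed.

Variable p : aux_index n L -> int.
Implicit Types (z : 'rV[C]_D).

Lemma auxfun_lat_eq0 z r :
  (forall hs, size hs = r -> auxfun g p (map (unit_dir R (n:=n)) hs) z = 0) ->
  forall ks, size ks = r -> auxfun g p (map lat_dir ks) z = 0.
Proof.
move=> H; suff G ks hs : (size hs + size ks = r)%N ->
    auxfun g p (map (unit_dir R (n:=n)) hs ++ map lat_dir ks) z = 0.
  by move=> ks ksr; apply: (G ks [::]).
elim: ks hs => [|k ks IHks] hs hr.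
  by rewrite cats0; apply: H; rewrite -hr addn0.
rewrite (auxfun_perm _ _ _ (_ : perm_eq _ (lat_dir k ::
  (map (unit_dir R (n:=n)) hs ++ map lat_dir ks)))); last first.
  by rewrite map_cons -cat1s perm_catCA.
rewrite [lat_dir k](row_sum_delta) auxfun_sum big1 // => h _.
by rewrite -[_ :: _]/(map (unit_dir R (n:=n)) (h :: hs) ++ _) IHks ?mulr0 // -hr /= addnS.
Qed.

(** A coordinate direction is a combination of the D lattice directions with coefficients from [Z],
    the inverse of [Y]; so each derivation costs a factor D * c. *)
Lemma auxfun_unit_le z r (B : C) :
  (forall ks, size ks = r -> `|auxfun g p (map lat_dir ks) z| <= B) ->
  forall hs, size hs = r ->
    `|auxfun g p (map (unit_dir R (n:=n)) hs) z| <= ((D * c) ^ r)%:R * B.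
Proof.
move=> H; suff G hs ks : (size hs + size ks = r)%N ->
    `|auxfun g p (map (unit_dir R (n:=n)) hs ++ map lat_dir ks) z|
    <= ((D * c) ^ size hs)%:R * B.
  by move=> hs hsr; have := G hs [::]; rewrite addn0 cats0 hsr; apply.
elim: hs ks => [|h hs IHhs] ks hr; first by rewrite mul1r; apply: H.
have eE : unit_dir R h = \sum_k Z h k *: lat_dir k.
  rewrite /unit_dir -row1 -ZY row_mul [row h Z]row_sum_delta mulmx_suml.
  by apply: eq_bigr => k _; rewrite mxE -scalemxAl -rowE.
rewrite map_cons cat_cons eE auxfun_sum; apply: le_trans (ler_norm_sum _ _ _) _.
apply: (@le_trans _ _ (\sum_(k : 'I_D) c%:R * (((D * c) ^ size hs)%:R * B))).
  apply: ler_sum => k _; rewrite normrM ler_pM //.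
  rewrite (auxfun_perm _ _ _ (_ : perm_eq _
    (map (unit_dir R (n:=n)) hs ++ map lat_dir (k :: ks)))).
    by apply: IHhs; rewrite -hr /= addnS.
  by rewrite map_cons perm_sym -[X in perm_eq (_ ++ X)]cat1s perm_catCA.
by rewrite sumr_const card_ord -[X in X <= _]mulr_natl !mulrA -!natrM -expnS.
Qed.

Lemma deriv_bound_gt0 r : (0 < deriv_bound D c S L r)%N.
Proof.
by rewrite /deriv_bound !muln_gt0 !expn_gt0 L_gt0 addn_gt0 !muln_gt0 c_gt0 S_gt0.
Qed.

Lemma deriv_bound_le r r' :
  (r <= r')%N -> (deriv_bound D c S L r <= deriv_bound D c S L r')%N.
Proof.
move=> rr; rewrite /deriv_bound !leq_mul2l leq_mul2r; do ?[apply/orP; right].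
by rewrite leq_mul2l leq_pexp2l ?orbT // addn_gt0 c_gt0.
Qed.



(** There are T^D derivatives at S^D points, and each vanishing condition lies in the number field,
    so it amounts to D integer equations. *)
Lemma siegel_auxfun T : (2 * (T ^ D * S ^ D * D) <= L ^ D.+1)%N -> (0 < T)%N ->
  exists q : aux_index n L -> int,
  [/\ exists k, q k != 0, forall k, (`|q k| <= coef_bound D c S L T)%N &
    forall hs (s : 'I_D -> nat), (size hs < T)%N -> (forall i, s i < S)%N ->
    auxfun g q (map (unit_dir R (n:=n)) hs) (lat_pt (fun i => (s i)%:R)) = 0].
Proof.
move=> LTS T_gt0.
pose dirs (tau : {ffun 'I_D -> 'I_T}) :=
  flatten [seq nseq (tau h) h | h <- enum 'I_D].
have dirs_size tau : (size (dirs tau) <= D * T)%N.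
  rewrite size_flatten /shape -map_comp sumnE big_map big_enum /=.
  rewrite -[D in (D * T)%N]card_ord -sum_nat_const; apply: leq_sum => h _.
  by rewrite size_nseq ltnW.
pose x (tau : {ffun 'I_D -> 'I_T}) (s : {ffun 'I_D -> 'I_S}) (k : aux_index n L) :=
  N%:R ^+ w * dexp k.1
     (\prod_(v <- map (unit_dir R (n:=n)) (dirs tau)) dir g (expo k) v)
     (lform g (lat_pt (fun i => (s i : nat)%:R)))
     (cexp (dot (expo k) (lat_pt (fun i => (s i : nat)%:R)))).
have /choice[M MP] (i : {ffun 'I_D -> 'I_T} * {ffun 'I_D -> 'I_S} * aux_index n L) :
    exists M, int_acts g (x i.1.1 i.1.2 i.2) M /\
    forall j, (\sum_k `|M j k|%N <= deriv_bound D c S L (D * T))%N.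
  have [M [gM Mle]] := dexp_int_size (dirs i.1.1) i.2 (fun j => ltn_ord (i.1.2 j)).
  exists M; split=> // j; apply: leq_trans (Mle j) _; exact: deriv_bound_le.
have cardJ : #|{: aux_index n L}| = (L ^ D.+1)%N.
  by rewrite card_prod card_ffun !card_ord [in RHS]expnS.
have [||||q [q_neq0 q_eq q_le]] := @siegel
    ({ffun 'I_D -> 'I_T} * {ffun 'I_D -> 'I_S} * 'I_D)%type (aux_index n L)
    (fun i k => M (i.1, k) 0 i.2) (deriv_bound D c S L (D * T)).
- by rewrite !card_prod !card_ffun !card_ord !muln_gt0 !expn_gt0 T_gt0 S_gt0.
- by rewrite cardJ !card_prod !card_ffun !card_ord.
- exact: deriv_bound_gt0.
- move=> i j; apply: leq_trans ((MP (i.1, j)).2 0).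
  by rewrite (bigD1 i.2) //= leq_addr.
exists q; split=> // [k|hs s hsT sS]; first by rewrite /coef_bound -cardJ.
have tauT h : (count_mem h hs < T)%N by apply: leq_ltn_trans (count_size _ _) hsT.
pose tau := [ffun h => Ordinal (tauT h)].
pose s' := [ffun i => Ordinal (sS i)].
rewrite (auxfun_perm _ _ _ (_ : perm_eq _ (map (unit_dir R (n:=n)) (dirs tau)))).
  apply: (mulfI (_ : N%:R ^+ w != 0)).
    by rewrite expf_neq0 // pnatr_eq0 -lt0n.
  (* After multiplication by g_0 the value is the combination of the g_d given by row 0 of the
     acting matrices, and Siegel's equations kill each of its D coefficients. *)
  apply: (mulIf (g_neq0 0)); rewrite mulr0 mul0r.
  have -> : lat_pt (fun i => (s i)%:R) = lat_pt (fun i => (s' i : nat)%:R).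
    by congr lat_pt; apply/funext => i; rewrite ffunE.
  rewrite /auxfun mulr_sumr mulr_suml.
  transitivity (\sum_(k : aux_index n L) (q k)%:~R *
     (\sum_d (M (tau, s', k) 0 d)%:~R * g d 0)).
    apply: eq_bigr => k _; have [/matrixP/(_ 0 0) ME _] := MP (tau, s', k).
    rewrite (_ : \sum_d _ = x tau s' k * g 0 0); first by rewrite /x /=; ring.
    move: ME; rewrite mxE [RHS]mxE => <-.
    by apply: eq_bigr => d _; rewrite mxE.
  under eq_bigr do rewrite mulr_sumr; rewrite exchange_big big1 //= => d _.
  under eq_bigr do rewrite mulrA -intrM mulrC.
  rewrite -mulr_sumr -rmorph_sum /=.
  have := q_eq (tau, s', d); rewrite /=; under eq_bigr do rewrite mulrC.
  by move=> ->; rewrite mulr0.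
apply: perm_map; apply/allP => h _ /=; apply/eqP.
rewrite /dirs count_flatten -map_comp sumnE big_map big_enum /= (bigD1 h) //=.
rewrite count_nseq /= eqxx mul1n ffunE big1 ?addn0 // => i ih.
by rewrite count_nseq /= (negPf ih).
Qed.

Lemma auxfun_norm_le (q : aux_index n L -> int) (A : nat) (ks : seq 'I_D) x :
  (forall k, (`|q k| <= A)%N) -> (forall i, 0 <= x i <= S%:R) ->
  `|auxfun g q (map lat_dir ks) (lat_pt x)| <=
  (L ^ D.+1 * A * deriv_bound D c S L (size ks))%:R.
Proof.
move=> qA xS; apply: le_trans (ler_norm_sum _ _ _) _.
apply: (@le_trans _ _ (\sum_(k : aux_index n L) (A * deriv_bound D c S L (size ks))%:R)).
  apply: ler_sum => k _; rewrite normrM natrM ler_pM // ?dexp_norm_le //.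
  by rewrite -intr_norm -abszE ler_nat.
rewrite sumr_const card_prod card_ffun !card_ord -[X in X <= _]mulr_natl -natrM ler_nat.
by rewrite -expnS mulnA.
Qed.

End Grid.

Lemma exists_frequent (ks : seq 'I_D) : exists k, (size ks <= D * count_mem k ks)%N.
Proof.
have sum_count : (\sum_k count_mem k ks = size ks)%N.
  elim: ks => [|a ks IHks] /=; first by rewrite big1.
  rewrite big_split /= IHks (bigD1 a) //= eqxx big1 ?addn0 ?add1n // => i ia.
  by rewrite eq_sym (negPf ia).
apply/existsP; apply: contraT => /existsPn H.
have : (\sum_(k < D) (D * count_mem k ks).+1 <= \sum_(k < D) size ks)%N.
  by apply: leq_sum => k _; rewrite ltnNge.
under eq_bigr do rewrite -addn1.
rewrite big_split /= -big_distrr /= sum_count !sum_nat_const card_ord muln1.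
by rewrite -[leqRHS]addn0 leq_add2l.
Qed.

Lemma lat_pt_update x k t :
  lat_pt (fun i => if i == k then t else x i) =
  lat_pt (fun i => if i == k then 0 else x i) + t%:C *: lat_dir k.
Proof.
rewrite /lat_pt (bigD1 k) //= eqxx addrC [in RHS](bigD1 k) //= eqxx scale0r add0r.
by congr (_ + _); apply: eq_bigr => i /negPf->.
Qed.

(** Let W be the least order of a derivative that does not vanish at some grid point. In a
    derivative of order W along lattice directions, some direction k occurs M >= W / D times. Apply
    the other W - M derivations and restrict to the line in direction k: by minimality the resulting
    function of one variable vanishes to order M at 0, ..., S - 1, so [hermite_bound] makes the
    derivative small. This contradicts [liouville]. *)
Lemma lattice_contradiction : False.
Proof.
have [S [L [T [S0 L0 T0 LTS num]]]] := baker_parameters (ltn0Sn n) c_gt0.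
have [q [[k0 qk0] q_le q0]] := siegel_auxfun S0 L0 LTS T0.
pose pt (s : 'I_D -> nat) := lat_pt (fun i => (s i)%:R).
pose P W := `[< exists hs s, [/\ size hs = W, forall i, (s i < S)%N &
  auxfun g q (map (unit_dir R (n:=n)) hs) (pt s) != 0] >].
have exP : exists W, P W.
  have [hs hs0] := auxfun_nonvanishing g_neq0 qk0.
  exists (size hs); apply/asboolP; exists hs, (fun=> 0%N); split=> //.
  rewrite (_ : pt _ = 0) // /pt /lat_pt big1 // => i _; exact: scale0r.
case: (ex_minnP exP) => W /asboolP[hs [s [hsW sS aux0]]] Wmin.
have TW : (T <= W)%N.
  by rewrite leqNgt; apply: contra aux0 => WT; rewrite /pt q0 ?hsW.
have W_gt0 : (0 < W)%N by apply: leq_trans TW.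
have low (ks : seq 'I_D) s' : (size ks < W)%N -> (forall i, s' i < S)%N ->
    auxfun g q (map lat_dir ks) (pt s') = 0.
  move=> ksW sS'; apply: (auxfun_lat_eq0 (r := size ks)) => // hs' hsk.
  apply/eqP/negPn/negP => H; suff : P (size ks) by move/Wmin; rewrite leqNgt ksW.
  by apply/asboolP; exists hs', s'.
set w := (D * D * L * S)%N in num.
set U := (L ^ D.+1 * coef_bound D c S L T)%N in num.
pose K := (D * (U * deriv_bound D c S L W) ^ n)%N.
(* With this [B] the product of all upper bounds is 1/2, against the lower bound 1. *)
pose B : C := ((2 * (c ^ w * (D * c) ^ W * K))%:R)^-1.
have db_gt0 r : (0 < deriv_bound D c S L r)%N by exact: deriv_bound_gt0.
have U_gt0 : (0 < U)%N.
  by rewrite muln_gt0 expn_gt0 L0 muln_gt0 expn_gt0 L0 (db_gt0 (D * T)%N).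
have K_gt0 : (0 < K)%N by rewrite muln_gt0 expn_gt0 muln_gt0 U_gt0 (db_gt0 W).
have up ks : size ks = W -> `|auxfun g q (map lat_dir ks) (pt s)| <= B.
  move=> ksW; have [k] := exists_frequent ks; rewrite ksW; set M := count_mem k ks.
  move=> WM; have M_gt0 : (0 < M)%N by rewrite lt0n; apply: contraTneq WM => ->; lia.
  have MW : (M <= W)%N by rewrite -ksW count_size.
  pose rest := seq.filter (predC1 k) ks.
  have rest_size : size rest = (W - M)%N.
    by rewrite size_filter -ksW -(count_predC (pred1 k) ks) addKn.
  have ksE : perm_eq (map lat_dir ks) (nseq M (lat_dir k) ++ map lat_dir rest).
    rewrite -map_nseq -map_cat; apply: perm_map.
    have kE : seq.filter (pred1 k) ks = nseq M k.
      by rewrite /M -size_filter; apply/all_pred1P/filter_all.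
    by rewrite perm_sym -kE; apply/permPl/perm_filterC.
  pose G m (t : R) := auxfun g q (nseq m (lat_dir k) ++ map lat_dir rest)
    (lat_pt (fun i => if i == k then t else (s i)%:R)).
  have dG m t : is_cderive (G m) t (G m.+1 t).
    have := is_cderive_auxfun g q (nseq m (lat_dir k) ++ map lat_dir rest)
      (lat_pt (fun i => if i == k then 0 else (s i)%:R)) (lat_dir k) t.
    rewrite -lat_pt_update.
    by under eq_fun do rewrite -lat_pt_update.
  have GE m (t : R) : G m t = auxfun g q (map lat_dir (nseq m k ++ rest))
    (lat_pt (fun i => if i == k then t else (s i)%:R)).
    by rewrite /G map_cat map_nseq.
  have G0 s' j : (s' < S)%N -> (j < M)%N -> G j s'%:R = 0.
    move=> sS' jM; rewrite GE.
    rewrite (_ : lat_pt _ = pt (fun i => if i == k then s' else s i)); last first.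
      by congr lat_pt; apply/funext => i; case: ifP.
    apply: low; first by rewrite size_cat size_nseq rest_size; lia.
    by move=> i; case: ifP.
  pose A := (U * deriv_bound D c S L (S * M + (W - M)))%N.
  have GA (t : R) : 0 <= t <= S%:R -> `|G (S * M)%N t| <= A%:R.
    move=> tS; rewrite GE; apply: le_trans (auxfun_norm_le S0 L0 _ q_le _) _.
      by move=> i; case: ifP => // _; rewrite ler0n ler_nat ltnW.
    by rewrite size_cat size_nseq rest_size.
  have auxE : auxfun g q (map lat_dir ks) (pt s) = G M (s k)%:R.
    rewrite (auxfun_perm _ _ _ ksE) /G; congr (auxfun _ _ _ (lat_pt _)).
    by apply/funext => i; case: eqP => [->|].
  have bound (F : nat -> R -> R) : (forall (m : nat) (t : R), is_derive t 1 (F m) (F m.+1 t)) ->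
      (forall s' j, (s' < S)%N -> (j < M)%N -> F j s'%:R = 0) ->
      (forall t, 0 <= t <= S%:R -> `|F (S * M)%N t| <= A%:R) ->
      `|F M (s k)%:R| * ((S * M)`!)%:R <= (A * M`! * S ^ (S * M))%:R.
    move=> dF F0 FA; rewrite 2!natrM; exact: hermite_bound.
  (* Rolle's theorem is about real functions, so real and imaginary parts are bounded separately, at
     the cost of a factor 2. *)
  have boundRe := bound (fun m t => complex.Re (G m t)) (fun m t => (dG m t).1).
  have boundIm := bound (fun m t => complex.Im (G m t)) (fun m t => (dG m t).2).
  rewrite auxE; apply: le_trans (norm_le_ReIm _) _.
  have f_gt0 : 0 < ((S * M)`!%:R : R) by rewrite ltr0n fact_gt0.
  have BE : B = (((2 * (c ^ w * (D * c) ^ W * K))%:R)^-1 : R)%:C.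
    by rewrite /B -natrC fmorphV.
  rewrite BE lecR -(ler_pM2r f_gt0) mulrDl.
  apply: le_trans (lerD (boundRe _ _) (boundIm _ _)) _.
  - by move=> s' j sS' jM; rewrite G0.
  - by move=> t tS; apply: Re_le_norm; rewrite natrC GA.
  - by move=> s' j sS' jM; rewrite G0.
  - by move=> t tS; apply: Im_le_norm; rewrite natrC GA.
  have X0 : 0 < ((2 * (c ^ w * (D * c) ^ W * K))%:R : R).
    by rewrite ltr0n muln_gt0 /= muln_gt0 K_gt0 andbT muln_gt0 !expn_gt0 muln_gt0 c_gt0.
  rewrite -(ler_pM2l X0) mulVKf ?gt_eqF // -natrD -natrM ler_nat.
  apply: leq_trans (ltnW (num W M TW MW WM)); apply: eq_leq.
  by rewrite /K -/A /=; ring.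
have := auxfun_unit_le up hsW => aux_le.
have x0 : N%:R ^+ w * auxfun g q (map (unit_dir R (n:=n)) hs) (pt s) != 0.
  by rewrite mulf_neq0 // expf_neq0 // pnatr_eq0 -lt0n.
have xs : int_size g (N%:R ^+ w * auxfun g q (map (unit_dir R (n:=n)) hs) (pt s))
    (U * deriv_bound D c S L W).
  rewrite /auxfun mulr_sumr.
  have -> : (U * deriv_bound D c S L W = #|{: aux_index n L}| *
      (coef_bound D c S L T * deriv_bound D c S L W))%N.
    by rewrite card_prod card_ffun !card_ord -expnS mulnA.
  apply: (N_sum (@int_sizeD C n g) (fun m => int_size_int g m)) => k.
  rewrite mulrCA; apply: int_sizeM.
    by apply: int_size_le (int_size_int g (q k)).
  by rewrite -hsW; apply: dexp_int_size.
have := liouville g_free xs x0.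
rewrite -/K normrM normrX normr_nat => /le_trans/(_ _).
have NcW : (N%:R : C) ^+ w <= (c ^ w)%:R by rewrite -natrX ler_nat leq_expr.
move=> H; have : (1 : C) <= (c ^ w)%:R * (((D * c) ^ W)%:R * B) * K%:R.
  apply: H; rewrite ler_wpM2r ?ler0n //.
  by apply: ler_pM => //; rewrite exprn_ge0 ?ler0n.
have E : (2 * (c ^ w * (D * c) ^ W * K))%:R =
    2 * ((c ^ w)%:R * ((D * c) ^ W)%:R * K%:R) :> C by rewrite -!natrM.
have X0 : ((c ^ w)%:R * ((D * c) ^ W)%:R * K%:R : C) != 0.
  rewrite -!natrM pnatr_eq0 -lt0n muln_gt0 K_gt0 andbT muln_gt0 !expn_gt0.
  by rewrite muln_gt0 c_gt0.
rewrite /B E; move: X0.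
move: ((c ^ w)%:R : C) (((D * c) ^ W)%:R : C) (K%:R : C) => a b k X0.
have -> : a * (b * (2 * (a * b * k))^-1) * k = 2^-1.
  by move: X0; rewrite !mulf_eq0 !negb_or => /andP[/andP[a0 b0'] k0']; field;
    rewrite ?a0 ?b0' ?k0'.
have half_lt1 : (2^-1 : C) < 1 by rewrite invf_lt1 ?ltr1n ?ltr0n.
by move=> /le_lt_trans/(_ half_lt1); rewrite ltxx.
Qed.

End Contradiction.

(** * Baker's theorem on linear forms in logarithms *)

Section Denominators.
Variables (C : numClosedFieldType) (n : nat) (g : 'cV[C]_n.+1).

Definition has_denom (x : C) :=
  exists N : nat, (0 < N)%N /\ exists B, int_size g (N%:R * x) B.

Lemma has_denom_int_acts x :
  (exists N : nat, (0 < N)%N /\ exists M, int_acts g (N%:R * x) M) -> has_denom x.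
Proof. by move=> [N [N0 [M HM]]]; exists N; split=> //; exact: int_acts_size HM. Qed.

Lemma has_denomM x y : has_denom x -> has_denom y -> has_denom (x * y).
Proof.
move=> [N [N0 [B HB]]] [N' [N'0 [B' HB']]]; exists (N * N')%N.
split; first by rewrite muln_gt0 N0.
by exists (B * B')%N; rewrite natrM mulrACA; apply: int_sizeM.
Qed.

Lemma has_denom1 : has_denom 1.
Proof. by exists 1%N; split=> //; exists 1%N; rewrite mulr1; exact: (int_size_int g 1). Qed.

Lemma has_denomX x m : has_denom x -> has_denom (x ^+ m).
Proof.
move=> xd; elim: m => [|m IHm]; first exact: has_denom1.
by rewrite exprS; apply: has_denomM.
Qed.

Lemma has_denom_prod (I : finType) (f : I -> C) :
  (forall i, has_denom (f i)) -> has_denom (\prod_i f i).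
Proof.
by move=> fP; apply: big_ind => //; [exact: has_denom1 | exact: has_denomM].
Qed.

Lemma common_denom (I : finType) (f : I -> C) : (forall i, has_denom (f i)) ->
  exists N, (0 < N)%N /\ exists B, forall i, int_size g (N%:R * f i) B.
Proof.
move=> /choice[N NP].
have /choice[B BP] i : exists B, int_size g ((\prod_j N j)%N%:R * f i) B.
  have [Ni [B HB]] := NP i; exists ((\prod_(j | j != i) N j) * B)%N.
  rewrite (bigD1 i) //= mulnC natrM -mulrA; apply: int_sizeM => //.
  exact: (int_size_int g (\prod_(j | j != i) N j)%N).
exists (\prod_j N j)%N; split; first by rewrite prodn_gt0 // => i; case: (NP i).
exists (\sum_i B i)%N => i; apply: int_size_le (BP i).
by rewrite (bigD1 i) //= leq_addr.
Qed.

End Denominators.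

Lemma eigenvalue_int_algebraic (C : numClosedFieldType) n (B : 'M[int]_n)
    (v : 'rV[C]_n) a :
  v != 0 -> v *m map_mx intr B = a *: v -> algebraicOver (ratr : rat -> C) a.
Proof.
move=> v0 vB; have : eigenvalue (map_mx intr B) a.
  by apply/eigenvalueP; exists v.
rewrite eigenvalue_root_char => ra; exists (map_poly intr (char_poly B)).
  exact: monic_neq0 (monic_map _ (char_poly_monic B)).
rewrite -map_poly_comp (eq_map_poly (g := intr)) ?map_char_poly // => z /=.
exact: ratr_int.
Qed.

(** The kernel of [Y] is stable under the commuting family, which therefore has a common eigenvector
    inside it. *)
Lemma common_kernel_eigenvector (C : numClosedFieldType) n (Y : 'M[C]_n.+1)
    (As : seq 'M[C]_n.+1) :
  Y \notin unitmx -> (forall A, A \in As -> comm_mx A Y) ->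
  {in As &, forall A B, comm_mx A B} ->
  exists2 v : 'rV[C]_n.+1, v != 0 & v *m Y = 0 /\
    forall A, A \in As -> exists a, v *m A = a *: v.
Proof.
move=> Yu AY AsC; pose V := eigenspace Y 0.
have Y0 : eigenvalue Y 0.
  have /det0P[v v0 vY] : \det Y == 0.
    by move: Yu; rewrite unitmxE unitfE negbK.
  by apply/eigenvalueP; exists v; rewrite // vY scale0r.
have stab A : A \in As -> stablemx V A.
  by move=> /AY AYc; apply: comm_mx_stable_eigenspace; apply: comm_mx_sym.
have [||v v0 /allP/= vP] := @common_eigenvector C _
    [seq restrictmx V A | A <- As].
- by rewrite lt0n mxrank_eq0.
- move=> _ _ /mapP[A AAs ->] /mapP[B BAs ->].
  by rewrite /comm_mx -!conjmxM ?inE ?stablemx_row_base ?stab // AsC.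
exists (v *m row_base V); first by rewrite mulmx_free_eq0 ?row_base_free.
split.
  have /sub_kermxP : (v *m row_base V <= V)%MS by rewrite mulmx_sub // eq_row_base.
  by rewrite raddf0 subr0.
move=> A AAs; have : stablemx (v *m row_base V) A.
  by rewrite -stablemx_restrict ?stab // vP // map_f.
by move=> /eigenvectorP[a vA]; exists a; apply/eigenspaceP.
Qed.

Section Baker.
Variable R : realType.
Local Notation C := R[i].
Local Notation alg := (algebraicOver (ratr : rat -> C)).

Lemma nat_bound (I : finType) (f : I -> C) :
  exists c : nat, forall i, `|f i| <= c%:R.
Proof.
have /choice[c cP] i : exists c : nat, `|f i| <= c%:R.
  exists (Num.bound (`|complex.Re (f i)| + `|complex.Im (f i)|)).
  apply: le_trans (norm_le_ReIm _) _; rewrite -natrC lecR ltW //.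
  by apply: archi_boundP; rewrite addr_ge0.
exists (\sum_i c i)%N => i; apply: le_trans (cP i) _.
by rewrite ler_nat (bigD1 i) //= leq_addr.
Qed.

(** With B_i the integer matrix of N * bet_i, the matrix Y = sum lam_i B_i satisfies Y g = N b0 g,
    and each exp Y_kh is a product of integer powers of the exp lam_i, hence lies in the number
    field. Once Y is invertible, [lattice_contradiction] applies. *)
Lemma baker_independent n (lam bet : 'I_n -> C) (b0 : C) :
  (forall i, alg (bet i)) -> (forall i, alg (cexp (lam i))) -> alg b0 ->
  (forall a : 'I_n -> C, (forall i, alg (a i)) -> \sum_i a i * lam i = 0 ->
     forall i, a i = 0) ->
  \sum_i bet i * lam i = b0 -> b0 = 0.
Proof.
move=> bet_alg lam_alg b0_alg lam_free lam_sum.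
apply/eqP/negPn/negP => b0_neq0.
have [i0 bi0] : exists i, bet i != 0.
  apply: contrapT => /forallNP bet0; case/eqP: b0_neq0; rewrite -lam_sum.
  by rewrite big1 // => i _; have /negP/negPn/eqP-> := bet0 i; rewrite mul0r.
pose s := b0 :: codom bet ++ codom (fun i => cexp (lam i))
            ++ codom (fun i => (cexp (lam i))^-1).
have [|m [g [g_free g_int g_s]]] := @int_lattice_exists C s.
  move=> x; rewrite inE !mem_cat => /or4P[/eqP->|||] // /codomP[i ->] //.
  exact: algebraic_inv.
have bet_den i : has_denom g (bet i).
  by apply/has_denom_int_acts/g_s; rewrite inE !mem_cat codom_f !orbT.
have e_den i : has_denom g (cexp (lam i)).
  apply/has_denom_int_acts/g_s; rewrite inE !mem_cat.
  by rewrite (codom_f (fun i => cexp (lam i)) i) !orbT.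
have eV_den i : has_denom g (cexp (lam i))^-1.
  apply/has_denom_int_acts/g_s; rewrite inE !mem_cat.
  by rewrite (codom_f (fun i => (cexp (lam i))^-1) i) !orbT.
have b0_den : has_denom g b0.
  by apply/has_denom_int_acts/g_s; rewrite inE eqxx.
have [|N [N0 [cb NP]]] := @common_denom _ _ g _ (oapp bet b0); first by case.
have /choice[B BP] i := NP (Some i).
have Nn0 : (N%:R : C) != 0 by rewrite pnatr_eq0 -lt0n.
pose Y : 'M[C]_m.+1 := \sum_i lam i *: map_mx intr (B i).
have Yg : Y *m g = (N%:R * b0) *: g.
  rewrite mulmx_suml -lam_sum mulr_sumr scaler_suml; apply: eq_bigr => i _.
  by rewrite -scalemxAl (BP i).1 scalerA; congr (_ *: _) => /=; ring.
have int_eq (M M' : 'M[int]_m.+1) : map_mx intr M *m g = map_mx intr M' *m g -> M = M'.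
  move=> MM; apply/eqP; rewrite -subr_eq0; apply/eqP/row_matrixP => i.
  rewrite row0; apply: g_free; rewrite map_row -row_mul map_mxB mulmxBl MM.
  by rewrite subrr row0.
have BC i j : B i *m B j = B j *m B i.
  apply: int_eq; rewrite !map_mxM -!mulmxA (BP i).1 (BP j).1 -!scalemxAr.
  by rewrite (BP i).1 (BP j).1 !scalerA mulrC.
have BCC i j : comm_mx (map_mx (intr : int -> C) (B i)) (map_mx intr (B j)).
  by rewrite /comm_mx -!map_mxM BC.
(* A common eigenvector of the B_i in the kernel of Y has eigenvalues a_i with sum a_i lam_i = 0.
   They are algebraic, so independence makes them all 0, and then B_i0 is singular although bet_i0
   is nonzero. *)
have Yu : Y \in unitmx.
  apply: contraT => Yu.
  have [||v v0 [vY vB]] := @common_kernel_eigenvector C m Y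
      (codom (fun i => map_mx (intr : int -> C) (B i))) Yu.
  - move=> A /codomP[i ->]; apply: comm_mx_sum => j _.
    by rewrite /comm_mx -scalemxAr -scalemxAl BCC.
  - by move=> _ _ /codomP[i ->] /codomP[j ->].
  have /choice[a aP] i : exists a, v *m map_mx intr (B i) = a *: v.
    by apply: vB; apply: (codom_f (fun i => map_mx (intr : int -> C) (B i))).
  have a0 : forall i, a i = 0.
    apply: lam_free; first by move=> i; apply: eigenvalue_int_algebraic (aP i).
    have /eqP : (\sum_i a i * lam i) *: v = 0.
      rewrite -vY mulmx_sumr scaler_suml; apply: eq_bigr => i _.
      by rewrite -scalemxAr aP scalerA mulrC.
    by rewrite scaler_eq0 (negPf v0) orbF => /eqP.
  have /det0P[u u0 uB] : \det (B i0) == 0.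
    rewrite -(intr_eq0 C) -det_map_mx; apply/det0P.
    by exists v; rewrite // aP a0 scale0r.
  exfalso; case/eqP: u0; apply: g_free; apply/eqP.
  have : (N%:R * bet i0) *: (map_mx intr u *m g) == 0.
    by rewrite scalemxAr -(BP i0).1 mulmxA -map_mxM uB map_mx0 mul0mx.
  by rewrite scaler_eq0 mulf_eq0 (negPf Nn0) (negPf bi0).
have eY_den (kh : 'I_m.+1 * 'I_m.+1) : has_denom g (cexp (Y kh.1 kh.2)).
  have -> : Y kh.1 kh.2 = \sum_i (B i kh.1 kh.2)%:~R * lam i.
    by rewrite summxE; apply: eq_bigr => i _; rewrite !mxE mulrC.
  rewrite cexp_sum; apply: has_denom_prod => i; rewrite cexp_intM.
  by case: (B i _ _) => z; rewrite ?NegzE -?exprnN -?exprVn; apply: has_denomX.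
have [N' [N'0 [c1 c1P]]] := common_denom eY_den.
have g_size i : exists c, int_size g (g i 0) c.
  by have [M gM] := g_int i; exact: int_acts_size gM.
have [c2 c2P] : exists c, forall i, int_size g (g i 0) c.
  have /choice[f fP] := g_size; exists (\sum_i f i)%N => i.
  by apply: int_size_le (fP i); rewrite (bigD1 i) //= leq_addr.
have [c3 c3P] := nat_bound (fun i => (N%:R * b0) * g i 0).
have [c4 c4P] := nat_bound (fun kh : 'I_m.+1 * 'I_m.+1 => Y kh.1 kh.2).
have [c5 c5P] := nat_bound (fun kh : 'I_m.+1 * 'I_m.+1 => invmx Y kh.1 kh.2).
have [c6 c6P] := nat_bound (fun kh : 'I_m.+1 * 'I_m.+1 =>
  (expR `|complex.Re (Y kh.1 kh.2)|)%:C).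
pose c := (N' + c1 + c2 + cb * c2 + c3 + c4 + c5 + c6)%N.
have le_c x k : (k <= c)%N -> `|x| <= k%:R -> `|x| <= c%:R :> C.
  by move=> kc /le_trans; apply; rewrite ler_nat.
apply: (@lattice_contradiction R m g Y (invmx Y) (N%:R * b0) N' c) => //.
- by move=> i; apply: int_size_le (c2P i); rewrite /c; lia.
- by move=> i; apply: int_size_le (int_sizeM (NP None) (c2P i)); rewrite /c; lia.
- exact: mulVmx.
- by rewrite /c; lia.
- by move=> k h; apply: int_size_le (c1P (k, h)); rewrite /c; lia.
- by move=> k; apply: le_c (c3P k); rewrite /c; lia.
- by move=> k h; apply: le_c (c4P (k, h)); rewrite /c; lia.
- by move=> k h; apply: le_c (c5P (k, h)); rewrite /c; lia.
- move=> k h; rewrite -lecR natrC -[X in X <= _]ger0_norm ?ler0c ?expR_ge0 //.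
  by apply: le_c (c6P (k, h)); rewrite /c; lia.
Qed.

(** Among the expressions of a nonzero value b0, one with the fewest logarithms has them linearly
    independent over the algebraic numbers, since a relation would eliminate one of them. *)
Theorem baker n (lam bet : 'I_n -> C) :
  (forall i, alg (bet i)) -> (forall i, alg (cexp (lam i))) ->
  alg (\sum_i bet i * lam i) -> \sum_i bet i * lam i = 0.
Proof.
move=> bet_alg lam_alg; move bE : (\sum_i bet i * lam i) => b0 b0_alg.
apply/eqP/negPn/negP => b0_neq0.
pose P k := `[< exists lam bet : 'I_k -> C, [/\ forall i, alg (bet i),
  forall i, alg (cexp (lam i)) & \sum_i bet i * lam i = b0] >].
have exP : exists k, P k by exists n; apply/asboolP; exists lam, bet.
case: (ex_minnP exP) => k /asboolP[{lam_alg}lam [{bet_alg}bet [bet_alg lam_alg {}bE]]] kmin.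
have lam_free : forall a : 'I_k -> C, (forall i, alg (a i)) ->
    \sum_i a i * lam i = 0 -> forall i, a i = 0.
  move=> a a_alg a0 j; apply/eqP/negPn/negP => aj.
  case: k => [|k] in lam bet bet_alg lam_alg bE kmin a a_alg a0 j aj *.
    by case: j aj.
  suff : P k by move/kmin; rewrite ltnn.
  apply/asboolP; exists (fun i => lam (lift j i)),
    (fun i => bet (lift j i) - bet j / a j * a (lift j i)); split.
  - move=> i; apply: algebraic_sub => //; apply: algebraic_mul => //.
    exact: algebraic_div.
  - by move=> i.
  - under eq_bigr do rewrite mulrBl -(mulrA (bet j / a j)).
    rewrite sumrB -mulr_sumr -bE (bigD1_ord j) //= addrC; congr (_ + _).
    move: a0; rewrite (bigD1_ord j) //= => /eqP; rewrite addr_eq0 => /eqP E.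
    by rewrite -[X in _ * X]opprK -E; field.
by case/eqP: b0_neq0; apply: (baker_independent bet_alg lam_alg b0_alg lam_free).
Qed.

End Baker.

Local Open Scope classical_set_scope.
Local Open Scope ring_scope.
Local Open Scope complex_scope.

(** * Continuous complex logarithms *)

Section ComplexContinuity.
Variables (R : realType) (V : normedModType R).
Implicit Types (f g : V -> R[i]) (p : V).

Definition ccont f p :=
  ((fun q => complex.Re (f q)) @ p --> complex.Re (f p)) /\
  ((fun q => complex.Im (f q)) @ p --> complex.Im (f p)).

Lemma ccont_cst (c : R[i]) p : ccont (fun=> c) p.
Proof. by split; apply: cvg_cst. Qed.

Lemma ccontD f g p : ccont f p -> ccont g p -> ccont (fun q => f q + g q) p.
Proof.
move=> [f1 f2] [g1 g2]; split.
- rewrite cReD (_ : (fun q => _) = (fun q => complex.Re (f q) + complex.Re (g q))).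
    exact: cvgD.
  by apply/funext => q; rewrite cReD.
- rewrite cImD (_ : (fun q => _) = (fun q => complex.Im (f q) + complex.Im (g q))).
    exact: cvgD.
  by apply/funext => q; rewrite cImD.
Qed.

Lemma ccontM f g p : ccont f p -> ccont g p -> ccont (fun q => f q * g q) p.
Proof.
move=> [f1 f2] [g1 g2]; split.
- rewrite cReM (_ : (fun q => _) = (fun q => complex.Re (f q) * complex.Re (g q)
    - complex.Im (f q) * complex.Im (g q))).
    by apply: cvgB; apply: cvgM.
  by apply/funext => q; rewrite cReM.
- rewrite cImM (_ : (fun q => _) = (fun q => complex.Re (f q) * complex.Im (g q)
    + complex.Im (f q) * complex.Re (g q))).
    by apply: cvgD; apply: cvgM.
  by apply/funext => q; rewrite cImM.
Qed.

Lemma ccont_sum (I : Type) (r : seq I) (F : I -> V -> R[i]) p :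
  (forall i, ccont (F i) p) -> ccont (fun q => \sum_(i <- r) F i q) p.
Proof.
move=> FP; elim: r => [|i r IHr].
  rewrite (_ : (fun q => _) = fun=> 0); first exact: ccont_cst.
  by apply/funext => s; rewrite big_nil.
rewrite (_ : (fun q => _) = fun q => F i q + \sum_(j <- r) F j q).
  exact: ccontD.
by apply/funext => s; rewrite big_cons.
Qed.

Lemma normc2_gt0 (z : R[i]) : z != 0 ->
  0 < complex.Re z ^+ 2 + complex.Im z ^+ 2.
Proof.
case: z => a b; rewrite eq_complex negb_and /= => /orP[a0|b0].
  by rewrite ltr_wpDr ?sqr_ge0 // exprn_even_gt0.
by rewrite ltr_wpDl ?sqr_ge0 // exprn_even_gt0.
Qed.

Lemma ccontV f p : f p != 0 -> ccont f p -> ccont (fun q => (f q)^-1) p.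
Proof.
move=> fp [f1 f2].
have n0 := lt0r_neq0 (normc2_gt0 fp).
have nc : (fun q => (complex.Re (f q) ^+ 2 + complex.Im (f q) ^+ 2)^-1) @ p -->
  (complex.Re (f p) ^+ 2 + complex.Im (f p) ^+ 2)^-1.
  by apply: cvgV => //; apply: cvgD; apply: cvgM.
split.
- rewrite cReV (_ : (fun q => _) = (fun q => complex.Re (f q) *
    (complex.Re (f q) ^+ 2 + complex.Im (f q) ^+ 2)^-1)); first exact: cvgM.
  by apply/funext => q; rewrite cReV.
- rewrite cImV (_ : (fun q => _) = (fun q => - complex.Im (f q) *
    (complex.Re (f q) ^+ 2 + complex.Im (f q) ^+ 2)^-1)).
    by apply: cvgM => //; apply: cvgN.
  by apply/funext => q; rewrite cImV.
Qed.

Lemma ccontX f p n : ccont f p -> ccont (fun q => f q ^+ n) p.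
Proof.
move=> fp; elim: n => [|n IHn]; first exact: ccont_cst.
rewrite (_ : (fun q => _) = fun q => f q * f q ^+ n); first exact: ccontM.
by apply/funext => q; rewrite exprS.
Qed.

End ComplexContinuity.

Lemma is_cderive_ccont (R : realType) (f : R -> R[i]) t d :
  is_cderive f t d -> ccont (f : R^o -> R[i]) t.
Proof.
move=> [f1 f2]; split; apply: differentiable_continuous; apply/derivable1_diffP.
  by case: f1.
by case: f2.
Qed.

Section Clog.
Variable R : realType.
Implicit Types (z w : R[i]).

Lemma is_cderiveV (f : R -> R[i]) t df : f t != 0 -> is_cderive f t df ->
  is_cderive (fun s => (f s)^-1) t (- (f t)^-2 * df).
Proof.
move=> ft fd; have [f1 f2] := fd.
have n0 := lt0r_neq0 (normc2_gt0 ft).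
have VE : (f t)^-2 = (f t)^-1 * (f t)^-1 by rewrite -exprVn.
have dn : is_derive t 1 (fun s => (complex.Re (f s) ^+ 2 + complex.Im (f s) ^+ 2)^-1)
  (- (complex.Re (f t) ^+ 2 + complex.Im (f t) ^+ 2) ^- 2 *
    (2 * complex.Re (f t) * complex.Re df + 2 * complex.Im (f t) * complex.Im df)).
  have := is_deriveD (is_deriveX 2 f1) (is_deriveX 2 f2).
  move=> d2; have H := @is_deriveV _ (fun s => complex.Re (f s) ^+ 2 +
    complex.Im (f s) ^+ 2) _ _ _ n0 d2; apply: is_derive_eq H _.
  by rewrite /GRing.scale /=; ring.
split.
- rewrite (_ : (fun s => _) = (fun s => complex.Re (f s)) *
    (fun s => (complex.Re (f s) ^+ 2 + complex.Im (f s) ^+ 2)^-1)).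
    apply: is_derive_eq (is_deriveM f1 dn) _.
    rewrite VE !(cReM, cReN, cImN, cImM, cReV, cImV) /GRing.scale /=.
    by field.
  by apply/funext => s; rewrite cReV.
- rewrite (_ : (fun s => _) = (- (fun s => complex.Im (f s))) *
    (fun s => (complex.Re (f s) ^+ 2 + complex.Im (f s) ^+ 2)^-1)).
    apply: is_derive_eq (is_deriveM (is_deriveN f2) dn) _.
    rewrite VE !(cReM, cReN, cImN, cImM, cReV, cImV) /GRing.scale /=.
    by rewrite -[(- _) t]/(- complex.Im (f t)); field.
  by apply/funext => s; rewrite cImV.
Qed.

(** The principal logarithm on the right half-plane, the only region where it is used. *)
Definition clog z : R[i] :=
  (ln (complex.Re z ^+ 2 + complex.Im z ^+ 2) / 2) +i* atan (complex.Im z / complex.Re z).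

Lemma clogK z : 0 < complex.Re z -> cexp (clog z) = z.
Proof.
case: z => a b /= a0; rewrite /clog /cexp /=.
have bE : b = a * (b / a) by rewrite mulrC divfK // gt_eqF.
move: (b / a) bE => u bE; pose s := Num.sqrt (1 + u ^+ 2).
have n0 : 0 < 1 + u ^+ 2 by rewrite ltr_pwDl ?sqr_ge0.
have s0 : 0 < s by rewrite sqrtr_gt0.
have s2 : s ^+ 2 = 1 + u ^+ 2 by rewrite sqr_sqrtr // ltW.
have -> : a ^+ 2 + b ^+ 2 = (a * s) ^+ 2 by rewrite bE !exprMn s2; ring.
have as0 : 0 < a * s by rewrite mulr_gt0.
rewrite lnXn // (_ : ln (a * s) *+ 2 / 2 = ln (a * s)); last by field.
rewrite lnK ?posrE //.
have cE : cos (atan u) = s^-1 by rewrite cos_atan.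
have sE : sin (atan u) = u * s^-1.
  rewrite -{2}[u]atanK /tan -cE divfK // cE invr_neq0 // gt_eqF //.
rewrite cE sE mulfK ?gt_eqF // [u * _]mulrC mulrA mulfK ?gt_eqF // mulrC.
by rewrite [u * a]mulrC -bE.
Qed.

Lemma clog1 : clog 1 = 0.
Proof. by rewrite /clog /= expr1n expr0n addr0 ln1 !mul0r atan0. Qed.

Lemma ccont_clog (V : normedModType R) (f : V -> R[i]) p :
  0 < complex.Re (f p) -> ccont f p -> ccont (fun q => clog (f q)) p.
Proof.
move=> fp [f1 f2]; rewrite /clog; split => /=.
- apply: cvgM; last exact: cvg_cst.
  have n0 : 0 < complex.Re (f p) ^+ 2 + complex.Im (f p) ^+ 2.
    by rewrite ltr_pwDl ?sqr_ge0 // exprn_gt0.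
  apply: (@continuous_cvg _ _ _ _ _ (fun q => complex.Re (f q) ^+ 2 +
    complex.Im (f q) ^+ 2) (@ln R)); first exact: continuous_ln.
  by apply: cvgD; apply: cvgM.
- apply: (@continuous_cvg _ _ _ _ _ (fun q => complex.Im (f q) /
    complex.Re (f q)) (@atan R)); first exact: continuous_atan.
  by apply: cvgM => //; apply: cvgV => //; rewrite gt_eqF.
Qed.

Lemma is_cderive_clog1 (f : R -> R[i]) t df : f t = 1 -> is_cderive f t df ->
  is_cderive (fun s => clog (f s)) t df.
Proof.
move=> ft [f1 f2]; split; rewrite /clog /=.
- have d2 := is_deriveD (is_deriveX 2 f1) (is_deriveX 2 f2).
  have n1 : (complex.Re (f t) ^+ 2 + complex.Im (f t) ^+ 2) = 1.
    by rewrite ft /= expr1n expr0n addr0.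
  have dl : is_derive (complex.Re (f t) ^+ 2 + complex.Im (f t) ^+ 2) 1 (@ln R) 1.
    by rewrite n1 -[X in is_derive _ _ _ X]invr1; apply: is_derive1_ln.
  have := is_deriveM (@is_derive1_comp _ (@ln R) (fun s => complex.Re (f s) ^+ 2 +
    complex.Im (f s) ^+ 2) _ _ _ dl d2) (is_derive_cst (2^-1 : R) t 1).
  move=> H; apply: is_derive_eq H _.
  by rewrite ft /= /GRing.scale /=; field.
- have ft0 : complex.Re (f t) != 0 by rewrite ft oner_eq0.
  have dq := is_deriveM f2 (@is_deriveV _ (fun s => complex.Re (f s)) _ _ _ ft0 f1).
  apply: is_derive_eq (@is_derive1_comp _ (@atan R)
    (fun s => complex.Im (f s) / complex.Re (f s)) _ _ _ (is_derive1_atan _) dq) _.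
  by rewrite ft /= /GRing.scale /=; field.
Qed.

End Clog.

Section LogUnique.
Variable R : realType.
Implicit Types (z : R[i]).

Lemma cexp_eq1 z : cexp z = 1 -> `|complex.Im z| < 1 -> z = 0.
Proof.
case: z => a b /= [H1 H2] b1.
have ea0 : expR a != 0 by rewrite gt_eqF ?expR_gt0.
have sb : sin b = 0 by move/eqP: H2; rewrite mulf_eq0 (negPf ea0) => /eqP.
have b0 : b = 0.
  have [b0|b0|//] := ltgtP b 0.
  - suff : 0 < sin (- b) by rewrite sinN sb oppr0 ltxx.
    by apply: sin2_gt0; move: b1; rewrite ltr_norml => /andP[]; lra.
  - suff : 0 < sin b by rewrite sb ltxx.
    by apply: sin2_gt0; move: b1; rewrite ltr_norml => /andP[]; lra.
have a0 : a = 0.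
  by move: H1; rewrite b0 cos0 mulr1 -expR0 => /expR_inj.
by rewrite a0 b0.
Qed.

(** The difference of the two variations takes values z with exp z = 1. If its imaginary part
    reached modulus 1, it would pass through 1/2 or -1/2, where [cexp_eq1] forces z = 0. *)
Lemma log_unique (lam mu : R -> R[i]) :
  (forall t, 0 <= t <= 1 -> ccont (lam : R^o -> _) t) ->
  (forall t, 0 <= t <= 1 -> ccont (mu : R^o -> _) t) ->
  (forall t, 0 <= t <= 1 -> cexp (lam t - lam 0) = cexp (mu t - mu 0)) ->
  lam 1 - lam 0 = mu 1 - mu 0.
Proof.
move=> lamc muc lm.
pose d t := (lam t - lam 0) - (mu t - mu 0).
have d1 t : 0 <= t <= 1 -> cexp (d t) = 1.
  by move=> t01; rewrite /d cexpD cexpN lm // divff // cexp_neq0.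
pose u t := complex.Im (d t).
have u0 : u 0 = 0 by rewrite /u /d !subrr.
have uc : {within `[0, 1], continuous u}.
  apply: continuous_in_subspaceT => t; rewrite inE /= in_itv /= => t01.
  have [_ l2] := lamc t t01; have [_ m2] := muc t t01.
  rewrite /continuous_at /u /d (_ : (fun t => _) = (fun t => (complex.Im (lam t)
    - complex.Im (lam 0)) - (complex.Im (mu t) - complex.Im (mu 0)))).
    rewrite [in X in _ --> X](_ : complex.Im _ = complex.Im (lam t)
    - complex.Im (lam 0) - (complex.Im (mu t) - complex.Im (mu 0))).
      by apply: cvgB; apply: cvgB => //; exact: cvg_cst.
    by rewrite !(cImD, cImN).
  by apply/funext => s; rewrite !(cImD, cImN).
have I01 : (0 <= 1 :> R) by [].
apply/eqP; rewrite -subr_eq0; apply/eqP.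
apply: cexp_eq1; first by rewrite d1 // ler01 lexx.
rewrite ltNge; apply/negP; rewrite -/(d 1) -/(u 1) => u1.
have half v : `|v| = 1 / 2 -> Num.min (u 0) (u 1) <= v <= Num.max (u 0) (u 1) -> False.
  move=> v2 vu; have [c] := IVT I01 uc vu; rewrite in_itv /= => c01 uv.
  have : d c = 0.
    by apply: cexp_eq1; rewrite ?d1 // -/(u c) uv v2; lra.
  move=> dc; move: v2; rewrite -uv /u dc /= normr0; lra.
have [u1p|u1n] := lerP 0 (u 1).
- move: u1; rewrite ger0_norm // => u1.
  apply: (half (1 / 2)); first by rewrite ger0_norm; lra.
  by rewrite u0 (min_idPl _) ?(max_idPr _) //; lra.
- move: u1; rewrite ltr0_norm // => u1.
  apply: (half (- (1 / 2))); first by rewrite normrN ger0_norm; lra.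
  by rewrite u0 (min_idPr _) ?(max_idPl _) //; lra.
Qed.

End LogUnique.

Section StarLog.
Variables (R : realType) (V : normedModType R) (T : set V) (h : V -> R[i]).
Hypotheses (T_compact : compact T)
  (T_star : forall (u : R) p, 0 <= u <= 1 -> T p -> T (u *: p))
  (h_cont : forall p, T p -> ccont h p) (h_neq0 : forall p, T p -> h p != 0).

Lemma uniform_ratio : exists2 e : R, 0 < e &
  forall p q, T p -> T q -> `|q - p| < e -> 0 < complex.Re (h q / h p).
Proof.
pose P (N : nat) (p : V) :=
  forall q, T q -> `|q - p| < N.+1%:R^-1 -> 0 < complex.Re (h q / h p).
have [N _ NP] : \forall N \near \oo, T `<=` P N.
  apply: (compact_near_coveringP T).1 => // x Tx.
  have : \forall qp \near (x, x), 0 < complex.Re (h qp.1 / h qp.2).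
    have c1 : ccont (fun qp : V * V => h qp.1) (x, x).
      have [h1 h2] := h_cont Tx; split => /=.
        by apply: (@cvg_comp _ _ _ fst (fun q => complex.Re (h q)) _ _ _ _ h1); exact: cvg_fst.
      by apply: (@cvg_comp _ _ _ fst (fun q => complex.Im (h q)) _ _ _ _ h2); exact: cvg_fst.
    have c2 : ccont (fun qp : V * V => h qp.2) (x, x).
      have [h1 h2] := h_cont Tx; split => /=.
        by apply: (@cvg_comp _ _ _ snd (fun q => complex.Re (h q)) _ _ _ _ h1); exact: cvg_snd.
      by apply: (@cvg_comp _ _ _ snd (fun q => complex.Im (h q)) _ _ _ _ h2); exact: cvg_snd.
    have [+ _] := ccontM c1 (ccontV (h_neq0 Tx : h (x, x).2 != 0) c2).
    by move=> /cvgr_gt; apply; rewrite /= divff ?h_neq0.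
  move=> /nbhs_ballP[e /= e0 He].
  have e20 : 0 < e / 2 by rewrite divr_gt0.
  exists (ball x (e / 2), [set N : nat | N.+1%:R^-1 < e / 2]).
    split; first exact: nbhsx_ballx.
    exists (Num.bound (e / 2)^-1) => // m /= mN.
    rewrite invf_plt ?posrE //.
    apply: lt_le_trans (archi_boundP _) _; first by rewrite invr_ge0 ltW.
    by rewrite ler_nat leqW.
  move=> [p N] /= [xp Ne] q Tq qp; apply: (He (q, p)); split => /=.
    rewrite -ball_normE /ball_ /= in xp *; rewrite distrC.
    rewrite -[q - x](subrKA p) (le_lt_trans (ler_normD _ _)) //.
    rewrite [e]splitr ltrD //; first exact: lt_trans Ne.
    by rewrite distrC.
  by apply: le_ball xp; rewrite ler_pdivrMr // ler_peMr ?ltW // ltr1n.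
exists (N.+1%:R^-1); first by rewrite invr_gt0.
by move=> p q Tp Tq; apply: (NP N) => //; exact: leqnn.
Qed.

(** Cut the segment from 0 to q into N equal pieces, with N uniform in q because T is compact. The
    ratios of consecutive values of h lie in the right half-plane; their principal logarithms add up
    to a continuous function whose exponential telescopes. *)
Lemma star_log : exists Lam : V -> R[i], forall p, T p ->
  ccont Lam p /\ \forall q \near p, cexp (Lam q) = h q / h 0.
Proof.
have [e e0 He] := uniform_ratio.
have [M [_ /(_ (`|M| + 1)) TM]] := compact_bounded T_compact.
have {}TM p : T p -> `|p| <= `|M| + 1.
  by apply: TM; rewrite (le_lt_trans (ler_norm _)) // ltrDl.
pose N := Num.bound ((`|M| + 1) / e).
have N1 : ((`|M| + 1) / e < N%:R) by apply: archi_boundP; rewrite divr_ge0 ?addr_ge0 // ltW.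
have N0 : (0 : R) < N%:R by apply: le_lt_trans N1; rewrite divr_ge0 ?addr_ge0 // ltW.
pose sc (j : nat) (q : V) := (j%:R / N%:R) *: q.
pose ratio (j : nat) q := h (sc j.+1 q) / h (sc j q).
pose Lam q := \sum_(j < N) clog (ratio j q).
have Tsc j p : T p -> (j <= N)%N -> T (sc j p).
  move=> Tp jN; apply: T_star => //; rewrite divr_ge0 // ler_pdivrMr // mul1r.
  by rewrite ler_nat.
have ratio_pos (j : 'I_N) p : T p -> 0 < complex.Re (ratio j p).
  move=> Tp; apply: He; try by apply: Tsc => //; exact: ltnW.
  rewrite /sc -scalerBl -mulrBl -natrB // subSnn normrZ ger0_norm ?divr_ge0 //.
  rewrite mulrC mulrA mulr1 ltr_pdivrMr //; apply: le_lt_trans (TM p Tp) _.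
  by rewrite -ltr_pdivrMl // mulrC.
have sc_cont j p : sc j @ p --> sc j p by apply: cvgZ; [exact: cvg_cst | exact: cvg_id].
have hsc j p : T p -> (j <= N)%N -> ccont (fun q => h (sc j q)) p.
  move=> Tp jN; have [h1 h2] := h_cont (Tsc j p Tp jN); split.
    exact: (cvg_comp (sc j) (fun q => complex.Re (h q)) (sc_cont j p) h1).
  exact: (cvg_comp (sc j) (fun q => complex.Im (h q)) (sc_cont j p) h2).
have ratio_cont (j : 'I_N) p : T p -> ccont (ratio j) p.
  move=> Tp; apply: ccontM; first exact: hsc.
  by apply: ccontV; [apply/h_neq0/Tsc => //; exact: ltnW | apply: hsc => //; exact: ltnW].
exists Lam => p Tp; split.
  by apply: ccont_sum => j; apply: ccont_clog; [exact: ratio_pos | exact: ratio_cont].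
have : \forall q \near p, forall j : 'I_N, 0 < complex.Re (ratio j q).
  apply: filter_forall => j; have [r1 _] := ratio_cont j p Tp.
  by apply: (cvgr_gt _ r1); exact: ratio_pos.
apply: filterS => q rq.
rewrite /Lam cexp_sum (eq_bigr (fun j : 'I_N => ratio j q)); last first.
  by move=> j _; rewrite clogK.
have tel m : (m <= N)%N -> (0 < m)%N -> \prod_(j < m) ratio j q = h (sc m q) / h (sc 0 q).
  elim: m => // m IHm mN _; rewrite big_ord_recr /=.
  case: m => [|m] in IHm mN *; first by rewrite big_ord0 mul1r.
  rewrite IHm //; last exact: ltnW.
  have hm : h (sc m.+1 q) != 0.
    apply/eqP => h0; have := rq (Ordinal mN); rewrite /ratio /= h0 invr0 mulr0.
    by rewrite ltxx.
  by rewrite mulrC mulrA /ratio divfK.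
rewrite tel //.
by rewrite /sc mul0r scale0r divff ?gt_eqF // scale1r.
Qed.

End StarLog.

Section PathLog.
Variables (R : realType) (h : R -> R[i]).
Hypotheses (h_cont : forall t, 0 <= t <= 1 -> ccont (h : R^o -> _) t)
  (h_neq0 : forall t, 0 <= t <= 1 -> h t != 0).

(** The segment is star-shaped about 0. Near t the logarithm coincides with lam t + clog (h / h t),
    as both have the same exponential and are close; this gives its derivative. *)
Lemma path_log : exists lam : R -> R[i], forall t, 0 <= t <= 1 ->
  [/\ ccont (lam : R^o -> _) t, cexp (lam t - lam 0) = h t / h 0 &
    forall dh, is_cderive h t dh -> is_cderive lam t (dh / h t)].
Proof.
have [||||lam lamP] := @star_log R R^o `[0, 1] h.
- exact: segment_compact.
- move=> u p /andP[u0 u1]; rewrite /= ?in_itv /= => /andP[p0 p1].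
  by rewrite mulr_ge0 //= mulr_ile1.
- by move=> p /= p01; apply: h_cont; move: p01; rewrite in_itv.
- by move=> p /= p01; apply: h_neq0; move: p01; rewrite in_itv.
have {}lamP t : 0 <= t <= 1 -> ccont (lam : R^o -> _) t /\
    \forall q \near t, cexp (lam q) = h q / h 0.
  by move=> t01; apply: lamP; rewrite /= in_itv.
have z01 : 0 <= (0 : R) <= 1 by rewrite lexx ler01.
have lamE t : 0 <= t <= 1 -> cexp (lam t) = h t / h 0.
  by move=> /lamP[_ /nbhs_singleton].
have lam0 : cexp (lam 0) = 1 by rewrite lamE // divff // h_neq0.
exists lam => t t01; have [lc ln] := lamP t t01; split=> //.
  by rewrite cexpD cexpN lam0 invr1 mulr1 lamE.
move=> dh hd; have ht := h_neq0 t01.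
pose q s := h s / h t.
have qt : q t = 1 by rewrite /q divff.
have qd : is_cderive q t (dh / h t).
  by apply: is_cderive_eq (is_cderiveM hd (is_cderive_cst _ _)) _; rewrite mulr0 addr0.
have qc : ccont (q : R^o -> _) t by apply: ccontM; [exact: h_cont | exact: ccont_cst].
pose d s := lam s - (lam t + clog (q s)).
have dc : ccont (d : R^o -> _) t.
  rewrite (_ : d = fun s => lam s + (-1) * (lam t + clog (q s))).
    apply: ccontD => //; apply: ccontM; first exact: ccont_cst.
    apply: ccontD; first exact: ccont_cst.
    by apply: ccont_clog => //; rewrite qt.
  by apply/funext => s; rewrite mulN1r.
have dt : d t = 0 by rewrite /d qt clog1 addr0 subrr.
have d0 : \forall s \near t, lam s = lam t + clog (q s).
  have qpos : \forall s \near t, 0 < complex.Re (q s).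
    by have [q1 _] := qc; apply: (cvgr_gt _ q1); rewrite qt.
  have dsm : \forall s \near t, `|complex.Im (d s)| < 1.
    have [_ d2] := dc; apply: (cvgr_norm_lt _ d2); by rewrite dt /= normr0.
  apply: filterS3 ln qpos dsm => s ls qs ds.
  apply/eqP; rewrite -subr_eq0; apply/eqP/cexp_eq1 => //.
  rewrite cexpD cexpN ls cexpD lamE // clogK // /q.
  have h0 : h 0 != 0 by apply: h_neq0.
  have hs : h s != 0.
    by apply: contraTneq qs => hs; rewrite /q hs mul0r ltxx.
  by field; rewrite hs ht h0.
have [c1 c2] : is_cderive (fun s => lam t + clog (q s)) t (dh / h t).
  apply: is_cderive_eq (is_cderiveD (is_cderive_cst _ _) (is_cderive_clog1 qt qd)) _.
  by rewrite add0r.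
split; [apply: near_eq_is_derive c1 | apply: near_eq_is_derive c2];
  by apply: filterS d0 => s ->.
Qed.
End PathLog.

Lemma cvg_point_pair (T U V : topologicalType) (p : T) (f : T -> U) (g : T -> V)
    (a : U) (b : V) :
  f @ p --> a -> g @ p --> b -> (fun q => (f q, g q)) @ p --> (a, b).
Proof.
by move=> fa gb; exact: (@cvg_pair _ _ _ (nbhs p) (nbhs a) (nbhs b) _ _ _ f g fa gb).
Qed.

Section LogVariation.
Variable R : realType.
Implicit Types (h lam : R -> R[i]).

Definition is_path_log h lam := forall t, 0 <= t <= 1 ->
  ccont (lam : R^o -> _) t /\ cexp (lam t - lam 0) = h t / h 0.

(* The variation of a continuous logarithm of h along [0, 1]. *)
Definition logvar h : R[i] :=
  xget 0 [set w | exists lam, is_path_log h lam /\ w = lam 1 - lam 0].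

Lemma logvarE h lam : is_path_log h lam -> logvar h = lam 1 - lam 0.
Proof.
move=> hl; rewrite /logvar; case: xgetP => [w _ [mu [hm ->]]|H].
  apply: log_unique => t t01; [by case: (hm t t01)|by case: (hl t t01)|].
  by rewrite (hm t t01).2 (hl t t01).2.
by case: (H (lam 1 - lam 0)); exists lam.
Qed.

Lemma eq_logvar h h' : (forall t, 0 <= t <= 1 -> h t = h' t) -> logvar h = logvar h'.
Proof.
move=> hh; congr xget; apply/seteqP; split => w [lam [hl ->]]; exists lam; split=> // t t01;
  by have [? ?] := hl t t01; split=> //; rewrite ?hh ?lexx ?ler01 // -!hh ?lexx ?ler01.
Qed.

Lemma cexp_logvar h :
  (forall t, 0 <= t <= 1 -> ccont (h : R^o -> _) t) ->
  (forall t, 0 <= t <= 1 -> h t != 0) -> cexp (logvar h) = h 1 / h 0.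
Proof.
move=> hc h0; have [lam lamP] := path_log hc h0.
have hl : is_path_log h lam by move=> t /lamP[].
by rewrite (logvarE hl) (hl 1 _).2 // lexx ler01.
Qed.

Lemma ccont_comp (U V : normedModType R) (F : V -> R[i]) (e : U -> V) (p : U) :
  e @ p --> e p -> ccont F (e p) -> ccont (F \o e) p.
Proof.
move=> ec [F1 F2]; split.
- exact: (cvg_comp e (fun q => complex.Re (F q)) ec F1).
- exact: (cvg_comp e (fun q => complex.Im (F q)) ec F2).
Qed.

Definition triangle : set (R^o * R^o) := [set p | [/\ 0 <= p.1, 0 <= p.2 & p.1 + p.2 <= 1]].

Lemma compact_triangle : compact triangle.
Proof.
pose F (q : R^o * R^o) : R^o * R^o := (q.1 * (1 - q.2), q.1 * q.2).
have -> : triangle = F @` (`[0, 1] `*` `[0, 1]).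
  apply/seteqP; split => [[s t] [/= s0 t0 st]|_ [[u v] [/= + +] <-]]; last first.
    rewrite !in_itv /= => /andP[u0 u1] /andP[v0 v1]; split => /=.
    - by rewrite mulr_ge0 // subr_ge0.
    - by rewrite mulr_ge0.
    - by rewrite -mulrDr subrK mulr1.
  have [st0|st0] := eqVneq (s + t) 0.
    have [-> ->] : s = 0 /\ t = 0 by lra.
    by exists (0, 0) => /=; rewrite ?in_itv /= ?lexx ?ler01 // /F /= !mul0r.
  have stp : 0 < s + t by rewrite lt0r st0 addr_ge0.
  exists (s + t, t / (s + t)); rewrite /= ?in_itv /=.
    by rewrite addr_ge0 // st divr_ge0 ?addr_ge0 //= ler_pdivrMr // mul1r lerDr.
  by rewrite /F /=; congr pair; field.
apply: continuous_compact; last by apply: compact_setX; exact: segment_compact.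
apply: continuous_subspaceT => q; apply: cvg_point_pair => /=.
  by apply: cvgM; [exact: cvg_fst | apply: cvgB; [exact: cvg_cst | exact: cvg_snd]].
by apply: cvgM; [exact: cvg_fst | exact: cvg_snd].
Qed.

(** One logarithm exists on the whole triangle, which is star-shaped about its vertex 0, and its
    variations along the edges telescope. *)
Lemma logvar_triangle (h : R^o * R^o -> R[i]) :
  (forall p, triangle p -> ccont h p) -> (forall p, triangle p -> h p != 0) ->
  logvar (fun t => h (1 - t, t)) - logvar (fun t => h (0, t))
    + logvar (fun t => h (t, 0)) = 0.
Proof.
move=> hc h0.
have [|Lam LamP] := star_log compact_triangle _ hc h0.
  move=> u [s t] /andP[u0 u1] [/= s0 t0 st]; split => /=.
  - by rewrite mulr_ge0.
  - by rewrite mulr_ge0.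
  - by rewrite -mulrDr mulr_ile1 // addr_ge0.
have LE p : triangle p -> cexp (Lam p) = h p / h 0.
  by move=> /LamP[_ /nbhs_singleton].
have h00 : h 0 != 0 by apply: h0; split => /=; rewrite ?addr0 ?lexx ?ler01.
have edge (e : R^o -> R^o * R^o) : (forall t, e @ t --> e t) ->
    (forall t, 0 <= t <= 1 -> triangle (e t)) ->
    logvar (fun t => h (e t)) = Lam (e 1) - Lam (e 0).
  move=> ec eT; apply: (@logvarE _ (Lam \o e)) => t t01.
  have z01 : 0 <= (0 : R) <= 1 by rewrite lexx ler01.
  split; first by apply: ccont_comp => //; case: (LamP _ (eT t t01)).
  rewrite /= cexpD cexpN !LE; [|exact: eT|exact: eT].
  by field; rewrite h00 h0 //; exact: eT.
rewrite (edge (fun t => (1 - t, t))); first rewrite (edge (fun t => (0, t))).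
- rewrite (edge (fun t => (t, 0))).
  + by rewrite !subr0 subrr; ring.
  + by move=> t; apply: cvg_point_pair; [exact: cvg_id | exact: cvg_cst].
  + by move=> t /andP[t0 t1]; split => /=; rewrite ?addr0.
- by move=> t; apply: cvg_point_pair; [exact: cvg_cst | exact: cvg_id].
- by move=> t /andP[t0 t1]; split => /=; rewrite ?add0r.
- move=> t; apply: cvg_point_pair; last exact: cvg_id.
  by apply: cvgB; [exact: cvg_cst | exact: cvg_id].
- by move=> t /andP[t0 t1]; split => /=; rewrite ?subrK ?subr_ge0.
Qed.

End LogVariation.

(** * Rational expressions in the points, and formal partial fractions *)

Inductive rexp (l : nat) :=
| RRat of rat
| RPt of 'I_l
| RAdd of rexp l & rexp l
| RMul of rexp l & rexp l
| RInv of 'I_l & 'I_l.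
Arguments RRat {l}.
HB.instance Definition _ (l : nat) := gen_eqMixin (rexp l).

(** Expressions stay formal because the same one is evaluated at real configurations, to see that it
    is not identically zero, and at complex ones, where it is algebraic and a quotient of
    polynomials in the coordinates. *)
Fixpoint reval (F : numFieldType) l (x : 'I_l -> F) (e : rexp l) : F :=
  match e with
  | RRat q => ratr q
  | RPt i => x i
  | RAdd a b => reval x a + reval x b
  | RMul a b => reval x a * reval x b
  | RInv i j => (x i - x j)^-1
  end.

(** The condition on inverses makes every denominator nonzero at pairwise distinct points. *)
Fixpoint rwf l (J : pred 'I_l) (e : rexp l) : bool :=
  match e with
  | RRat q => true
  | RPt i => J i
  | RAdd a b => rwf J a && rwf J b
  | RMul a b => rwf J a && rwf J b
  | RInv i j => [&& J i, J j & i != j]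
  end.

Definition RSub l (i j : 'I_l) := RAdd (RPt i) (RMul (RRat (-1)) (RPt j)).
Definition RPow l (e : rexp l) n := iter n (RMul e) (RRat 1).
Definition RPowz l (i j : 'I_l) (n : int) :=
  match n with Posz n => RPow (RSub i j) n | Negz n => RPow (RInv i j) n.+1 end.

Lemma reval_sub (F : numFieldType) l (x : 'I_l -> F) i j :
  reval x (RSub i j) = x i - x j.
Proof. by rewrite /= rmorphN1 mulN1r. Qed.

Lemma reval_pow (F : numFieldType) l (x : 'I_l -> F) e n :
  reval x (RPow e n) = reval x e ^+ n.
Proof. by elim: n => [|n IHn] /=; rewrite ?rmorph1 // IHn exprS. Qed.

Lemma reval_powz (F : numFieldType) l (x : 'I_l -> F) i j n :
  reval x (RPowz i j n) = (x i - x j) ^ n.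
Proof. by case: n => n; rewrite reval_pow ?reval_sub //= exprVn NegzE exprnN. Qed.

Lemma rwf_pow l (J : pred 'I_l) e n : rwf J e -> rwf J (RPow e n).
Proof. by move=> eJ; elim: n => //= n ->; rewrite eJ. Qed.

Lemma rwf_powz l (J : pred 'I_l) i j n :
  J i -> J j -> (n < 0 -> i != j) -> rwf J (RPowz i j n).
Proof.
by move=> Ji Jj; case: n => n ij; apply: rwf_pow; rewrite /= Ji Jj //= ij.
Qed.

Lemma rwf_mono l (J J' : pred 'I_l) e : subpred J J' -> rwf J e -> rwf J' e.
Proof.
move=> JJ; elim: e => //= [a IHa b IHb|a IHa b IHb|i j].
- by case/andP => /IHa-> /IHb->.
- by case/andP => /IHa-> /IHb->.
- by case/and3P => /JJ-> /JJ-> ->.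
Qed.

Lemma reval_local (F : numFieldType) l (J : pred 'I_l) (x y : 'I_l -> F) e :
  rwf J e -> (forall i, J i -> x i = y i) -> reval x e = reval y e.
Proof.
move=> + xy; elim: e => //= [a IHa b IHb|a IHa b IHb|i j].
- by case/andP => /IHa-> /IHb->.
- by case/andP => /IHa-> /IHb->.
- by case/and3P => /xy-> /xy-> _.
Qed.

Lemma reval_morph (F F' : numFieldType) (f : {rmorphism F -> F'}) l
    (x : 'I_l -> F) e : reval (f \o x) e = f (reval x e).
Proof.
elim: e => //= [q|a IHa b IHb|a IHa b IHb|i j].
- by rewrite fmorph_rat.
- by rewrite IHa IHb rmorphD.
- by rewrite IHa IHb rmorphM.
- by rewrite fmorphV rmorphB.
Qed.

Lemma reval_algebraic (F : numFieldType) l (J : pred 'I_l) (x : 'I_l -> F) e :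
  rwf J e -> (forall i, J i -> algebraicOver (ratr : rat -> F) (x i)) ->
  algebraicOver (ratr : rat -> F) (reval x e).
Proof.
move=> + xa; elim: e => //= [q|a IHa b IHb|a IHa b IHb|i j].
- by move=> _; exact: algebraic_id.
- by case/andP => /IHa ? /IHb ?; exact: algebraic_add.
- by case/andP => /IHa ? /IHb ?; exact: algebraic_mul.
- by case/and3P => Ji Jj _; apply/algebraic_inv/algebraic_sub; apply: xa.
Qed.

Section PartialFractions.
Variable l : nat.

(* A triple (c, i, n) stands for the term c(x) (u - x_i)^n of a partial
   fraction expansion in u. *)
Definition term := (rexp l * 'I_l * int)%type.

Definition mul_term j (t : term) : seq term :=
  [:: (t.1.1, t.1.2, t.2 + 1); (RMul t.1.1 (RSub t.1.2 j), t.1.2, t.2)].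

(* (u - a)^(n+1) / (u - b) = (u - a)^n + (b - a) (u - a)^n / (u - b) *)
Fixpoint div_nat c i j n : seq term :=
  if n is n'.+1 then (c, i, n'%:Z) :: div_nat (RMul c (RSub j i)) i j n'
  else [:: (c, j, -1)].

(* 1 / ((u - a)^(n+1) (u - b))
   = (b - a)^-1 (1 / ((u - a)^n (u - b)) - 1 / (u - a)^(n+1)) *)
Fixpoint div_pole c i j n : seq term :=
  if n is n'.+1 then
    let c' := RMul c (RInv j i) in
    (RMul (RRat (-1)) c', i, - n'.+1%:Z) :: div_pole c' i j n'
  else [:: (c, j, -1)].

Definition div_term j (t : term) : seq term :=
  match t.2 with
  | Posz n => div_nat t.1.1 t.1.2 j n
  | Negz n => if t.1.2 == j then [:: (t.1.1, j, Negz n.+1)]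
              else div_pole t.1.1 t.1.2 j n.+1
  end.

Lemma div_term_nat j c i (n : nat) : div_term j (c, i, n%:Z) = div_nat c i j n.
Proof. by []. Qed.
Lemma div_term_neg j c i n : div_term j (c, i, Negz n) =
  if i == j then [:: (c, j, Negz n.+1)] else div_pole c i j n.+1.
Proof. by []. Qed.

Definition mulE j (E : seq term) := flatten [seq mul_term j t | t <- E].
Definition divE j (E : seq term) := flatten [seq div_term j t | t <- E].

(** The invariant of an expansion: [J] holds the points it may depend on, [P] those where it may
    have a pole. *)
Definition good (J P : pred 'I_l) (t : term) :=
  [&& rwf J t.1.1, J t.1.2 & (t.2 < 0) ==> P t.1.2].
Notation goodE J P E := (all (good J P) E).

Lemma good_mono (J J' P P' : pred 'I_l) E : subpred J J' -> subpred P P' ->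
  goodE J P E -> goodE J' P' E.
Proof.
move=> JJ PP; apply: sub_all => t /and3P[tr Jt /implyP Pt]; apply/and3P; split.
- exact: rwf_mono tr.
- exact: JJ.
- by apply/implyP => /Pt /PP.
Qed.

Lemma good_mul (J P : pred 'I_l) j E : J j -> goodE J P E -> goodE J P (mulE j E).
Proof.
move=> Jj; elim: E => //= t E IHE /andP[/and3P[tr Jt Pt] /IHE {}IHE].
rewrite /good /= tr Jj Jt Pt /=; apply/andP; split=> //.
by apply/implyP => t1; apply: (implyP Pt); lia.
Qed.

Lemma good_div_nat (J P : pred 'I_l) c i j n : rwf J c -> J i -> J j -> P j ->
  goodE J P (div_nat c i j n).
Proof.
move=> + Ji Jj Pj; elim: n c => [|n IHn] c cJ /=; first by rewrite /good /= cJ Jj Pj.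
by rewrite /good /= cJ Ji /= IHn //= cJ Ji Jj.
Qed.

Lemma good_div_pole (J P : pred 'I_l) c i j n :
  rwf J c -> J i -> J j -> P i -> P j -> i != j -> goodE J P (div_pole c i j n).
Proof.
move=> + Ji Jj Pi Pj ij.
elim: n c => [|n IHn] c cJ /=; first by rewrite /good /= cJ Jj Pj.
by rewrite /good /= cJ Ji Pi Jj ?implybT (eq_sym j i) ij /= IHn //= cJ Ji Jj (eq_sym j i) ij.
Qed.

Lemma good_div (J P : pred 'I_l) j E :
  J j -> P j -> goodE J P E -> goodE J P (divE j E).
Proof.
move=> Jj Pj; elim: E => //= t E IHE /andP[/and3P[tr Jt Pt] /IHE {}IHE].
rewrite all_cat IHE andbT; case: t tr Jt Pt => [[c i] n] /= cr Ji.
case: n => n Pi; first exact: good_div_nat.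
rewrite div_term_neg; case: eqVneq => [_|ij]; first by rewrite /good /= cr Jj Pj.
by apply: good_div_pole => //; exact: (implyP Pi isT).
Qed.

Section Evaluation.
Variables (F : numFieldType) (x : 'I_l -> F).

Definition pf_eval (E : seq term) u : F :=
  \sum_(t <- E) reval x t.1.1 * (u - x t.1.2) ^ t.2.
Definition pf_prim (E : seq term) u : F :=
  \sum_(t <- E | t.2 != -1)
     reval x t.1.1 / (t.2 + 1)%:~R * (u - x t.1.2) ^ (t.2 + 1).
Definition pf_res (E : seq term) i : F :=
  \sum_(t <- E | (t.1.2 == i) && (t.2 == -1)) reval x t.1.1.
Definition pf_poly (E : seq term) : {poly F} :=
  \sum_(t <- E | 0 <= t.2) reval x t.1.1 *: ('X - (x t.1.2)%:P) ^+ `|t.2|%N.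

Lemma pf_eval_cat E E' u : pf_eval (E ++ E') u = pf_eval E u + pf_eval E' u.
Proof. by rewrite /pf_eval big_cat. Qed.
Lemma pf_res_cat E E' i : pf_res (E ++ E') i = pf_res E i + pf_res E' i.
Proof. by rewrite /pf_res big_cat. Qed.
Lemma pf_poly_cat E E' : pf_poly (E ++ E') = pf_poly E + pf_poly E'.
Proof. by rewrite /pf_poly big_cat. Qed.

Lemma pf_eval_cons t E u :
  pf_eval (t :: E) u = reval x t.1.1 * (u - x t.1.2) ^ t.2 + pf_eval E u.
Proof. by rewrite /pf_eval big_cons. Qed.
Lemma pf_eval_nil u : pf_eval [::] u = 0.
Proof. by rewrite /pf_eval big_nil. Qed.

Lemma pf_eval_mul (J P : pred 'I_l) j E u : goodE J P E -> (forall i, P i -> u != x i) ->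
  pf_eval (mulE j E) u = (u - x j) * pf_eval E u.
Proof.
move=> + uP; elim: E => [|t E IHE] /=; first by rewrite !pf_eval_nil mulr0.
move=> /andP[/and3P[_ _ /implyP Pt] /IHE {}IHE].
rewrite -/(mulE j E) !pf_eval_cons IHE.
have -> : (u - x t.1.2) ^ (t.2 + 1) = (u - x t.1.2) * (u - x t.1.2) ^ t.2.
  case: (ltP t.2 0) => t0.
    by rewrite [t.2 + 1]addrC expfzDr // subr_eq0 uP ?Pt.
  by rewrite [t.2 + 1]addrC exprzD_ss // t0.
rewrite /= rmorphN1 mulN1r; ring.
Qed.

Lemma pf_eval_div_nat c i j n u : u != x j ->
  pf_eval (div_nat c i j n) u = reval x c * (u - x i) ^+ n / (u - x j).
Proof.
move=> u_j; have uj : u - x j != 0 by rewrite subr_eq0.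
elim: n c => [|n IHn] c /=.
  by rewrite pf_eval_cons pf_eval_nil addr0 /= expr0 mulr1.
rewrite pf_eval_cons IHn /= rmorphN1 mulN1r exprS -exprnP; field => //.
Qed.

Lemma pf_eval_div_pole c i j n u : u != x j -> u != x i -> x i != x j ->
  pf_eval (div_pole c i j n) u = reval x c * (u - x i) ^- n / (u - x j).
Proof.
move=> u_j u_i i_j; have uj : u - x j != 0 by rewrite subr_eq0.
have ui : u - x i != 0 by rewrite subr_eq0.
have ij : x j - x i != 0 by rewrite subr_eq0 eq_sym.
elim: n c => [|n IHn] c.
  by rewrite /= pf_eval_cons pf_eval_nil addr0 /= expr0 invr1 mulr1.
rewrite /div_pole -/(div_pole _ _ _ _) pf_eval_cons IHn /= rmorphN1 -exprnN exprS.
have un : (u - x i) ^+ n != 0 by rewrite expf_neq0.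
by field; rewrite ij ui un uj.
Qed.

Lemma pf_eval_div (J P : pred 'I_l) j E u : goodE J P E -> (forall i, P i -> u != x i) ->
  (forall i k, J i -> J k -> i != k -> x i != x k) -> J j -> P j ->
  pf_eval (divE j E) u = pf_eval E u / (u - x j).
Proof.
move=> + uP xinj Jj Pj; elim: E => [|t E IHE] /=; first by rewrite !pf_eval_nil mul0r.
move=> /andP[/and3P[_ Jt /implyP Pt] /IHE {}IHE].
rewrite pf_eval_cat -/(divE j E) pf_eval_cons IHE mulrDl; congr (_ + _).
case: t Jt Pt => [[c i] n] /= Ji.
case: n => n Pi; first by rewrite div_term_nat pf_eval_div_nat ?uP.
have {}Pi := Pi isT; rewrite div_term_neg.
case: eqVneq => [->|ij].
  rewrite pf_eval_cons pf_eval_nil addr0 /= -mulrA; congr (_ * _).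
  by rewrite !NegzE -!exprnN [in LHS]exprSr invfM mulrC.
by rewrite pf_eval_div_pole ?uP ?xinj // NegzE -exprnN.
Qed.

Lemma pf_poly_cons t E : 0 <= t.2 ->
  pf_poly (t :: E) = reval x t.1.1 *: ('X - (x t.1.2)%:P) ^+ `|t.2|%N + pf_poly E.
Proof. by move=> t0; rewrite /pf_poly big_cons t0. Qed.
Lemma pf_poly_cons_neg t E : t.2 < 0 -> pf_poly (t :: E) = pf_poly E.
Proof. by move=> t0; rewrite /pf_poly big_cons leNgt t0. Qed.
Lemma pf_poly_nil : pf_poly [::] = 0.
Proof. by rewrite /pf_poly big_nil. Qed.

Lemma mul_nonneg j (E : seq term) : all (fun t : term => 0 <= t.2) E ->
  all (fun t : term => 0 <= t.2) (mulE j E).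
Proof. by elim: E => //= t E IHE /andP[t0 /IHE ->]; rewrite t0 addr_ge0. Qed.

Lemma pf_poly_mul j E : all (fun t : term => 0 <= t.2) E ->
  pf_poly (mulE j E) = ('X - (x j)%:P) * pf_poly E.
Proof.
elim: E => [|t E IHE] /=; first by rewrite !pf_poly_nil mulr0.
move=> /andP[t0 /IHE {}IHE]; rewrite -/(mulE j E) !pf_poly_cons ?addr_ge0 //= IHE.
case: t t0 => [[c i] n] /= n0; rewrite rmorphN1 mulN1r.
case: n n0 => // n _; rewrite absz_nat (_ : absz (n%:Z + 1)%R = n.+1); last by lia.
rewrite exprS -!mul_polyC rmorphM rmorphB /=; ring.
Qed.

Lemma pf_poly_div_nat c i j n :
  pf_poly (div_nat c i j n) * ('X - (x j)%:P) =
  reval x c *: (('X - (x i)%:P) ^+ n - ((x j - x i) ^+ n)%:P).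
Proof.
elim: n c => [|n IHn] c /=.
  by rewrite pf_poly_cons_neg // pf_poly_nil !expr0 mul0r subrr scaler0.
rewrite pf_poly_cons //= mulrDl IHn /= rmorphN1 mulN1r !exprS -!mul_polyC.
rewrite !(rmorphM, rmorphB, rmorphXn) /=; ring.
Qed.

Lemma pf_poly_div_pole c i j n : pf_poly (div_pole c i j n) = 0.
Proof.
by elim: n c => [|n IHn] c /=; rewrite pf_poly_cons_neg ?pf_poly_nil.
Qed.

(** On polynomial parts, dividing by u - x_j is Euclidean division; the remainder goes into a polar
    term. *)
Lemma pf_poly_div j E : exists r,
  pf_poly E = pf_poly (divE j E) * ('X - (x j)%:P) + r%:P.
Proof.
elim: E => [|t E [r IHE]]; first by exists 0; rewrite !pf_poly_nil mul0r addr0.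
case: t => [[c i] n]; have -> t : divE j (t :: E) = div_term j t ++ divE j E by [].
rewrite pf_poly_cat.
case: n => n; rewrite ?div_term_nat ?div_term_neg.
  exists (r + reval x c * (x j - x i) ^+ n).
  rewrite pf_poly_cons //= mulrDl pf_poly_div_nat IHE -!mul_polyC.
  rewrite !(rmorphM, rmorphB, rmorphXn, rmorphD) /=; ring.
exists r; rewrite pf_poly_cons_neg // IHE.
case: eqVneq => _; first by rewrite pf_poly_cons_neg // pf_poly_nil add0r.
by rewrite pf_poly_div_pole add0r.
Qed.

Lemma pf_res_div_nat c i j n : pf_res (div_nat c i j n) j = reval x c * (x j - x i) ^+ n.
Proof.
elim: n c => [|n IHn] c /=.
  by rewrite /pf_res big_cons big_nil /= !eqxx addr0 mulr1.
by rewrite /pf_res big_cons /= andbF -/(pf_res _ _) IHn /= rmorphN1 mulN1r exprS mulrA.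
Qed.

Lemma pf_res_div j E : goodE predT (pred1 j) E ->
  pf_res (divE j E) j = (pf_poly E).[x j].
Proof.
elim: E => [|t E IHE] /=.
  by rewrite pf_poly_nil horner0 /pf_res big_nil.
move=> /andP[/and3P[_ _ /implyP Pt] /IHE {}IHE].
rewrite -/(divE j E) pf_res_cat IHE.
case: t Pt => [[c i] n] /=.
case: n => n Pi; rewrite ?div_term_nat ?div_term_neg.
  rewrite pf_poly_cons //= hornerD hornerZ pf_res_div_nat.
  by rewrite horner_exp hornerXsubC.
rewrite pf_poly_cons_neg // (eqP (Pi isT)) eqxx.
by rewrite /pf_res big_cons big_nil /= andbF add0r.
Qed.

(** Dividing m + 1 times by u - x_j turns the Taylor coefficient of order m at x_j into a residue;
    negative powers of u - x_j already present only become more negative. *)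
Lemma pf_res_iter_div j m E : goodE predT (pred1 j) E ->
  pf_res (iter m.+1 (divE j) E) j = ((pf_poly E)^`N(m)).[x j].
Proof.
elim: m E => [|m IHm] E gE; first by rewrite nderivn0 pf_res_div.
rewrite iterSr IHm; last by apply: good_div; rewrite //= eqxx.
have [r ->] := pf_poly_div j E.
set q := pf_poly _.
have -> : q * ('X - (x j)%:P) + r%:P = q * 'X + r%:P - x j *: q.
  by rewrite -mul_polyC; ring.
rewrite linearB /= linearZ /= nderivnMXaddC !(hornerD, hornerN, hornerZ, hornerM, hornerX).
by rewrite mulrC addrK.
Qed.

Lemma pf_res0 (J P : pred 'I_l) E i : goodE J P E -> ~~ P i -> pf_res E i = 0.
Proof.
move=> + Pi; rewrite /pf_res; elim: E => [_|t E IHE /= /andP[/and3P[_ _ Pt] /IHE Er]].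
  by rewrite big_nil.
rewrite big_cons Er; case: ifP => // /andP[/eqP ti /eqP tn].
by move: Pt; rewrite tn ti (negPf Pi).
Qed.

Definition coef_le (b : F) (t : term) := `|reval x t.1.1| <= b.

Lemma div_pole_le c i j n b : `|reval x c| <= b -> `|(x j - x i)^-1| <= 1 ->
  all (coef_le b) (div_pole c i j n).
Proof.
move=> + ij; elim: n c => [|n IHn] c cb /=; first by rewrite andbT.
have cb' : `|reval x c * (x j - x i)^-1| <= b.
  by rewrite normrM (le_trans _ cb) // ler_piMr.
by rewrite /coef_le /= rmorphN1 mulN1r normrN cb' IHn.
Qed.

Lemma neg_div_pole c i j n : all (fun t : term => t.2 < 0) (div_pole c i j n).
Proof. by elim: n c => //= n IHn c; rewrite IHn. Qed.

Lemma neg_div j E : all (fun t : term => t.2 < 0) E ->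
  all (fun t : term => t.2 < 0) (divE j E).
Proof.
elim: E => //= t E IHE /andP[t0 /IHE {}IHE]; rewrite all_cat IHE andbT /div_term.
by case: t.2 t0 => // n _; case: eqP => //= _; exact: neg_div_pole.
Qed.

Lemma neg_iter_div j m E : all (fun t : term => t.2 < 0) E ->
  all (fun t : term => t.2 < 0) (iter m (divE j) E).
Proof. by move=> E0; elim: m => //= m IHm; exact: neg_div. Qed.

Lemma divE_le j E b : all (fun t : term => t.2 < 0) E -> all (coef_le b) E ->
  (forall i, i != j -> `|(x j - x i)^-1| <= 1) -> all (coef_le b) (divE j E).
Proof.
move=> + + x1; elim: E => //= t E IHE /andP[t0 /IHE {}IHE] /andP[tb /IHE {}IHE].
rewrite all_cat IHE andbT; case: t t0 tb => [[c i] [//|n]] _ /= cb.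
rewrite div_term_neg; case: eqVneq => [_|ij]; first by rewrite /= andbT.
exact: div_pole_le (x1 _ ij).
Qed.

(* One division by u - x_j already makes every coefficient small when x_j is
   far from the other poles. *)
Lemma divE_le_first j E b d : all (fun t : term => t.2 < 0) E -> all (coef_le b) E ->
  all (fun t : term => t.1.2 != j) E -> d <= 1 -> 0 <= b ->
  (forall i, i != j -> `|(x j - x i)^-1| <= d) -> all (coef_le (b * d)) (divE j E).
Proof.
move=> + + + d1 b0 xd; elim: E => //= t E IHE.
move=> /andP[t0 /IHE {}IHE] /andP[tb /IHE {}IHE] /andP[tj /IHE {}IHE].
rewrite all_cat IHE andbT; case: t t0 tb tj => [[c i] [//|n]] _ /= cb ij.
rewrite div_term_neg (negPf ij).
have cb' : `|reval x c * (x j - x i)^-1| <= b * d by rewrite normrM ler_pM ?xd.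
rewrite [div_pole _ _ _ _]/= /= /coef_le /= rmorphN1 mulN1r normrN cb' /=.
by apply: div_pole_le => //; rewrite (le_trans (xd _ ij)).
Qed.

(** The first division gains the factor d; the later ones do not increase the coefficients. *)
Lemma divE_iter_le j m E b d : all (fun t : term => t.2 < 0) E ->
  all (coef_le b) E -> all (fun t : term => t.1.2 != j) E -> d <= 1 -> 0 <= b ->
  (forall i, i != j -> `|(x j - x i)^-1| <= d) ->
  all (coef_le (b * d)) (iter m.+1 (divE j) E).
Proof.
move=> E0 Eb Ej d1 b0 xd; elim: m => [|m IHm]; first exact: divE_le_first.
rewrite iterS; apply: divE_le => //; first exact: neg_iter_div.
by move=> i ij; rewrite (le_trans (xd _ ij)).
Qed.

Lemma pf_res_le E i b : 0 <= b -> all (coef_le b) E ->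
  `|pf_res E i| <= (size E)%:R * b.
Proof.
move=> b0; elim: E => [|t E IHE] /=; first by rewrite /pf_res big_nil normr0 mul0r.
move=> /andP[tb /IHE {}IHE]; rewrite /pf_res big_cons -/(pf_res _ _) -natr1 mulrDl mul1r.
case: ifP => _; last by rewrite (le_trans IHE) // lerDl.
by rewrite [leRHS]addrC (le_trans (ler_normD _ _)) // lerD.
Qed.

End Evaluation.

Lemma divE_cat j E E' : divE j (E ++ E') = divE j E ++ divE j E'.
Proof. by rewrite /divE map_cat flatten_cat. Qed.

Lemma iter_divE_cat j m E E' :
  iter m (divE j) (E ++ E') = iter m (divE j) E ++ iter m (divE j) E'.
Proof. by elim: m => //= m ->; rewrite divE_cat. Qed.

Definition posE (E : seq term) := seq.filter (fun t : term => 0 <= t.2) E.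
Definition negE (E : seq term) := seq.filter (fun t : term => t.2 < 0) E.

(** Division acts term by term, so the polynomial part, source of the large residue at [K], and the
    polar part, whose contribution is small, can be followed separately. *)
Lemma pf_res_iter_split (F : numFieldType) (x : 'I_l -> F) j m E i :
  pf_res x (iter m (divE j) E) i =
  pf_res x (iter m (divE j) (posE E)) i + pf_res x (iter m (divE j) (negE E)) i.
Proof.
elim: E => [|t E IHE].
  have -> : iter m (divE j) [::] = [::] by elim: m => //= m ->.
  by rewrite /posE /negE /=; elim: m => [|m IHm]; rewrite /pf_res !big_nil addr0.
rewrite -cat1s iter_divE_cat pf_res_cat IHE {IHE} /posE /negE /= ltNge.
by case: (0 <= t.2); rewrite /= -[t :: seq.filter _ _]cat1s iter_divE_cat pf_res_cat;
  [rewrite addrA|rewrite addrCA].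
Qed.

Lemma pf_poly_posE (F : numFieldType) (x : 'I_l -> F) E :
  pf_poly x (posE E) = pf_poly x E.
Proof.
by rewrite /pf_poly big_filter_cond; apply: eq_bigl => t; rewrite andbb.
Qed.

Definition prim_exp z (E : seq term) := foldr (fun (t : term) acc =>
  if t.2 == -1 then acc else
  RAdd (RMul (RMul t.1.1 (RRat ((t.2 + 1)%:~R^-1))) (RPowz z t.1.2 (t.2 + 1))) acc)
  (RRat 0) E.
Definition res_exp i (E : seq term) := foldr (fun (t : term) acc =>
  if (t.1.2 == i) && (t.2 == -1) then RAdd t.1.1 acc else acc) (RRat 0) E.

Lemma reval_prim (F : numFieldType) (x : 'I_l -> F) z E :
  reval x (prim_exp z E) = pf_prim x E (x z).
Proof.
rewrite /pf_prim; elim: E => [|t E IHE]; first by rewrite big_nil /= rmorph0.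
rewrite big_cons /= -IHE; case: eqP => //= _.
by rewrite reval_powz fmorphV /= rmorph_int.
Qed.

Lemma reval_res (F : numFieldType) (x : 'I_l -> F) i E :
  reval x (res_exp i E) = pf_res x E i.
Proof.
rewrite /pf_res; elim: E => [|t E IHE]; first by rewrite big_nil /= rmorph0.
by rewrite big_cons /= -IHE; case: ifP.
Qed.

Lemma rwf_prim (J P : pred 'I_l) z E : J z -> ~~ P z -> goodE J P E ->
  rwf J (prim_exp z E).
Proof.
move=> Jz Pz; elim: E => //= t E IHE /andP[/and3P[tr Jt Pt] /IHE {}IHE].
case: ifP => //= _; rewrite tr IHE /= andbT rwf_powz // => t0.
apply: contraNneq Pz => zt; rewrite zt; apply: (implyP Pt).
by move: t0; clear; lia.
Qed.

Lemma rwf_res (J P : pred 'I_l) i E : goodE J P E -> rwf J (res_exp i E).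
Proof.
elim: E => //= t E IHE /andP[/and3P[tr Jt Pt] /IHE {}IHE].
by case: ifP => //= _; rewrite tr.
Qed.

Lemma pf_eval_morph (F F' : numFieldType) (f : {rmorphism F -> F'}) (x : 'I_l -> F) E u :
  pf_eval (f \o x) E (f u) = f (pf_eval x E u).
Proof.
rewrite /pf_eval rmorph_sum; apply: eq_bigr => t _.
by rewrite reval_morph rmorphM fmorphXz rmorphB.
Qed.

Lemma pf_res_morph (F F' : numFieldType) (f : {rmorphism F -> F'}) (x : 'I_l -> F) E i :
  pf_res (f \o x) E i = f (pf_res x E i).
Proof. by rewrite -!reval_res reval_morph. Qed.

Lemma pf_prim_morph (F F' : numFieldType) (f : {rmorphism F -> F'}) (x : 'I_l -> F) E u :
  pf_prim (f \o x) E (f u) = f (pf_prim x E u).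
Proof.
rewrite /pf_prim rmorph_sum; apply: eq_bigr => t _.
by rewrite reval_morph !rmorphM fmorphXz rmorphB fmorphV rmorph_int.
Qed.

End PartialFractions.

Lemma size_quot_monic (F : fieldType) (p q : {poly F}) a r n :
  p = q * ('X - a%:P) + r%:P -> p \is monic -> size p = n.+2 ->
  q \is monic /\ size q = n.+1.
Proof.
move=> pE pm sp.
have q0 : q != 0.
  apply: contra_eqN sp => /eqP q0; rewrite pE q0 mul0r add0r size_polyC.
  by case: (r == 0).
have sq : size (q * ('X - a%:P)) = (size q).+1.
  by rewrite size_Mmonic ?monicXsubC // size_XsubC addn2.
have sr : (size r%:P < size (q * ('X - a%:P))%R)%N.
  by rewrite sq ltnS size_polyC (leq_trans (leq_b1 _)) // size_poly_gt0.
split; last by move: sp; rewrite pE size_polyDl // sq => -[].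
by move: pm; rewrite pE !monicE lead_coefDl // lead_coef_Mmonic ?monicXsubC.
Qed.

(** * Expansion of the product of the (u - x_i)^mu_i *)

Section Expansion.
Variables (l : nat) (mu : 'I_l -> int).

Definition mulEs (s : seq 'I_l) E := foldr (fun i E => iter `|mu i|%N (mulE i) E) E s.
Definition divEs (s : seq 'I_l) E := foldr (fun i E => iter `|mu i|%N (divE i) E) E s.

Lemma good_mulEs (J P : pred 'I_l) s E :
  all J s -> all (good J P) E -> all (good J P) (mulEs s E).
Proof.
move=> + gE; elim: s => //= i s IHs /andP[Ji /IHs {}IHs].
by elim: `|mu i|%N => //= n IHn; exact: good_mul.
Qed.

Lemma good_iter_div (J P : pred 'I_l) j n E :
  J j -> P j -> all (good J P) E -> all (good J P) (iter n (divE j) E).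
Proof. by move=> Jj Pj gE; elim: n => //= n IHn; exact: good_div. Qed.

Lemma good_divEs (J P : pred 'I_l) s E :
  all J s -> all P s -> all (good J P) E -> all (good J P) (divEs s E).
Proof.
move=> + + gE; elim: s => //= i s IHs /andP[Ji /IHs {}IHs] /andP[Pi /IHs {}IHs].
exact: good_iter_div.
Qed.

Section Field.
Variables (F : numFieldType) (x : 'I_l -> F).

Lemma pf_eval_mulEs (J P : pred 'I_l) s E u :
  all J s -> all (good J P) E -> (forall i, P i -> u != x i) ->
  pf_eval x (mulEs s E) u = (\prod_(i <- s) (u - x i) ^+ `|mu i|) * pf_eval x E u.
Proof.
move=> + gE uP; elim: s => [_|i s IHs]; first by rewrite big_nil mul1r.
move=> /andP[Ji Js]; rewrite big_cons -mulrA -IHs //=.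
have := good_mulEs Js gE; move: (mulEs s E) => E' gE'.
suff H n : pf_eval x (iter n (mulE i) E') u = (u - x i) ^+ n * pf_eval x E' u /\
    all (good J P) (iter n (mulE i) E') by case: (H `|mu i|%N).
elim: n => [|n [IHn gn]]; first by rewrite mul1r.
by rewrite /= (pf_eval_mul _ gn uP) IHn exprS mulrA; split=> //; exact: good_mul.
Qed.

Lemma pf_eval_iter_div (J P : pred 'I_l) j n E u :
  J j -> P j -> all (good J P) E -> (forall i, P i -> u != x i) ->
  (forall i k, J i -> J k -> i != k -> x i != x k) ->
  pf_eval x (iter n (divE j) E) u = (u - x j) ^- n * pf_eval x E u.
Proof.
move=> Jj Pj gE uP xinj; elim: n => [|n IHn]; first by rewrite expr0 invr1 mul1r.
rewrite /= (pf_eval_div (good_iter_div n Jj Pj gE) uP xinj Jj Pj) IHn.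
by rewrite exprS invfM mulrC mulrA.
Qed.

Lemma pf_eval_divEs (J P : pred 'I_l) s E u :
  all J s -> all P s -> all (good J P) E -> (forall i, P i -> u != x i) ->
  (forall i k, J i -> J k -> i != k -> x i != x k) ->
  pf_eval x (divEs s E) u = (\prod_(i <- s) (u - x i) ^- `|mu i|) * pf_eval x E u.
Proof.
move=> + + gE uP xinj; elim: s => [_ _|i s IHs]; first by rewrite big_nil mul1r.
move=> /andP[Ji Js] /andP[Pi Ps]; rewrite big_cons -mulrA -IHs //=.
by apply: (pf_eval_iter_div (J := J) (P := P)) => //; exact: good_divEs.
Qed.

Lemma pf_poly_mulEs s E : all (fun t : term l => 0 <= t.2) E ->
  pf_poly x E \is monic ->
  [/\ all (fun t : term l => 0 <= t.2) (mulEs s E), pf_poly x (mulEs s E) \is monic &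
    size (pf_poly x (mulEs s E)) = (\sum_(i <- s) `|mu i| + size (pf_poly x E))%N].
Proof.
move=> E0 Em; elim: s => [|i s [s0 sm ss]]; first by rewrite big_nil.
rewrite big_cons -addnA -ss /=; move: (mulEs s E) s0 sm => E' s0 sm.
elim: `|mu i|%N => [|n [n0 nm ns]] //=.
rewrite pf_poly_mul // monicMl ?monicXsubC //; split=> //; first exact: mul_nonneg.
by rewrite size_monicM ?monicXsubC ?monic_neq0 // size_XsubC ns.
Qed.

Lemma pf_poly_iter_div j n E d : pf_poly x E \is monic ->
  size (pf_poly x E) = (n + d.+1)%N ->
  pf_poly x (iter n (divE j) E) \is monic /\ size (pf_poly x (iter n (divE j) E)) = d.+1.
Proof.
elim: n E => // n IHn E Em sE; rewrite iterSr.
have [r Er] := pf_poly_div x j E.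
have [] := size_quot_monic Er Em (n := (n + d)%N); first by rewrite sE; lia.
by move=> m1 s1; apply: IHn; rewrite // s1; lia.
Qed.

Lemma pf_poly_divEs s E d : pf_poly x E \is monic ->
  size (pf_poly x E) = (\sum_(i <- s) `|mu i| + d.+1)%N ->
  pf_poly x (divEs s E) \is monic /\ size (pf_poly x (divEs s E)) = d.+1.
Proof.
elim: s d => [|i s IHs] d Em; rewrite ?big_nil // big_cons => sE /=.
have [|m1 s1] := IHs (`|mu i|%N + d)%N Em; first by rewrite sE; lia.
by apply: pf_poly_iter_div; rewrite // s1; lia.
Qed.

End Field.

Variables (inf K z : 'I_l).
Definition J0 : pred 'I_l := [pred i | (i != inf) && (i != K)].
Definition Jfin : pred 'I_l := [pred i | i != inf].
Definition P0 : pred 'I_l := [pred i | J0 i && (mu i < 0)].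
Definition Pfin : pred 'I_l := [pred i | Jfin i && (mu i < 0)].
Definition zeros := [seq i <- enum 'I_l | 0 < mu i].
Definition poles0 := [seq i <- enum 'I_l | P0 i].
(** [K] is divided out last, in [expansion], so that x_K enters through that division only. *)
Definition expansion0 := divEs poles0 (mulEs zeros [:: (RRat 1, z, 0)]).
Definition expansion := iter `|mu K|%N (divE K) expansion0.

Hypotheses (mu_inf : mu inf < 0) (mu_K : mu K < 0) (mu_z : 0 < mu z) (inf_K : inf != K).

Lemma zeros_J0 : all J0 zeros.
Proof.
apply/allP => i; rewrite mem_filter => /andP[mi _] /=.
by apply/andP; split; [apply: contraTneq mi | apply: contraTneq mi] => ->; lia.
Qed.

Lemma J0_z : J0 z.
Proof. by apply: (allP zeros_J0); rewrite mem_filter mu_z mem_enum. Qed.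

Lemma good_expansion0 : all (good J0 P0) expansion0.
Proof.
apply: good_divEs; try by apply/allP => i; rewrite mem_filter => /andP[] // /andP[].
by apply: good_mulEs; rewrite ?zeros_J0 //= /good [rwf _ _]/= J0_z.
Qed.

Lemma good_expansion : all (good Jfin Pfin) expansion.
Proof.
apply: good_iter_div; rewrite /Pfin /Jfin /= ?(eq_sym K) ?inf_K //.
apply: good_mono good_expansion0 => i; first by case/andP.
by case/andP => /andP[ii _] mi; rewrite inE /= ii.
Qed.

Lemma prod_filter_enum (F : numFieldType) (P : pred 'I_l) (f : 'I_l -> F) :
  \prod_(i <- [seq i <- enum 'I_l | P i]) f i = \prod_(i | P i) f i.
Proof. by rewrite big_filter big_enum_cond. Qed.

Section Values.
Variables (F : numFieldType) (x : 'I_l -> F).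

Lemma pf_eval_expansion0 u : (forall i, mu i != 0) ->
  (forall i, P0 i -> u != x i) ->
  (forall i k, J0 i -> J0 k -> i != k -> x i != x k) ->
  pf_eval x expansion0 u = \prod_(i | J0 i) (u - x i) ^ mu i.
Proof.
move=> mu0 uP xinj.
have gz : all (good J0 P0) (mulEs zeros [:: (RRat 1, z, 0)]).
  by apply: good_mulEs; rewrite ?zeros_J0 //= /good [rwf _ _]/= J0_z.
rewrite (pf_eval_divEs (J := J0) (P := P0)) //; first last.
- by apply/allP => i; rewrite mem_filter => /andP[].
- by apply/allP => i; rewrite mem_filter => /andP[/andP[]].
rewrite (pf_eval_mulEs (J := J0) (P := P0)) ?zeros_J0 //; last first.
  by rewrite /= /good [rwf _ _]/= J0_z.
rewrite /pf_eval big_seq1 /= rmorph1 expr0z mulr1 mulr1 !prod_filter_enum.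
rewrite [RHS](bigID (fun i => mu i < 0)) /=; congr (_ * _).
  apply: eq_big => // i /andP[_ mi].
  by rewrite exprnN; congr (_ ^ _); lia.
apply: eq_big => [i|i mi]; last by rewrite exprnP; congr (_ ^ _); lia.
apply/idP/idP => [mi|/andP[_ mi]]; last by have := mu0 i; lia.
rewrite -leNgt ltW // andbT; apply: (allP zeros_J0).
by rewrite mem_filter mi mem_enum.
Qed.

Lemma pf_eval_expansion u : (forall i, mu i != 0) ->
  (forall i, Pfin i -> u != x i) ->
  (forall i k, Jfin i -> Jfin k -> i != k -> x i != x k) ->
  pf_eval x expansion u = \prod_(i | Jfin i) (u - x i) ^ mu i.
Proof.
move=> mu0 uP xinj.
rewrite (pf_eval_iter_div (J := Jfin) (P := Pfin)) //; first last.
- apply: good_mono good_expansion0 => i; first by case/andP.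
  by case/andP => /andP[ii _] mi; rewrite /Pfin /= /Jfin /= ii.
- by rewrite /Pfin /Jfin /= eq_sym inf_K.
- by rewrite /Jfin /= eq_sym.
rewrite pf_eval_expansion0 //; first last.
- by move=> i k /andP[ii _] /andP[ki _]; exact: xinj.
- by move=> i /andP[/andP[ii _] mi]; apply: uP; rewrite /Pfin /= /Jfin /= ii.
rewrite [RHS](bigD1 K) /=; last by rewrite /Jfin /= eq_sym.
by congr (_ * _); rewrite exprnN; congr (_ ^ _); move: mu_K; clear; lia.
Qed.

Lemma pf_poly_expansion0 d : (forall i, mu i != 0) ->
  \sum_(i | J0 i) mu i = d%:Z ->
  pf_poly x expansion0 \is monic /\ size (pf_poly x expansion0) = d.+1.
Proof.
move=> mu0 sd.
have p1 : pf_poly x [:: (RRat 1, z, 0)] = 1.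
by rewrite /pf_poly big_cons big_nil /= rmorph1 scale1r expr0 addr0.
have [||n1 m1 s1] := @pf_poly_mulEs F x zeros [:: (RRat 1, z, 0)]; rewrite ?p1 ?monic1 //.
apply: pf_poly_divEs => //; rewrite s1 p1 size_poly1.
have PE (s : seq 'I_l) : (\sum_(i <- s) `|mu i|)%N%:Z = \sum_(i <- s) `|mu i|%N%:Z.
  exact: (big_morph Posz PoszD).
suff : (\sum_(i <- zeros) `|mu i|)%N%:Z = (\sum_(i <- poles0) `|mu i|)%N%:Z + d%:Z.
  by rewrite -PoszD => -[->]; rewrite addn1 addnS.
rewrite !PE -sd !big_filter !big_enum_cond /= [in RHS](bigID (fun i => mu i < 0) J0) /= addrA.
rewrite -big_split /= [X in _ = X + _]big1 ?add0r; last first.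
  by move=> i Pi; have /andP[_ mi] : J0 i && (mu i < 0) := Pi; move: mi; clear; lia.
apply: eq_big => [i|i mi]; last by lia.
apply/idP/idP => [mi|/andP[_ mi]]; last by have := mu0 i; lia.
rewrite -leNgt ltW // andbT; apply: (allP zeros_J0).
by rewrite mem_filter mi mem_enum.
Qed.

End Values.
End Expansion.

(** * The rational primitive, and a configuration where it varies between the two zeros *)

Section Derivative.
Variables (R : realType) (l : nat).

Lemma is_cderiveXz (f : R -> R[i]) t df (n : int) : (n < 0 -> f t != 0) ->
  is_cderive f t df ->
  is_cderive (fun s => f s ^ n) t (n%:~R * f t ^ (n - 1) * df).
Proof.
case: n => [[|n]|n] ft fd.
- by rewrite mul0r mul0r; apply: is_cderive_cst.
- apply: is_cderive_eq (is_cderiveX n.+1 fd) _.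
  by congr (_ * _ * _); rewrite exprnP; congr (_ ^ _); lia.
have {}ft := ft isT.
have := is_cderiveX n.+1 (is_cderiveV ft fd).
have -> : (fun s => (f s)^-1 ^+ n.+1) = (fun s => f s ^ Negz n).
  by apply/funext => s; rewrite NegzE exprVn exprnN.
move=> /is_cderive_eq; apply; rewrite NegzE mulrNz -pmulrn.
have -> : f t ^ (- n.+1%:Z - 1) = (f t)^-1 ^+ n * (f t)^-2.
  by rewrite exprVn !exprnN -expfzDr //; congr (_ ^ _); lia.
by rewrite [n.+1.-1]/=; move: (n.+1%:R) => c; ring.
Qed.

Lemma is_cderive_pf_prim (x : 'I_l -> R[i]) (J P : pred 'I_l) E X t dX :
  all (good J P) E -> is_cderive X t dX -> (forall i, P i -> X t != x i) ->
  is_cderive (fun s => pf_prim x E (X s)) t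
    ((pf_eval x E (X t) - \sum_(i | P i) pf_res x E i / (X t - x i)) * dX).
Proof.
move=> + Xd XP; elim: E => [_|[[c i] n] E IHE].
  have -> : (fun s => pf_prim x [::] (X s)) = fun=> 0.
    by apply/funext => s; rewrite /pf_prim big_nil.
  apply: is_cderive_eq (is_cderive_cst 0 t) _.
  by rewrite pf_eval_nil big1 ?subrr ?mul0r // => i _; rewrite /pf_res big_nil mul0r.
move=> /andP[/and3P[/= _ _ /implyP Pi] /IHE {}IHE].
rewrite pf_eval_cons /=; have [nE|nE] := eqVneq n (-1).
  have -> : (fun s => pf_prim x ((c, i, n) :: E) (X s)) = fun s => pf_prim x E (X s).
    by apply/funext => s; rewrite /pf_prim big_cons /= nE.
  have {}Pi : P i by apply: Pi; rewrite nE.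
  apply: is_cderive_eq IHE _; congr (_ * _).
  rewrite (bigD1 i) //= [in RHS](bigD1 i) //= {1 3}/pf_res big_cons /= nE !eqxx /=.
  rewrite -/(pf_res _ _ _) exprN1.
  have -> : \sum_(k | P k && (k != i)) pf_res x ((c, i, -1) :: E) k / (X t - x k) =
      \sum_(k | P k && (k != i)) pf_res x E k / (X t - x k).
    apply: eq_bigr => k /andP[_ ki]; congr (_ / _).
    by rewrite /pf_res big_cons /= eq_sym (negPf ki).
  ring.
have -> : (fun s => pf_prim x ((c, i, n) :: E) (X s)) =
    fun s => reval x c / (n + 1)%:~R * (X s + - x i) ^ (n + 1) + pf_prim x E (X s).
  by apply/funext => s; rewrite /pf_prim big_cons /= nE.
have n1 : (n + 1)%:~R != 0 :> R[i] by rewrite intr_eq0; apply: contraNneq nE; lia.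
have Xd' := is_cderiveD Xd (is_cderive_cst (- x i) t).
have H : n + 1 < 0 -> X t + - x i != 0.
  by move=> n0; rewrite subr_eq0 XP // Pi //; lia.
apply: is_cderive_eq (is_cderiveD (is_cderiveZ _ (is_cderiveXz H Xd')) IHE) _.
rewrite addr0 addrK.
have -> : \sum_(k | P k) pf_res x ((c, i, n) :: E) k / (X t - x k) =
    \sum_(k | P k) pf_res x E k / (X t - x k).
  by apply: eq_bigr => k _; rewrite /pf_res big_cons /= (negPf nE) andbF.
by move: ((n + 1)%:~R : R[i]) n1 => c0 n1; field.
Qed.

End Derivative.

Section PolynomialGrowth.
Variable R : realType.

(** The Taylor coefficient of order m at y is a polynomial in y of degree d - m >= 1 with positive
    leading coefficient. Written q * 'X + c, with q eventually at least its leading coefficient, it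
    lies above a line of positive slope. *)
Lemma nderivn_growth (p : {poly R}) d m : p \is monic -> size p = d.+1 -> (m < d)%N ->
  exists c e Y : R, 0 < c /\ forall y, Y <= y -> c * y - e <= p^`N(m).[y].
Proof.
move=> pm sp md; set q := p^`N(m).
have q0 : q`_(d - m) = 'C(d, m)%:R.
  rewrite coef_nderivn subnKC ?(ltnW md) //.
  by move/monicP : pm; rewrite lead_coefE sp => ->.
have sq : size q = (d - m).+1.
  apply/eqP; rewrite eqn_leq; apply/andP; split.
    apply/leq_sizeP => j dj; rewrite coef_nderivn nth_default ?mul0rn // sp; lia.
  rewrite ltnNge; apply/negP => /leq_sizeP/(_ _ (leqnn _))/eqP.
  by rewrite q0 pnatr_eq0 -leqn0 leqNgt bin_gt0 ltnW.
have lq : 0 < lead_coef q by rewrite lead_coefE sq q0 ltr0n bin_gt0 ltnW.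
move: lq sq; move: q {q0} => q; elim/poly_ind: q => [|q c _]; first by rewrite lead_coef0 ltxx.
move=> + sq; have q0 : q != 0.
  apply: contra_eqN sq => /eqP ->; rewrite mul0r add0r size_polyC.
  by rewrite neq_ltn ltnS (leq_trans (leq_b1 _)) // subn_gt0 md.
rewrite lead_coefDl ?size_mulX ?size_polyC //; last first.
  by rewrite (leq_ltn_trans (leq_b1 _)) // ltnS size_poly_gt0.
rewrite lead_coefMX => lq; have [Y Yq] := poly_pinfty_gt_lc lq.
exists (lead_coef q), (- c), (Num.max 0 Y); split=> // y; rewrite ge_max => /andP[y0 /Yq qy].
by rewrite hornerMXaddC opprK lerD2r ler_wpM2r.
Qed.

End PolynomialGrowth.

Section Nonvanishing.
Variables (R : realType) (l : nat) (mu : 'I_l -> int) (inf K z1 z2 : 'I_l).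
Hypotheses (mu0 : forall i, mu i != 0) (mu_inf : mu inf < 0) (mu_K : mu K < 0).
Hypotheses (mu_z1 : 0 < mu z1) (mu_z2 : 0 < mu z2) (inf_K : inf != K) (z1_z2 : z1 != z2).

(** The poles other than [K] sit at integers in [2, N], away from the segment from [z1] = 0 to [z2]
    = 1; only [K], at y, will move. *)
Let conf (y : R) (i : 'I_l) : R :=
  if i == z1 then 0 else if i == z2 then 1 else if i == K then y else i.+2%:R.
Let N : R := l.+2%:R.

Let K_z1 : K != z1. Proof. by apply: contraTneq mu_K => ->; rewrite -leNgt ltW. Qed.
Let K_z2 : K != z2. Proof. by apply: contraTneq mu_K => ->; rewrite -leNgt ltW. Qed.

Let conf_K y : conf y K = y.
Proof. by rewrite /conf (negPf K_z1) (negPf K_z2) eqxx. Qed.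

Let conf_le y i : i != K -> 0 <= conf y i <= N.
Proof.
move=> iK; rewrite /conf (negPf iK) /N; case: ifP => _; first by rewrite lexx ler0n.
case: ifP => _; first by rewrite ler01 ler1n.
by rewrite ler0n ler_nat /= !ltnS ltnW.
Qed.

Let conf_inj y : N < y -> injective (conf y).
Proof.
move=> yN i j.
have [->|iK] := eqVneq i K; have [->|jK] := eqVneq j K => //.
- by rewrite conf_K => yE; have := conf_le y jK; rewrite -yE (leNgt y) yN andbF.
- by rewrite conf_K => yE; have := conf_le y iK; rewrite yE (leNgt y) yN andbF.
rewrite /conf (negPf iK) (negPf jK).
have [->|i1] := eqVneq i z1; have [->|j1] := eqVneq j z1 => //.
- by case: eqP => _ /eqP; rewrite eq_sym ?oner_eq0 // pnatr_eq0.
- by case: eqP => _ /eqP; rewrite ?oner_eq0 // pnatr_eq0.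
have [->|i2] := eqVneq i z2; have [->|j2] := eqVneq j z2 => //.
- by move/eqP; rewrite -[1]/(1%:R) eqr_nat.
- by move/eqP; rewrite -[1]/(1%:R) eqr_nat.
by move/eqP; rewrite eqr_nat !eqSS => /eqP/val_inj.
Qed.

Let conf_pole y i : mu i < 0 -> N < y -> 2 <= conf y i.
Proof.
move=> mi yN; rewrite /conf.
have -> : (i == z1) = false by apply: contraTF mi => /eqP->; rewrite -leNgt ltW.
have -> : (i == z2) = false by apply: contraTF mi => /eqP->; rewrite -leNgt ltW.
case: ifP => _; last by rewrite ler_nat.
by rewrite (le_trans _ (ltW yN)) // ler_nat.
Qed.

Let E := expansion mu inf K z1.
Let E0 := expansion0 mu inf K z1.

(** On [0, 1] the factors other than that of [K] are at most powers of N, and that of [K] is at most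
    1 / (y - N). *)
Let phi_bound : exists2 B, 0 <= B & forall y xi, N + 1 <= y -> 0 <= xi <= 1 ->
  `|pf_eval (conf y) E xi| <= B / (y - N).
Proof.
exists (\prod_(i | J0 inf K i) N ^+ `|mu i|); first by rewrite prodr_ge0 // => i _; rewrite exprn_ge0.
move=> y xi yN /andP[xi0 xi1].
have yN' : N < y by rewrite (lt_le_trans _ yN) // ltrDl.
have N1 : 1 <= N by rewrite ler1n.
rewrite /E pf_eval_expansion //; first last.
- by move=> i k _ _ ik; apply: contra_neq ik; exact: conf_inj.
- move=> i /andP[_ mi]; have := conf_pole mi yN'; apply: contraTneq => <-.
  by rewrite -ltNge (le_lt_trans xi1) // ltr1n.
rewrite (bigD1 K) /=; last by rewrite /Jfin /= eq_sym.
rewrite mulrC normrM conf_K; apply: ler_pM => //.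
  rewrite normr_prod; apply: ler_prod => i iJ; rewrite normr_ge0 /=.
  have /andP[ii iK] : (i != inf) && (i != K) := iJ.
  have /andP[c0 cN] := conf_le y iK.
  case: (ltP (mu i) 0) => mi.
    have c2 := conf_pole mi yN'.
    have -> : mu i = - (`|mu i|%N%:Z) by move: mi; clear; lia.
    rewrite -exprnN normfV normrX abszN absz_nat.
    rewrite (@le_trans _ _ 1) ?exprn_ege1 // invf_le1 ?exprn_gt0 ?normr_gt0 ?exprn_ege1 //.
      by rewrite ler0_norm; lra.
    by rewrite subr_eq0; apply: contraTneq c2 => <-; rewrite -ltNge; lra.
  have -> : mu i = (`|mu i|%N%:Z) by move: mi; clear; lia.
  rewrite -exprnP normrX absz_nat lerXn2r ?nnegrE ?ler0n //.
  by rewrite ler_norml; apply/andP; split; lra.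
have [n nE] : exists n, mu K = - (n.+1)%:Z by exists `|mu K|.-1; move: mu_K; clear; lia.
rewrite nE -exprnN normfV normrX lef_pV2 ?posrE ?subr_gt0 ?exprn_gt0 //; last first.
  by rewrite normr_gt0; lra.
have e : y - N <= `|xi - y| by rewrite ler0_norm; lra.
rewrite (le_trans e) // exprS ler_peMr // exprn_ege1 //; lra.
Qed.

Let y0 : R := N + 1.
Let p0 := pf_poly (conf y0) E0.
Let m := `|mu K|.-1.
Let mE : `|mu K|%N = m.+1. Proof. by rewrite /m; move: mu_K; clear; lia. Qed.

Let conf_local y y' i : J0 inf K i -> conf y i = conf y' i.
Proof. by move=> /andP[_ iK]; rewrite /conf (negPf iK). Qed.

Let pole_E0 : all (good (J0 inf K) (P0 mu inf K)) E0.
Proof. exact: good_expansion0. Qed.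

Let pf_polyE y : pf_poly (conf y) E0 = p0.
Proof.
rewrite /p0 /pf_poly big_seq_cond [RHS]big_seq_cond; apply: eq_bigr => t /andP[tE _].
have /and3P[tr Jt _] := allP pole_E0 t tE.
by rewrite (conf_local y y0 Jt) (reval_local tr (conf_local y y0)).
Qed.

Let b : R := \sum_(t <- negE E0) `|reval (conf y0) t.1.1|.
Let b_ge0 : 0 <= b. Proof. by rewrite sumr_ge0. Qed.
Let tail := iter m.+1 (divE K) (negE E0).

Let neg_le y : all (coef_le (conf y) b) (negE E0).
Proof.
apply/allP => t tE; have tE0 : t \in E0 by move: tE; rewrite mem_filter => /andP[].
have /and3P[tr _ _] := allP pole_E0 t tE0.
rewrite /coef_le (reval_local tr (conf_local y y0)) /b (big_rem t) //=.
by rewrite lerDl sumr_ge0.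
Qed.

Let tail_le y i : N + 1 <= y ->
  `|pf_res (conf y) tail i| <= (size tail)%:R * b / (y - N).
Proof.
move=> yN; have yN0 : 0 < y - N by lra.
rewrite -mulrA; apply: pf_res_le.
  by rewrite divr_ge0 // ltW.
apply: divE_iter_le => //.
- by apply/allP => t; rewrite mem_filter => /andP[].
- apply/allP => t; rewrite mem_filter => /andP[_ tE0].
  by have /and3P[_ /andP[]] := allP pole_E0 t tE0.
- by rewrite invf_le1 //; lra.
move=> i0 iK; have /andP[c0 cN] := conf_le y iK.
rewrite conf_K normfV lef_pV2 ?posrE ?normr_gt0 //; last by rewrite subr_eq0 gt_eqF //; lra.
by rewrite ger0_norm; lra.
Qed.

Let good_pos : all (good predT (pred1 K)) (posE E0).
Proof.
apply/allP => t; rewrite mem_filter => /andP[t0 tE0].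
have /and3P[tr _ _] := allP pole_E0 t tE0.
by rewrite /good (rwf_mono _ tr) //= ltNge t0.
Qed.

Let res_split y i : pf_res (conf y) E i =
  pf_res (conf y) (iter m.+1 (divE K) (posE E0)) i + pf_res (conf y) tail i.
Proof. by rewrite /E /expansion mE pf_res_iter_split. Qed.

Let resK y : pf_res (conf y) E K = p0^`N(m).[y] + pf_res (conf y) tail K.
Proof. by rewrite res_split pf_res_iter_div // conf_K pf_poly_posE pf_polyE. Qed.

Let res_other y i : i != K -> pf_res (conf y) E i = pf_res (conf y) tail i.
Proof.
move=> iK; rewrite res_split (@pf_res0 _ _ _ predT (pred1 K)) ?add0r //.
by apply: good_iter_div; rewrite //= eqxx.
Qed.

Hypotheses (mu_inf2 : mu inf <= -2) (mu_sum : \sum_i mu i = -2).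

(** Let y tend to infinity. Up to O(1 / y), the residue at [K] is the Taylor coefficient of order m
    = |mu K| - 1 at y of a fixed monic polynomial of degree d = -2 - mu inf - mu K; as mu inf <= -2,
    d > m and the residue grows at least linearly. The other residues and the function itself are
    O(1 / y) on [0, 1], so the derivative of the rational primitive is governed by r_K / (y - xi),
    which stays above a positive constant up to O(1 / y). *)
Lemma nonvanishing_pointwise : exists x : 'I_l -> R,
  [/\ injective x, x z1 = 0, x z2 = 1, forall i, mu i < 0 -> 2 <= x i &
    pf_res x E K != 0 /\ forall xi, 0 <= xi <= 1 ->
      0 < pf_eval x E xi - \sum_(i | Pfin mu inf i) pf_res x E i / (xi - x i)].
Proof.
pose d := absz ((-2) - mu inf - mu K)%R.
have sd : \sum_(i | J0 inf K i) mu i = d%:Z.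
  have : \sum_i mu i = mu inf + (mu K + \sum_(i | J0 inf K i) mu i).
    by rewrite (bigD1 inf) //= (bigD1 K) //= eq_sym.
  rewrite mu_sum /d; move: mu_K mu_inf2; clear; lia.
have md : (m < d)%N by rewrite -mE /d; move: mu_K mu_inf2; clear; lia.
have [pm sp] : p0 \is monic /\ size p0 = d.+1 by apply: pf_poly_expansion0.
have [c [e [Y [c0 Yp]]]] := nderivn_growth pm sp md.
have [B B0 phiB] := phi_bound.
pose S : R := (size tail)%:R * b.
have S0 : 0 <= S by rewrite mulr_ge0.
pose T : R := `|e| + S + l%:R * S + B.
have T0 : 0 <= T by rewrite !addr_ge0 // mulr_ge0.
(* s = y - N is taken so large that all error terms, of sum at most T / s, stay below the slope
   c. *)
pose s : R := Num.max 1 (Num.max (Y - N) ((T + 1) / c)).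
have s1 : 1 <= s by rewrite le_max lexx.
have sY : Y - N <= s by rewrite !le_max lexx orbT.
have sT : T + 1 <= c * s by rewrite mulrC -ler_pdivrMr // !le_max lexx !orbT.
pose y := s + N.
have N0 : 1 <= N by rewrite ler1n.
have yN1 : N + 1 <= y by rewrite /y; lra.
have yN : N < y by lra.
have yNs : y - N = s by rewrite /y addrK.
have s0 : 0 < s by lra.
have Ss : S / s <= S by rewrite ler_pdivrMr // ler_peMr.
have resK_ge : c * y - `|e| - S <= pf_res (conf y) E K.
  rewrite resK; have := tail_le K yN1; rewrite -/S yNs ler_norml => /andP[tl _].
  have : Y <= y by rewrite /y; lra.
  move/Yp; rewrite -/p0 => pl; have := ler_norm e; lra.
have cy : c * s <= c * y by rewrite ler_wpM2l ?(ltW c0) // /y; lra.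
have TE : T = `|e| + S + l%:R * S + B by [].
have lS : 0 <= l%:R * S by rewrite mulr_ge0.
have resK_gt0 : 0 < pf_res (conf y) E K.
  by have := normr_ge0 e; lra.
exists (conf y); split.
- exact: conf_inj.
- by rewrite /conf eqxx.
- by rewrite /conf eq_sym (negPf z1_z2) eqxx.
- by move=> i mi; exact: conf_pole.
split; first by rewrite gt_eqF.
move=> xi xi01; have /andP[xi0 xi1] := xi01.
rewrite (bigD1 K) /=; last by rewrite /Pfin /Jfin /= eq_sym inf_K.
have := phiB y xi yN1 xi01; rewrite yNs ler_norml => /andP[phil _].
set O := \sum_(i | _) _.
have Ole : O <= l%:R * S / s.
  apply: (@le_trans _ _ (\sum_(i : 'I_l) S / s)); last by rewrite sumr_const card_ord -[X in X <= _]mulr_natl mulrA.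
  rewrite /O big_mkcond ler_sum // => i _; case: ifP => [/andP[/andP[ii mi] iK]|_]; last first.
    by rewrite divr_ge0 // ltW.
  have ci := conf_pole mi yN.
  rewrite (le_trans (ler_norm _)) // normrM res_other //.
  rewrite -[leRHS]mulr1 ler_pM //; first by rewrite -yNs tail_le.
  have xc : xi - conf y i <= -1 by lra.
  rewrite normfV invf_le1; last by rewrite normr_gt0; apply: contraTneq xc => ->; lra.
  by rewrite ler0_norm; lra.
rewrite conf_K.
have main : (c * y - `|e| - S) / y <= - (pf_res (conf y) E K / (xi - y)).
  have -> : - (pf_res (conf y) E K / (xi - y)) = pf_res (conf y) E K / (y - xi).
    by rewrite -mulrN -invrN opprB.
  apply: ler_pM => //; rewrite ?invr_ge0; try lra.
  by rewrite lef_pV2 ?posrE; lra.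
have main2 : c - (`|e| + S) / s <= (c * y - `|e| - S) / y.
  have y0' : 0 < y by lra.
  rewrite -addrA -opprD mulrBl mulfK ?gt_eqF // lerD2l lerN2.
  by rewrite ler_wpM2l ?addr_ge0 // lef_pV2 ?posrE // /y; lra.
have cT : T / s < c by rewrite ltr_pdivrMr //; lra.
move: cT; rewrite TE !mulrDl => cT.
move: main2; rewrite mulrDl => main2.
lra.
Qed.

End Nonvanishing.

Section Nonvanishing.
Variables (R : realType) (l : nat) (mu : 'I_l -> int) (inf K z1 z2 : 'I_l).
Hypotheses (mu0 : forall i, mu i != 0) (mu_inf : mu inf <= -2) (mu_K : mu K < 0).
Hypotheses (mu_z1 : 0 < mu z1) (mu_z2 : 0 < mu z2) (inf_K : inf != K) (z1_z2 : z1 != z2).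
Hypothesis mu_sum : \sum_i mu i = -2.

(** (G(1) - G(0)) r_K, the quantity that will vanish at arithmetic points. *)
Definition key_exp : rexp l :=
  let E := expansion mu inf K z1 in
  RMul (RAdd (prim_exp z2 E) (RMul (RRat (-1)) (prim_exp z1 E))) (res_exp K E).

Lemma reval_key (F : numFieldType) (x : 'I_l -> F) :
  let E := expansion mu inf K z1 in
  reval x key_exp = (pf_prim x E (x z2) - pf_prim x E (x z1)) * pf_res x E K.
Proof. by rewrite /= !reval_prim reval_res rmorphN1 mulN1r. Qed.

(** By the mean value theorem G(1) - G(0) is a value of the positive derivative. That derivative is
    known for the complexified primitive, hence the detour through real parts. *)
Lemma nonvanishing : exists x : 'I_l -> R,
  [/\ injective x, x z1 = 0, x z2 = 1 & reval x key_exp != 0].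
Proof.
have mu_inf0 : mu inf < 0 by move: mu_inf; clear; lia.
have [x [xinj x1 x2 xP [rK dpos]]] :=
  nonvanishing_pointwise R mu0 mu_inf0 mu_K mu_z1 mu_z2 inf_K z1_z2 mu_inf mu_sum.
exists x; split=> //; rewrite reval_key mulf_neq0 // x1 x2.
set E := expansion mu inf K z1 in dpos *.
pose xc := real_complex R \o x.
pose f (t : R) := complex.Re (pf_prim xc E t%:C).
have fE t : f t = pf_prim x E t by rewrite /f /xc pf_prim_morph.
have fd (t : R) : 0 <= t <= 1 -> is_derive t 1 f
    (pf_eval x E t - \sum_(i | Pfin mu inf i) pf_res x E i / (t - x i)).
  move=> t01; have gE := good_expansion mu_inf0 mu_K mu_z1 inf_K.
  have tP i : Pfin mu inf i -> t%:C != xc i.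
    move=> /andP[_ mi]; rewrite /xc /= (inj_eq (@complexI R)).
    by have := xP i mi; apply: contraTneq => <-; have /andP[_ t1] := t01; rewrite -ltNge (le_lt_trans t1) // ltr1n.
  have [+ _] := is_cderive_pf_prim gE (is_cderive_real t) tP.
  rewrite mulr1 -/f => H; apply: is_derive_eq H _.
  rewrite /xc pf_eval_morph -[RHS]/(complex.Re (real_complex R _)); congr complex.Re.
  rewrite rmorphB; congr (_ - _); rewrite rmorph_sum; apply: eq_bigr => i _.
  by rewrite pf_res_morph fmorph_div rmorphB.
rewrite -!fE subr_eq0; apply/eqP => f01.
have [||c] := @MVT R f (fun t => pf_eval x E t -
    \sum_(i | Pfin mu inf i) pf_res x E i / (t - x i)) 0 1 ltr01.
- by move=> t; rewrite in_itv /= => /andP[/ltW t0 /ltW t1]; apply: fd; rewrite t0.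
- apply: derivable_within_continuous => t; rewrite in_itv /= => t01.
  by have H := fd t t01; exact: ex_derive.
rewrite in_itv /= => /andP[/ltW c0 /ltW c1]; rewrite f01 subrr subr0 mulr1 => d0.
by have := dpos c; rewrite c0 c1 -d0 ltxx => /(_ isT).
Qed.

End Nonvanishing.

(** * Integrals of omega in the affine coordinate *)

Section FTC.
Variable R : realType.

Lemma real_FTC (F h : R -> R) :
  (forall t : R, 0 <= t <= 1 -> is_derive t 1 F (h t)) ->
  (forall t : R, 0 <= t <= 1 -> (h : R^o -> R^o) @ t --> h t) ->
  Rintegral (@lebesgue_measure R) `[0, 1] h = F 1 - F 0.
Proof.
move=> Fd hc; rewrite /Rintegral (@continuous_FTC2 R h F) ?ltr01 //.
- apply: continuous_in_subspaceT => t; rewrite inE /= in_itv /= => t01.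
  exact: hc.
- have Fc (t : R) : 0 <= t <= 1 -> F @ t --> F t.
    move=> /Fd H; apply: differentiable_continuous; apply/derivable1_diffP.
    exact: ex_derive.
  split.
  + move=> t; rewrite in_itv /= => /andP[t0 t1].
    by have H := Fd t; apply: ex_derive; apply: H; rewrite !ltW.
  + by apply: cvg_at_right_filter; apply: Fc; rewrite lexx ler01.
  + by apply: cvg_at_left_filter; apply: Fc; rewrite lexx ler01.
- move=> t; rewrite in_itv /= => /andP[t0 t1]; rewrite derive1E.
  by have H : is_derive t 1 F (h t) by [apply: Fd; rewrite !ltW]; rewrite derive_val.
Qed.

Lemma complex_FTC (F h : R -> R[i]) :
  (forall t : R, 0 <= t <= 1 -> is_cderive F t (h t)) ->
  (forall t : R, 0 <= t <= 1 -> ccont (h : R^o -> _) t) ->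
  Complex (Rintegral (@lebesgue_measure R) `[0, 1] (fun t => complex.Re (h t)))
          (Rintegral (@lebesgue_measure R) `[0, 1] (fun t => complex.Im (h t))) = F 1 - F 0.
Proof.
move=> Fd hc.
have re := @real_FTC (fun t => complex.Re (F t)) (fun t => complex.Re (h t))
  (fun t t01 => (Fd t t01).1) (fun t t01 => (hc t t01).1).
have im := @real_FTC (fun t => complex.Im (F t)) (fun t => complex.Im (h t))
  (fun t t01 => (Fd t t01).2) (fun t t01 => (hc t t01).2).
rewrite re im.
by case: (F 1); case: (F 0).
Qed.

End FTC.

Section Det2.
Variable F : comPzRingType.
Implicit Types v w a b : 'rV[F]_2.

Lemma det2_plucker w a b c :
  det2 w a * det2 b c - det2 b a * det2 w c = det2 w b * det2 a c.
Proof. rewrite /det2; ring. Qed.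

Lemma det2C v w : det2 w v = - det2 v w.
Proof. rewrite /det2; ring. Qed.

Lemma det2_id v : det2 v v = 0.
Proof. rewrite /det2; ring. Qed.


End Det2.

Lemma det2_mul (F : comNzRingType) (v w : 'rV[F]_2) (g : 'M[F]_2) :
  det2 (v *m g) (w *m g) = \det g * det2 v w.
Proof.
rewrite (expand_det_row _ ord0) !big_ord_recl big_ord0 /cofactor !det_mx11 !mxE.
rewrite /det2 !mxE !big_ord_recl !big_ord0 !addr0 /=.
have -> : lift ord0 ord0 = 1 :> 'I_2 by apply: val_inj.
have -> : lift 1 0 = 0 :> 'I_2 by apply: val_inj.
have -> : ord0 = 0 :> 'I_2 by apply: val_inj.
by rewrite /bump /= expr0 expr1; ring.
Qed.

Lemma det2_trans (F : fieldType) (a b c : 'rV[F]_2) :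
  b != 0 -> det2 a b = 0 -> det2 b c = 0 -> det2 a c = 0.
Proof.
move=> b0 ab bc.
have H0 : b 0 0 * det2 a c = 0.
  have := congr2 (fun x y => x * c 0 0 + y * a 0 0) ab bc.
  rewrite !mul0r addr0 => <-; rewrite /det2; ring.
have H1 : b 0 1 * det2 a c = 0.
  have := congr2 (fun x y => x * c 0 1 + y * a 0 1) ab bc.
  rewrite !mul0r addr0 => <-; rewrite /det2; ring.
move/eqP: H0; rewrite mulf_eq0 => /orP[/eqP b00|/eqP//].
move/eqP: H1; rewrite mulf_eq0 => /orP[/eqP b01|/eqP//].
case/eqP: b0; apply/rowP => j; rewrite mxE.
by case: j => -[|[|//]] p; [rewrite -b00|rewrite -b01]; congr (b 0 _); apply: val_inj.
Qed.

Section Coordinate.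
Variables (R : realType) (l : nat) (mu : 'I_l -> int) (inf z1 z2 : 'I_l).
Hypotheses (inf_z1 : inf != z1) (inf_z2 : inf != z2) (z1_z2 : z1 != z2).
Hypothesis mu_sum : \sum_i mu i = -2.
Variable D : differential R mu.

Definition pt i := row i (diff_pt D).
(** Normalises the coordinate, which is 0 at [z1] and infinite at [inf], to be 1 at [z2]. *)
Definition kap := det2 (pt z2) (pt inf) / det2 (pt z2) (pt z1).
Definition coord w := kap * det2 w (pt z1) / det2 w (pt inf).
Definition cfg i := coord (pt i).
Definition acoef i := kap * det2 (pt z1) (pt inf) / det2 (pt i) (pt inf).

Lemma pt_det i j : i != j -> det2 (pt i) (pt j) != 0.
Proof. exact: diff_pt_distinct. Qed.

Lemma kap_neq0 : kap != 0.
Proof. by rewrite mulf_neq0 ?invr_neq0 // pt_det // eq_sym. Qed.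

Lemma acoef_neq0 i : i != inf -> acoef i != 0.
Proof.
move=> ii; apply: mulf_neq0; last by rewrite invr_eq0 pt_det.
by apply: mulf_neq0; [exact: kap_neq0 | rewrite pt_det // eq_sym].
Qed.

(** This is the Plucker relation between w, p_i, p_z1 and p_inf. *)
Lemma coord_sub w i : i != inf -> det2 w (pt inf) != 0 ->
  coord w - cfg i = acoef i * det2 w (pt i) / det2 w (pt inf).
Proof.
move=> ii wi; have pi := pt_det ii.
have -> : acoef i * det2 w (pt i) / det2 w (pt inf) =
    kap * (det2 w (pt i) * det2 (pt z1) (pt inf)) / (det2 (pt i) (pt inf) * det2 w (pt inf)).
  by rewrite /acoef; field; rewrite wi pi.
by rewrite -det2_plucker /cfg /coord; field; rewrite wi pi.
Qed.

Lemma cfg_inj i j : i != inf -> j != inf -> i != j -> cfg i != cfg j.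
Proof.
move=> ii ji ij; rewrite -subr_eq0 coord_sub ?pt_det //.
by rewrite mulf_neq0 ?invr_eq0 ?pt_det // mulf_neq0 ?pt_det ?acoef_neq0.
Qed.

Lemma cfg_z1 : cfg z1 = 0.
Proof. by rewrite /cfg /coord det2_id mulr0 mul0r. Qed.

Lemma cfg_z2 : cfg z2 = 1.
Proof.
rewrite /cfg /coord /kap; have := pt_det inf_z2; rewrite det2C oppr_eq0 => i2.
by field; rewrite i2 pt_det // eq_sym.
Qed.

(** The constant C in omega = C prod (u - x_i)^mu_i du. *)
Definition dcst : R[i] := diff_scale D * (\prod_(i | i != inf) acoef i ^ (- mu i)) /
  (kap * det2 (pt z1) (pt inf)).

Lemma dcst_neq0 : dcst != 0.
Proof.
rewrite /dcst !mulf_neq0 ?invr_eq0 ?diff_scale_neq0 //.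
  apply/prodf_neq0 => i ii; rewrite expfz_neq0 // acoef_neq0 //.
by rewrite mulf_neq0 ?kap_neq0 // pt_det // eq_sym.
Qed.

(** The last factor is du, and the powers of det2 w p_inf balance because the orders add up to
    -2. *)
Lemma diff_form_coord w v : det2 w (pt inf) != 0 ->
  diff_form D w v = dcst * (\prod_(i | i != inf) (coord w - cfg i) ^ mu i) *
    (kap * (det2 v w * det2 (pt z1) (pt inf)) / det2 w (pt inf) ^+ 2).
Proof.
move=> wi.
have E1 : \prod_(i | i != inf) (coord w - cfg i) ^ mu i =
    (\prod_(i | i != inf) acoef i ^ mu i) * (\prod_(i | i != inf) det2 w (pt i) ^ mu i) *
    \prod_(i | i != inf) det2 w (pt inf) ^ (- mu i).
  rewrite -!big_split; apply: eq_bigr => i ii.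
  by rewrite /= coord_sub // !expfzMl !exprz_inv.
have E2 : (\prod_(i | i != inf) acoef i ^ (- mu i)) * (\prod_(i | i != inf) acoef i ^ mu i) = 1.
  rewrite -big_split big1 // => i ii.
  by rewrite /= -expfzDr ?acoef_neq0 // addNr.
have E3 : \prod_(i | i != inf) det2 w (pt inf) ^ (- mu i) =
    det2 w (pt inf) ^ mu inf * det2 w (pt inf) ^+ 2.
  have -> : det2 w (pt inf) ^ mu inf * det2 w (pt inf) ^+ 2 =
      det2 w (pt inf) ^ (- \sum_(i | i != inf) mu i).
    rewrite exprnP -expfzDr //; congr (_ ^ _).
    by have := mu_sum; rewrite (bigD1 inf) //= => H; move: H; move: (\sum_(i | _) _) => s; lia.
  by rewrite -sumrN; elim/big_ind2: _ => // x1 x2 y1 y2 -> ->; rewrite expfzDr.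
have m0 : kap * det2 (pt z1) (pt inf) != 0.
  by rewrite mulf_neq0 ?kap_neq0 // pt_det // eq_sym.
rewrite /diff_form (bigD1 inf) //= -/(pt inf) E1 E3 /dcst.
move: E2; move: (\prod_(i | _) _) (\prod_(i | _) acoef i ^ mu i) => A A' AA.
have -> : \prod_(i | i != inf) det2 w (row i (diff_pt D)) ^ mu i =
  \prod_(i | i != inf) det2 w (pt i) ^ mu i by [].
move: (\prod_(i | i != inf) _) => Q.
transitivity (A * A' * (diff_scale D * (det2 w (pt inf) ^ mu inf * Q) * det2 v w)).
  by rewrite AA mul1r.
move: m0; rewrite mulf_eq0 => /norP[k0 p0]; move: (_ ^ mu inf) => W.
by field; rewrite wi k0 p0.
Qed.

End Coordinate.

Section C1.
Variable R : realType.
Implicit Types (f : R -> 'rV[R[i]]_2).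

Lemma C1_is_cderive f t j : C1_map (f : R^o -> _) ->
  is_cderive (fun s => f s 0 j) t (cderive f t 0 j).
Proof.
move=> /(_ j)[/(_ 1)[d1 _] /(_ 1)[d2 _]]; rewrite mxE; split => /=.
  by rewrite derive1E; apply/derivableP.
by rewrite derive1E; apply/derivableP.
Qed.

Lemma C1_ccont_cderive f t j : C1_map (f : R^o -> _) ->
  ccont (fun s : R^o => cderive f s 0 j) t.
Proof.
move=> /(_ j)[/(_ 1)[_ d1] /(_ 1)[_ d2]]; split.
  rewrite [X in X @ _](_ : _ = fun x : R^o => 'D_1 (fun s : R^o => complex.Re (f s 0 j)) x); last first.
    by apply/funext => s; rewrite mxE /= derive1E.
  by rewrite mxE /= derive1E; exact: d1.
rewrite [X in X @ _](_ : _ = fun x : R^o => 'D_1 (fun s : R^o => complex.Im (f s 0 j)) x); last first.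
  by apply/funext => s; rewrite mxE /= derive1E.
by rewrite mxE /= derive1E; exact: d2.
Qed.

Lemma is_cderive_det2 f t (p : 'rV[R[i]]_2) : C1_map (f : R^o -> _) ->
  is_cderive (fun s => det2 (f s) p) t (det2 (cderive f t) p).
Proof.
move=> fC; have d0 := C1_is_cderive t 0 fC; have d1 := C1_is_cderive t 1 fC.
have -> : (fun s => det2 (f s) p) = fun s => f s 0 0 * p 0 1 + (-1) * (f s 0 1 * p 0 0).
  by apply/funext => s; rewrite mulN1r.
apply: is_cderive_eq (is_cderiveD (is_cderiveM d0 (is_cderive_cst (p 0 1) t))
   (is_cderiveZ (-1) (is_cderiveM d1 (is_cderive_cst (p 0 0) t)))) _.
by rewrite /det2; ring.
Qed.

Section Ccont.
Variable V : normedModType R.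

Lemma ccont_det2 (f g : V -> 'rV[R[i]]_2) p :
  (forall j, ccont (fun q => f q 0 j) p) -> (forall j, ccont (fun q => g q 0 j) p) ->
  ccont (fun q => det2 (f q) (g q)) p.
Proof.
move=> fc gc; rewrite /det2.
have -> : (fun q => f q 0 0 * g q 0 1 - f q 0 1 * g q 0 0) =
    fun q => f q 0 0 * g q 0 1 + (-1) * (f q 0 1 * g q 0 0).
  by apply/funext => q; rewrite mulN1r.
by apply: ccontD; [|apply: ccontM; first exact: ccont_cst]; apply: ccontM.
Qed.

Lemma ccontXz (f : V -> R[i]) p (n : int) : (n < 0 -> f p != 0) -> ccont f p ->
  ccont (fun q => f q ^ n) p.
Proof.
case: n => n fp fc; first exact: ccontX.
have -> : (fun q => f q ^ Negz n) = fun q => (f q)^-1 ^+ n.+1.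
  by apply/funext => q; rewrite NegzE exprVn exprnN.
by apply: ccontX; apply: ccontV => //; exact: fp.
Qed.

Lemma ccont_prod (I : Type) (r : seq I) (P : pred I) (F : I -> V -> R[i]) p :
  (forall i, P i -> ccont (F i) p) -> ccont (fun q => \prod_(i <- r | P i) F i q) p.
Proof.
move=> Fc; elim: r => [|i r IHr].
  have -> : (fun q => \prod_(i <- [::] | P i) F i q) = fun=> 1.
    by apply/funext => q; rewrite big_nil.
  exact: ccont_cst.
have [Pi|Pi] := boolP (P i); last first.
  have -> // : (fun q => \prod_(k <- i :: r | P k) F k q) = fun q => \prod_(k <- r | P k) F k q.
  by apply/funext => q; rewrite big_cons (negPf Pi).
have -> : (fun q => \prod_(k <- i :: r | P k) F k q) =
    fun q => F i q * \prod_(k <- r | P k) F k q.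
  by apply/funext => q; rewrite big_cons Pi.
by apply: ccontM => //; exact: Fc.
Qed.

End Ccont.
End C1.

Section PathIntegral.
Variables (R : realType) (l : nat) (mu : 'I_l -> int) (inf K z1 z2 : 'I_l).
Hypotheses (mu0 : forall i, mu i != 0) (mu_inf : mu inf < 0) (mu_K : mu K < 0).
Hypotheses (mu_z1 : 0 < mu z1) (mu_z2 : 0 < mu z2) (inf_K : inf != K) (z1_z2 : z1 != z2).
Hypothesis mu_sum : \sum_i mu i = -2.
Variable D : differential R mu.

Local Notation E := (expansion mu inf K z1).
Local Notation X := (coord inf z1 z2 D).
Local Notation x := (cfg inf z1 z2 D).
Local Notation C := (dcst inf z1 z2 D).
Local Notation pt := (pt D).

Lemma pole_zero i j : mu i < 0 -> 0 < mu j -> i != j.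
Proof. by move=> mi; apply: contraTneq => <-; rewrite -leNgt ltW. Qed.

Let inf_z1 : inf != z1. Proof. exact: pole_zero. Qed.
Let inf_z2 : inf != z2. Proof. exact: pole_zero. Qed.

Lemma not_pole_inf w : ~ is_pole D w -> det2 w (pt inf) != 0.
Proof. by move=> wP; apply/eqP => wi; apply: wP; exists inf. Qed.

Lemma not_pole_coord w i : ~ is_pole D w -> Pfin mu inf i -> X w - x i != 0.
Proof.
move=> wP /andP[ii mi]; rewrite coord_sub //; last exact: not_pole_inf.
apply: mulf_neq0; last by rewrite invr_eq0 not_pole_inf.
apply: mulf_neq0; first exact: acoef_neq0.
by apply/eqP => wi; apply: wP; exists i.
Qed.

Definition path_val (g : R -> 'rV[R[i]]_2) :=
  C * (pf_prim x E (X (g 1)) - pf_prim x E (X (g 0)) +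
    \sum_(i | Pfin mu inf i) pf_res x E i * logvar (fun t => X (g t) - x i)).

Lemma is_cderive_coord (g : R -> 'rV[R[i]]_2) t : C1_map (g : R^o -> _) ->
  det2 (g t) (pt inf) != 0 ->
  is_cderive (fun s => X (g s)) t
    (kap inf z1 z2 D * (det2 (cderive g t) (g t) * det2 (pt z1) (pt inf)) / det2 (g t) (pt inf) ^+ 2).
Proof.
move=> gC gi; have d1 := is_cderive_det2 t (pt z1) gC.
have di := is_cderive_det2 t (pt inf) gC.
apply: is_cderive_eq (is_cderiveM (is_cderiveZ _ d1) (is_cderiveV gi di)) _.
by rewrite -det2_plucker; field.
Qed.

Lemma is_cderive_coord_sub (g : R -> 'rV[R[i]]_2) t dX c :
  is_cderive (fun s => X (g s)) t dX -> is_cderive (fun s => X (g s) - c) t dX.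
Proof.
move=> Xd; apply: is_cderive_eq (is_cderiveD Xd (is_cderive_cst (- c) t)) _.
by rewrite addr0.
Qed.

(** Along the path the integrand is the derivative of C (G(X) + sum r_i lam_i), with lam_i a
    continuous logarithm of X - x_i; then the fundamental theorem of calculus applies. *)
Lemma path_integralE (g : simplex1 D) : path_integral g = path_val g.
Proof.
have gC := simplex1_C1 g.
have gP t : 0 <= t <= 1 -> ~ is_pole D (g t) by move=> /(simplex1_avoid g)[].
have gi t : 0 <= t <= 1 -> det2 (g t) (pt inf) != 0 by move=> /gP/not_pole_inf.
pose dX t := kap inf z1 z2 D * (det2 (cderive g t) (g t) * det2 (pt z1) (pt inf)) / det2 (g t) (pt inf) ^+ 2.
have Xd t : 0 <= t <= 1 -> is_cderive (fun s => X (g s)) t (dX t).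
  by move=> /gi; exact: is_cderive_coord.
have Xc t : 0 <= t <= 1 -> ccont (fun s : R^o => X (g s)) t by move=> /Xd/is_cderive_ccont.
have hE i : Pfin mu inf i -> forall t, 0 <= t <= 1 -> X (g t) - x i != 0.
  by move=> Pi t /gP tP; exact: not_pole_coord.
have hd c t : 0 <= t <= 1 -> is_cderive (fun s => X (g s) - c) t (dX t).
  by move=> /Xd; exact: is_cderive_coord_sub.
have hc c t : 0 <= t <= 1 -> ccont (fun s : R^o => X (g s) - c) t.
  by move=> /(hd c)/is_cderive_ccont.
have /choice[lam lamP] i : exists lam : R -> R[i], Pfin mu inf i -> forall t, 0 <= t <= 1 ->
    [/\ ccont (lam : R^o -> _) t, cexp (lam t - lam 0) = (X (g t) - x i) / (X (g 0) - x i) &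
       is_cderive lam t (dX t / (X (g t) - x i))].
  have [Pi|Pi] := boolP (Pfin mu inf i); last by exists (fun=> 0).
  have [lam lamP] := path_log (hc (x i)) (hE i Pi).
  exists lam => _ t t01; have [? ? H] := lamP t t01; split=> //.
  by apply: H; exact: hd.
pose lamP' i t := if Pfin mu inf i then lam i t else 0.
pose F t := C * (pf_prim x E (X (g t)) + \sum_i pf_res x E i * lamP' i t).
rewrite /path_integral (@complex_FTC R F).
- rewrite /F /path_val -mulrBr; congr (_ * _).
  rewrite opprD addrACA; congr (_ + _); rewrite -sumrB [RHS]big_mkcond.
  apply: eq_bigr => i _; rewrite /lamP'; case: ifP => [Pi|_]; last by rewrite subrr.
  rewrite -mulrBr; congr (_ * _); rewrite (@logvarE _ _ (lam i)) // => t t01.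
  by have [] := lamP i Pi t t01.
- move=> t t01.
  have xP i : Pfin mu inf i -> X (g t) != x i.
    by move=> Pi; rewrite -subr_eq0; exact: hE.
  have lamd i : is_cderive (lamP' i) t (if Pfin mu inf i then dX t / (X (g t) - x i) else 0).
    rewrite /lamP'; case: ifP => [Pi|_]; last exact: is_cderive_cst.
    by have [] := lamP i Pi t t01.
  have gE := good_expansion mu_inf mu_K mu_z1 inf_K.
  have Sd := @is_cderive_sum R _ (index_enum 'I_l) (fun i s => pf_res x E i * lamP' i s) t _
     (fun i => is_cderiveZ (pf_res x E i) (lamd i)).
  apply: is_cderive_eq (is_cderiveZ _ (is_cderiveD (is_cderive_pf_prim gE (Xd t t01) xP) Sd)) _.
  have -> : \sum_(i < l) pf_res x E i * (if Pfin mu inf i then dX t / (X (g t) - x i) else 0) =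
     dX t * \sum_(i | Pfin mu inf i) pf_res x E i / (X (g t) - x i).
    rewrite [in RHS]big_mkcond mulr_sumr; apply: eq_bigr => i _.
    by case: ifP => _; rewrite ?mulr0 // mulrCA.
  rewrite pf_eval_expansion //; last first.
    by move=> i k ii ki ik; apply: cfg_inj => //.
  rewrite (diff_form_coord inf_z1 inf_z2 z1_z2 mu_sum _ (gi t t01)) -/(dX t).
  rewrite -mulrA; congr (_ * _); rewrite /Jfin /=; ring.
- move=> t t01; rewrite /diff_form.
  have gc j : ccont (fun s : R^o => g s 0 j) t.
    exact: is_cderive_ccont (C1_is_cderive t j gC).
  apply: ccontM; last by apply: ccont_det2 => // j; exact: C1_ccont_cderive.
  apply: ccontM; first exact: ccont_cst.
  apply: ccont_prod => i _; apply: ccontXz.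
    by move=> mi; apply/eqP => gi0; apply: (gP t t01); exists i.
  by apply: ccont_det2 => // j; exact: ccont_cst.
Qed.

End PathIntegral.

(** * Periods depend only on the relative homology class *)

Section C1Affine.
Variable R : realType.

Section Affine.
Variables (V W : normedModType R) (f : W -> R) (e : V -> W) (u : V -> W).
Hypothesis eE : forall (h : R) v a, e (h *: v + a) = h *: u v + e a.

Lemma derive_affine_quotient v a :
  (fun h : R => h^-1 *: (((f \o e) \o shift a) (h *: v) - (f \o e) a)) =
  (fun h : R => h^-1 *: ((f \o shift (e a)) (h *: u v) - f (e a))).
Proof. by apply/funext => h; rewrite /= eE. Qed.

Lemma derive_affine v a : 'D_v (f \o e) a = 'D_(u v) f (e a).
Proof. by rewrite /derive derive_affine_quotient. Qed.

Lemma derivable_affine v a : derivable f (e a) (u v) -> derivable (f \o e) a v.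
Proof. by rewrite /derivable derive_affine_quotient. Qed.

Lemma C1_real_affine : continuous e -> C1_real f -> C1_real (f \o e).
Proof.
move=> ec fC v; have [fd fD] := fC (u v).
split=> [a|]; first exact: derivable_affine.
rewrite (_ : (fun a => _) = (fun a => 'D_(u v) f (e a))); last by apply/funext => a; exact: derive_affine.
by move=> a; exact: (cvg_comp e (fun b => 'D_(u v) f b) (ec a) (fD (e a))).
Qed.

End Affine.

Lemma mean_value (phi dphi : R -> R) (s t : R) :
  (forall x : R, is_derive x 1 phi (dphi x)) ->
  exists2 xi, `|xi - s| <= `|t - s| & phi t - phi s = dphi xi * (t - s).
Proof.
move=> phid; have phic a b : {within `[a, b], continuous phi}.
  apply: derivable_within_continuous => x _.
  by have H := phid x; exact: ex_derive.
have [st|ts] := leP s t.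
  have [c] := MVT_segment st (fun x _ => phid x) (phic s t).
  rewrite in_itv /= => /andP[sc ct] E; exists c => //.
  by rewrite !ger0_norm ?subr_ge0 // lerD2r.
have [c] := MVT_segment (ltW ts) (fun x _ => phid x) (phic t s).
rewrite in_itv /= => /andP[tc cs] E; exists c.
  by rewrite !ler0_norm ?subr_le0 ?(ltW ts) // lerN2 lerD2r.
by rewrite -[LHS]opprB E -mulrN opprB.
Qed.

(** Differentiability in the first variable gives continuity along it; the second is controlled by
    the mean value theorem and a local bound of the partial derivative. *)
Lemma C1_real_continuous (f : R^o * R^o -> R) : C1_real f -> continuous f.
Proof.
move=> fC [a b].
pose e1 : R^o * R^o := (1, 0); pose e2 : R^o * R^o := (0, 1).
have [d1 D1] := fC e1; have [d2 D2] := fC e2.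
have phid (s t : R) : is_derive t 1 (fun t => f (s, t)) ('D_e2 f (s, t)).
  pose e (t : R^o) : R^o * R^o := (s, t).
  have eE (h : R) v t0 : e (h *: v + t0) = h *: ((0 : R), v : R^o) + e t0.
    by apply: (congr2 pair) => //; rewrite /= scaler0 add0r.
  have H : derivable (f \o e) t 1 := derivable_affine eE (d2 (e t)).
  have E : 'D_1 (f \o e) t = 'D_e2 f (s, t) := derive_affine f eE (1 : R^o) t.
  exact: is_derive_eq (derivableP H) E.
have psic : (fun p : R^o * R^o => f (p.1, b)) @ (a, b) --> f (a, b).
  pose e (s : R^o) : R^o * R^o := (s, b).
  have eE (h : R) v s : e (h *: v + s) = h *: (v : R^o, (0 : R)) + e s.
    by apply: (congr2 pair) => //; rewrite /= scaler0 add0r.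
  have H := derivable_affine eE (d1 (e a)).
  have H2 : (f \o e) @ a --> (f \o e) a.
    by apply: differentiable_continuous; apply/derivable1_diffP.
  by apply: (@cvg_comp _ _ _ (fun p : R^o * R^o => p.1) (f \o e) _ _ _ _ H2); exact: cvg_fst.
have [M [M0 Mb]] : exists M : R, 0 < M /\ \forall p \near (a, b), `|'D_e2 f p| <= M.
  exists (`|'D_e2 f (a, b)| + 1); split; first by rewrite ltr_wpDl.
  have /cvgrPdist_le/(_ 1 ltr01) := D2 (a, b).
  apply: filterS => p; rewrite distrC => H.
  by rewrite -lerBlDl (le_trans _ H) // lerB_dist.
have gc : (fun p : R^o * R^o => f p - f (p.1, b)) @ (a, b) --> 0.
  apply/cvgrPdist_le => eps eps0.
  have [del /= del0 {}Mb] : nbhs_ball (a : R^o, b : R^o) [set p | `|'D_e2 f p| <= M].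
    by rewrite nbhs_ballE.
  have r0 : 0 < Num.min del (eps / M) by rewrite lt_min del0 divr_gt0.
  suff : nbhs_ball (a : R^o, b : R^o) [set p : R^o * R^o | `|0 - (f p - f (p.1, b))| <= eps].
    by rewrite nbhs_ballE.
  exists (Num.min del (eps / M)) => //= -[s t] [/= sa tb].
  rewrite sub0r normrN.
  have [xi xib ->] := mean_value b t (phid s).
  have /andP[sa1 _] : (`|a - s| < del) && (`|a - s| < eps / M) by rewrite -lt_min.
  have /andP[tb1 tb2] : (`|b - t| < del) && (`|b - t| < eps / M) by rewrite -lt_min.
  have DM : `|'D_e2 f (s, xi)| <= M.
    apply: Mb; split => //=; rewrite /ball /= /ball_ /= distrC (le_lt_trans xib) //.
    by rewrite distrC.
  rewrite normrM; apply: (@le_trans _ _ (M * (eps / M))); last by rewrite mulrC divfK // gt_eqF.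
  by rewrite ler_pM // ltW // distrC.
have H := cvgD gc psic; rewrite add0r in H.
rewrite (_ : _ + _ = f) in H; first by exact: H.
by apply/funext => p; rewrite /= subrK.
Qed.

End C1Affine.

Section Chains.
Variables (R : realType) (l : nat) (mu : 'I_l -> int) (D : differential R mu).

Lemma same_path_trans (f g h : simplex1 D) : same_path f g -> same_path g h -> same_path f h.
Proof.
by move=> fg gh t t01; apply: (@det2_trans _ _ (g t)); rewrite ?fg ?gh //; have [] := simplex1_avoid g t01.
Qed.

Lemma same_path_sym (f g : R -> 'rV[R[i]]_2) : same_path f g -> same_path g f.
Proof. by move=> fg t t01; rewrite det2C fg ?oppr0. Qed.

(** A chain may list the same path several times, under different lifts. The entries are grouped by
    path, by induction on the length; each group has total coefficient 0 or lies in [Z]. *)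
Lemma chain_sum0 (Z : simplex1 D -> Prop) (V : simplex1 D -> R[i]) (L : chain1 D) :
  (forall f g : simplex1 D, same_path f g -> Z f -> Z g) ->
  (forall f g : simplex1 D, same_path f g -> V f = V g) -> (forall f, Z f -> V f = 0) ->
  (forall g, ~ Z g -> chain_coef L g = 0) ->
  \sum_(x <- L) x.1%:~R * V x.2 = 0.
Proof.
move=> ZE VE VZ; have [n] := ubnP (size L); elim: n => // n IHn in L *.
case: L => [|[m g] L] /=; first by rewrite big_nil.
rewrite ltnS => sL L0.
pose P (y : int * simplex1 D) := `[< same_path y.2 g >].
rewrite (bigID P) /= [X in _ + X](_ : _ = 0) ?addr0; last first.
  rewrite -big_filter; apply: IHn => [|h Zh].
    rewrite /= (_ : P (m, g)); last by apply/asboolP => t _; rewrite det2_id.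
    by rewrite size_filter (leq_ltn_trans (count_size _ _)).
  have [gh|gh] := pselect (same_path g h).
    rewrite /chain_coef big_filter big1 // => y /asboolP yg.
    rewrite /path_delta; case: asboolP => yh; last by rewrite mulr0.
    by case: yg; apply: same_path_trans yh (same_path_sym gh).
  rewrite /chain_coef big_filter -[RHS](L0 h Zh) /chain_coef [RHS](bigID P) /= [X in _ = X + _]big1 ?add0r //.
  move=> y /asboolP yg; rewrite /path_delta; case: asboolP => yh; last by rewrite mulr0.
  by case: gh; apply: same_path_trans yh; exact: same_path_sym.
have -> : \sum_(y <- (m, g) :: L | P y) y.1%:~R * V y.2 =
    (\sum_(y <- (m, g) :: L | P y) y.1)%:~R * V g.
  rewrite raddf_sum mulr_suml; apply: eq_bigr => y /asboolP yg.
  by rewrite (VE _ _ yg).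
have [Zg|Zg] := pselect (Z g); first by rewrite VZ ?mulr0.
have := L0 g Zg; rewrite /chain_coef => S0.
rewrite [X in X%:~R](_ : _ = 0) ?mul0r // -[RHS]S0 big_mkcond.
by apply: eq_bigr => y _; rewrite /path_delta /P; case: asboolP => _; rewrite ?mulr1 ?mulr0.
Qed.

End Chains.

Section Faces.
Variables (R : realType) (l : nat) (mu : 'I_l -> int) (D : differential R mu).

Lemma face_C1 (s : simplex2 D) (a0 b0 a1 b1 : R) :
  C1_map ((fun t => s (a0 + t * a1, b0 + t * b1)) : R^o -> _).
Proof.
move=> j; have [C0 C1] := simplex2_C1 s j.
pose e (t : R^o) : R^o * R^o := (a0 + t * a1, b0 + t * b1).
pose u (v : R^o) : R^o * R^o := (v * a1, v * b1).
have eE (h : R) v a : e (h *: v + a) = h *: u v + e a.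
  have H (c0 c1 : R) : c0 + (h * v + a) * c1 = h * (v * c1) + (c0 + a * c1) by ring.
  by apply: (congr2 pair); exact: H.
have ec : continuous e.
  have ec1 (c0 c1 : R) (t : R^o) : (fun t => c0 + t * c1 : R^o) @ t --> c0 + t * c1.
    by apply: cvgD; [exact: cvg_cst | apply: cvgM; [exact: cvg_id | exact: cvg_cst]].
  by move=> t; apply: cvg_point_pair; exact: ec1.
by split; [exact: (C1_real_affine eE ec C0) | exact: (C1_real_affine eE ec C1)].
Qed.

Lemma face_avoid (s : simplex2 D) (a0 b0 a1 b1 : R) :
  (forall t, 0 <= t <= 1 -> [/\ 0 <= a0 + t * a1, 0 <= b0 + t * b1 &
     (a0 + t * a1) + (b0 + t * b1) <= 1]) ->
  forall t, 0 <= t <= 1 -> s (a0 + t * a1, b0 + t * b1) != 0 /\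
     ~ is_pole D (s (a0 + t * a1, b0 + t * b1)).
Proof. by move=> H t /H[? ? ?]; exact: simplex2_avoid. Qed.

Lemma face_exists (s : simplex2 D) (a0 b0 a1 b1 : R) (f : R -> 'rV[R[i]]_2) :
  (forall t, 0 <= t <= 1 -> [/\ 0 <= a0 + t * a1, 0 <= b0 + t * b1 &
     (a0 + t * a1) + (b0 + t * b1) <= 1]) ->
  (forall t, f t = s (a0 + t * a1, b0 + t * b1)) ->
  exists g : simplex1 D, (g : R -> _) = f.
Proof.
move=> H fE; have -> : f = fun t => s (a0 + t * a1, b0 + t * b1) by apply/funext.
by exists (Simplex1 (face_C1 s a0 b0 a1 b1) (face_avoid s H)).
Qed.

Lemma simplex2_faces (s : simplex2 D) : exists f0 f1 f2 : simplex1 D,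
  [/\ (f0 : R -> _) = (fun t => s (1 - t, t)), (f1 : R -> _) = (fun t => s (0, t)) &
      (f2 : R -> _) = (fun t => s (t, 0))].
Proof.
have [|t|f0 E0] := @face_exists s 1 0 (-1) 1 (fun t => s (1 - t, t)).
- by move=> t /andP[? ?]; split; lra.
- by congr (s (_, _)); ring.
have [|t|f1 E1] := @face_exists s 0 0 0 1 (fun t => s (0, t)).
- by move=> t /andP[? ?]; split; lra.
- by congr (s (_, _)); ring.
have [|t|f2 E2] := @face_exists s 0 0 1 0 (fun t => s (t, 0)).
- by move=> t /andP[? ?]; split; lra.
- by congr (s (_, _)); ring.
by exists f0, f1, f2.
Qed.

End Faces.

Section Invariance.
Variables (R : realType) (l : nat) (mu : 'I_l -> int) (inf K z1 z2 : 'I_l).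
Hypotheses (mu0 : forall i, mu i != 0) (mu_inf : mu inf < 0) (mu_K : mu K < 0).
Hypotheses (mu_z1 : 0 < mu z1) (mu_z2 : 0 < mu z2) (inf_K : inf != K) (z1_z2 : z1 != z2).
Hypothesis mu_sum : \sum_i mu i = -2.
Variable D : differential R mu.

Local Notation E := (expansion mu inf K z1).
Local Notation X := (coord inf z1 z2 D).
Local Notation x := (cfg inf z1 z2 D).
Local Notation pt := (pt D).

Let inf_z1 : inf != z1. Proof. exact: pole_zero mu_inf mu_z1. Qed.
Let inf_z2 : inf != z2. Proof. exact: pole_zero mu_inf mu_z2. Qed.

Lemma coord_eq w w' : det2 w w' = 0 -> det2 w (pt inf) != 0 -> det2 w' (pt inf) != 0 ->
  X w = X w'.
Proof.
move=> ww wi wi'; apply/eqP; rewrite -subr_eq0; apply/eqP.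
transitivity (kap inf z1 z2 D * (det2 w w' * det2 (pt z1) (pt inf)) /
  (det2 w' (pt inf) * det2 w (pt inf))).
  by rewrite -det2_plucker /coord; field; rewrite wi wi'.
by rewrite ww mul0r mulr0 mul0r.
Qed.

Lemma path_integral_same (f g : simplex1 D) : same_path f g ->
  path_integral f = path_integral g.
Proof.
move=> fg; rewrite !(path_integralE mu0 mu_inf mu_K mu_z1 mu_z2 inf_K z1_z2 mu_sum) /path_val.
have XE t : 0 <= t <= 1 -> X (f t) = X (g t).
  move=> t01; apply: coord_eq; first exact: fg.
    by apply: not_pole_inf => //; have [] := simplex1_avoid f t01.
  by apply: not_pole_inf => //; have [] := simplex1_avoid g t01.
rewrite !XE ?lexx ?ler01 //; congr (_ * (_ + _)); apply: eq_bigr => i _; congr (_ * _).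
by apply: eq_logvar => t t01; rewrite XE.
Qed.

Definition in_zeros (f : simplex1 D) := forall t, 0 <= t <= 1 -> is_zero D (f t).

Lemma is_zero_same w w' : w != 0 -> det2 w w' = 0 -> is_zero D w -> is_zero D w'.
Proof.
move=> w0 ww [i [mi wi]]; exists i; split=> //; apply: (@det2_trans _ _ w) => //.
by rewrite det2C ww oppr0.
Qed.

Lemma in_zeros_same (f g : simplex1 D) : same_path f g -> in_zeros f -> in_zeros g.
Proof.
move=> fg fZ t t01; apply: is_zero_same (fg t t01) (fZ t t01).
by have [] := simplex1_avoid f t01.
Qed.

Lemma path_integral_zeros f : in_zeros f -> path_integral f = 0.
Proof.
move=> fZ; have h0 t : 0 <= t <= 1 -> diff_form D (f t) (cderive f t) = 0.
  move=> /fZ[i [mi fi]]; rewrite /diff_form (bigD1 i) //= fi.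
  by case: (mu i) mi => // -[//|n] _; rewrite exp0rz mul0r mulr0 mul0r.
rewrite /path_integral.
rewrite (@eq_Rintegral _ _ _ _ _ (fun=> 0)); last first.
  by move=> t; rewrite inE /= in_itv /= => /h0 ->.
rewrite [X in Complex _ X](@eq_Rintegral _ _ _ _ _ (fun=> 0)); last first.
  by move=> t; rewrite inE /= in_itv /= => /h0 ->.
by rewrite /Rintegral integral0.
Qed.

(** The rational parts telescope over the three vertices, and each logarithm has total variation 0
    by [logvar_triangle]. *)
Lemma simplex2_integral (s : simplex2 D) (f0 f1 f2 : simplex1 D) :
  (f0 : R -> _) = (fun t => s (1 - t, t)) -> (f1 : R -> _) = (fun t => s (0, t)) ->
  (f2 : R -> _) = (fun t => s (t, 0)) ->
  path_integral f0 - path_integral f1 + path_integral f2 = 0.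
Proof.
move=> e0 e1 e2.
pose S (f : R -> 'rV[R[i]]_2) :=
  \sum_(i | Pfin mu inf i) pf_res x E i * logvar (fun t => X (f t) - x i).
have piE (f : simplex1 D) : path_integral f =
    dcst inf z1 z2 D * (pf_prim x E (X (f 1)) - pf_prim x E (X (f 0)) + S f).
  exact: (path_integralE mu0 mu_inf mu_K mu_z1 mu_z2 inf_K z1_z2 mu_sum).
rewrite !piE e0 e1 e2 (subrr 1) (subr0 1).
have : S (fun t => s (1 - t, t)) - S (fun t => s (0, t)) + S (fun t => s (t, 0)) = 0.
  rewrite /S -sumrB -big_split big1 // => i Pi.
  rewrite [LHS]/= -mulrBr -mulrDr.
  have sc j p : ccont (fun p : R^o * R^o => s p 0 j) p.
    have [c1 c2] := simplex2_C1 s j.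
    by split; [exact: (C1_real_continuous c1)|exact: (C1_real_continuous c2)].
  have sP p : triangle p -> ~ is_pole D (s p).
    by case: p => a b [/= a0 b0 ab]; have [] := simplex2_avoid s a0 b0 ab.
  rewrite (@logvar_triangle R (fun p => X (s p) - x i)) ?mulr0 // => p pT.
    apply: ccontD; last exact: ccont_cst.
    apply: ccontM; last first.
      apply: ccontV; first by apply: not_pole_inf => //; exact: sP.
      by apply: ccont_det2 => j //; exact: ccont_cst.
    apply: ccontM; first exact: ccont_cst.
    by apply: ccont_det2 => j //; exact: ccont_cst.
  by apply: (@not_pole_coord _ _ _ _ z1 z2) => //; exact: sP.
have telescope (C p0 p1 p2 S0 S1 S2 : R[i]) : S0 - S1 + S2 = 0 ->
    C * (p2 - p1 + S0) - C * (p2 - p0 + S1) + C * (p1 - p0 + S2) = 0.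
  by move=> S012; rewrite -[RHS](mulr0 C) -S012; ring.
exact: telescope.
Qed.

(** The difference of c - c' and of the faces of s has coefficient 0 outside the paths inside the
    zeros, where omega vanishes; [chain_sum0] gives total integral 0, and the faces contribute 0. *)
Lemma period_homologous (c c' : chain1 D) : homologous c c' -> period c = period c'.
Proof.
move=> [s sH]; have /choice[F FP] (y : simplex2 D) : exists F : simplex1 D * simplex1 D * simplex1 D,
    [/\ (F.1.1 : R -> _) = (fun t => y (1 - t, t)), (F.1.2 : R -> _) = (fun t => y (0, t)) &
      (F.2 : R -> _) = (fun t => y (t, 0))].
  by have [f0 [f1 [f2 H]]] := simplex2_faces y; exists (f0, f1, f2).
pose B : chain1 D := flatten [seq [:: (y.1, (F y.2).1.1); (- y.1, (F y.2).1.2); (y.1, (F y.2).2)] | y <- s].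
pose neg (d : chain1 D) : chain1 D := [seq (- y.1, y.2) | y <- d].
have negE (d : chain1 D) (V : simplex1 D -> R[i]) :
    \sum_(y <- neg d) y.1%:~R * V y.2 = - \sum_(y <- d) y.1%:~R * V y.2.
  by rewrite big_map -sumrN; apply: eq_bigr => y _; rewrite rmorphN mulNr.
have negC (d : chain1 D) g : chain_coef (neg d) g = - chain_coef d g.
  by rewrite /chain_coef big_map -sumrN; apply: eq_bigr => y _; rewrite mulNr.
have BC g : chain_coef B g = boundary2_coef s g.
  rewrite /chain_coef /boundary2_coef big_flatten big_map; apply: eq_bigr => y _.
  have [e0 e1 e2] := FP y.2.
  by rewrite !big_cons big_nil /= e0 e1 e2; ring.
have BV (V : simplex1 D -> R[i]) : (forall y, V (F y).1.1 - V (F y).1.2 + V (F y).2 = 0) ->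
    \sum_(y <- B) y.1%:~R * V y.2 = 0.
  move=> V0; rewrite big_flatten big_map big1 // => y _.
  by rewrite !big_cons big_nil /= mulrNz mulNr addr0 addrA -mulrBr -mulrDr V0 mulr0.
have := @chain_sum0 R l mu D in_zeros (@path_integral R l mu D) (c ++ neg c' ++ neg B)
  in_zeros_same path_integral_same path_integral_zeros.
rewrite !big_cat /= !negE BV ?oppr0 ?addr0 => [H|y]; last first.
  by have [e0 e1 e2] := FP y; exact: simplex2_integral e0 e1 e2.
apply/eqP; rewrite -subr_eq0; apply/eqP; apply: H => g gZ.
rewrite /chain_coef !big_cat /= -!/(chain_coef _ _) !negC BC addrA sH ?subrr //.
Qed.

Lemma period_comb d (n : 'I_d -> int) (gam : 'I_d -> chain1 D) :
  period (chain_comb n gam) = \sum_j (n j)%:~R * period (gam j).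
Proof.
rewrite /period /chain_comb big_flatten big_map big_enum /=; apply: eq_bigr => j _.
rewrite big_map mulr_sumr; apply: eq_bigr => y _ /=.
by rewrite rmorphM mulrA.
Qed.

(** Periods of relative cycles are integral combinations of the basic ones, so a single scalar
    serves for all cycles. *)
Lemma algebraic_period_cycle : algebraic_periods D -> exists2 a : R[i], a != 0 &
  forall c : chain1 D, rel_cycle c -> is_algebraic (a * period c).
Proof.
move=> [d [gam [[gZ gB] [_ [a a0 aP]]]]]; exists a => // c cZ.
have [n [/period_homologous -> _]] := gB c cZ.
rewrite period_comb mulr_sumr; elim/big_ind: _ => [|y z yA zA|j _].
- exact: algebraic0.
- exact: algebraic_add.
- rewrite mulrCA; apply: algebraic_mul; last exact: aP.
  rewrite -(ratr_int _ (n j)); exact: algebraic_id.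
Qed.

End Invariance.

Lemma C1_real_derive1 (R : realType) (f df : R -> R) :
  (forall t : R, is_derive t 1 f (df t)) -> (forall t : R, (df : R^o -> R^o) @ t --> df t) ->
  C1_real (f : R^o -> R).
Proof.
move=> fd dfc v.
have dif (t : R^o) : differentiable (f : R^o -> R^o) t.
  by apply/derivable1_diffP; have H := fd t; exact: ex_derive.
have E : (fun t : R^o => 'D_v (f : R^o -> R^o) t) = (fun t => v * df t).
  apply/funext => t; rewrite deriveE //.
  have -> : v = v *: (1 : R^o) by rewrite /GRing.scale /= mulr1.
  rewrite linearZ /= -deriveE //; have H := fd t.
  by rewrite derive_val /GRing.scale /= mulr1.
split=> [t|]; first exact: diff_derivable.
rewrite [X in continuous X]E => t.
by apply: cvgM; [exact: cvg_cst | exact: dfc].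
Qed.

Lemma ccont_real (R : realType) (t : R) : ccont (fun s : R^o => s%:C) t.
Proof. exact: is_cderive_ccont (is_cderive_real t). Qed.

Lemma norm_real_ex (R : realType) (z : R[i]) : `|z| = (complex.Re `|z|)%:C.
Proof. by rewrite normc_def. Qed.

(** * Two explicit cycles: a loop around [K] and an arc from [z1] to [z2] *)

Section Cycles.
Variables (R : realType) (l : nat) (mu : 'I_l -> int) (inf K z1 z2 : 'I_l).
Hypotheses (mu0 : forall i, mu i != 0) (mu_inf : mu inf < 0) (mu_K : mu K < 0).
Hypotheses (mu_z1 : 0 < mu z1) (mu_z2 : 0 < mu z2) (inf_K : inf != K) (z1_z2 : z1 != z2).
Hypothesis mu_sum : \sum_i mu i = -2.
Variable D : differential R mu.

Local Notation E := (expansion mu inf K z1).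
Local Notation X := (coord inf z1 z2 D).
Local Notation x := (cfg inf z1 z2 D).
Local Notation pt := (pt D).
Local Notation kappa := (kap inf z1 z2 D).

Let inf_z1 : inf != z1. Proof. exact: pole_zero mu_inf mu_z1. Qed.
Let inf_z2 : inf != z2. Proof. exact: pole_zero mu_inf mu_z2. Qed.
Let kap0 : kappa != 0. Proof. exact: kap_neq0. Qed.
Let z1inf : det2 (pt z1) (pt inf) != 0.
Proof. by apply: pt_det; rewrite eq_sym. Qed.

(** A lift, affine in u, of the point of coordinate u. *)
Definition coord_lift (u : R[i]) : 'rV[R[i]]_2 := pt z1 - (u / kappa) *: pt inf.

Lemma det2_coord_lift u : det2 (coord_lift u) (pt inf) = det2 (pt z1) (pt inf).
Proof. rewrite /det2 !mxE; ring. Qed.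

Lemma coord_lift_neq0 u : coord_lift u != 0.
Proof.
apply: contraNneq z1inf => u0.
by rewrite -(det2_coord_lift u) u0 /det2 !mxE !mul0r subrr.
Qed.

Lemma coord_liftK u : X (coord_lift u) = u.
Proof.
rewrite /coord det2_coord_lift.
have -> : det2 (coord_lift u) (pt z1) = (u / kappa) * det2 (pt z1) (pt inf).
  rewrite /det2 !mxE; ring.
by field; rewrite kap0 z1inf.
Qed.

Section Path.
Variables gam dgam : R -> R[i].
Hypotheses (gamd : forall t, is_cderive gam t (dgam t))
  (dgamc : forall t, ccont (dgam : R^o -> _) t)
  (gam_avoid : forall t i, 0 <= t <= 1 -> Pfin mu inf i -> gam t != x i).

Lemma path_exists : exists g : simplex1 D, (g : R -> _) = (fun t => coord_lift (gam t)).
Proof.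
have C1 : C1_map ((fun t => coord_lift (gam t)) : R^o -> _).
  move=> j.
  have gd t : is_cderive (fun s => coord_lift (gam s) 0 j) t (- (pt inf 0 j / kappa) * dgam t).
    rewrite (_ : (fun s => _) = fun s => pt z1 0 j + (- (pt inf 0 j / kappa)) * gam s); last first.
      by apply/funext => s; rewrite !mxE; ring.
    apply: is_cderive_eq (is_cderiveD (is_cderive_cst _ t) (is_cderiveZ _ (gamd t))) _.
    by rewrite add0r.
  have gc t : ccont (fun s : R^o => - (pt inf 0 j / kappa) * dgam s) t.
    by apply: ccontM => //; exact: ccont_cst.
  split; first exact: (C1_real_derive1 (fun t => (gd t).1) (fun t => (gc t).1)).
  exact: (C1_real_derive1 (fun t => (gd t).2) (fun t => (gc t).2)).
have avoid t : 0 <= t <= 1 ->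
    coord_lift (gam t) != 0 /\ ~ is_pole D (coord_lift (gam t)).
  move=> t01; split; first exact: coord_lift_neq0.
  move=> [i [mi gi]]; have [iE|ii] := eqVneq i inf.
    by move/eqP: gi; rewrite iE -/(pt inf) det2_coord_lift (negPf z1inf).
  have Pi : Pfin mu inf i by rewrite /Pfin /Jfin /= ii.
  have /eqP[] := gam_avoid t01 Pi; apply/eqP; rewrite -subr_eq0.
  rewrite -[gam t]coord_liftK coord_sub ?det2_coord_lift //.
  by rewrite -/(pt i) in gi; rewrite gi mulr0 mul0r.
by exists (Simplex1 C1 avoid).
Qed.

Lemma path_integral_lift (g : simplex1 D) :
  (g : R -> _) = (fun t => coord_lift (gam t)) ->
  path_integral g = dcst inf z1 z2 D * (pf_prim x E (gam 1) - pf_prim x E (gam 0) +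
    \sum_(i | Pfin mu inf i) pf_res x E i * logvar (fun t => gam t - x i)).
Proof.
move=> gE; rewrite (path_integralE mu0 mu_inf mu_K mu_z1 mu_z2 inf_K z1_z2 mu_sum) /path_val.
rewrite gE !coord_liftK; congr (_ * (_ + _)); apply: eq_bigr => i _; congr (_ * _).
by apply: eq_logvar => t _; rewrite coord_liftK.
Qed.

End Path.

Let KP : Pfin mu inf K.
Proof. by rewrite /Pfin /Jfin /= eq_sym inf_K. Qed.

(** The radius is so small that for the other poles (gam - x_i) / (x_K - x_i) stays in the right
    half-plane; its principal logarithm then returns to its initial value. The rational primitive
    closes up as well, and the logarithm at x_K varies by 2 pi i. *)
Lemma loop_integral : exists2 c : chain1 D, rel_cycle c &
  period c = dcst inf z1 z2 D * (pf_res x E K * (2 * pi)%:C * 'i%C).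
Proof.
pose A i := complex.Re `|(x K - x i)^-1|.
have A0 i : 0 <= A i by rewrite -ler0c -norm_real_ex.
pose eps := (1 + \sum_i A i)^-1.
have S1 : 0 < 1 + \sum_i A i by rewrite ltr_pwDl // sumr_ge0.
have eps0 : 0 < eps by rewrite invr_gt0.
have epsA i : eps * A i < 1.
  rewrite mulrC ltr_pdivrMr // mul1r (bigD1 i) //= addrCA ltr_pwDr //.
  by rewrite ltr_pwDl // sumr_ge0.
pose c2 : R[i] := (2 * pi)%:C * 'i%C.
pose e (t : R) := cexp (c2 * t%:C).
have eE t : complex.Re (c2 * t%:C) = 0 by rewrite !cReM !cImM /=; ring.
have ne t : `|e t| = 1 by rewrite norm_cexp eE expR0.
have e0 : e 0 = 1 by rewrite /e mulr0 cexp0.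
have e1 : e 1 = 1.
  have c2E : c2 = 0 +i* (pi *+ 2) by rewrite -mulr_natl; apply: complex_eq => /=; ring.
  by rewrite /e mulr1 c2E /cexp /= expR0 cos2pi sin2pi !mul1r.
pose gam t := x K + eps%:C * e t.
pose dgam t := eps%:C * (e t * c2).
have ed t : is_cderive e t (e t * c2).
  apply: is_cderive_eq (is_cderive_cexp (is_cderiveZ c2 (is_cderive_real t))) _.
  by rewrite mulr1.
have gamd t : is_cderive gam t (dgam t).
  apply: is_cderive_eq (is_cderiveD (is_cderive_cst _ t) (is_cderiveZ _ (ed t))) _.
  by rewrite add0r.
have ec t : ccont (e : R^o -> _) t := is_cderive_ccont (ed t).
have dgamc t : ccont (dgam : R^o -> _) t.
  by apply: ccontM; [exact: ccont_cst | apply: ccontM => //; exact: ccont_cst].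
pose w i t := 1 + eps%:C * e t / (x K - x i).
have xK i : Pfin mu inf i -> i != K -> x K - x i != 0.
  move=> /andP[ii _] iK; rewrite subr_eq0 cfg_inj // eq_sym //.
have wE i t : Pfin mu inf i -> i != K -> gam t - x i = (x K - x i) * w i t.
  by move=> Pi iK; rewrite /gam /w; field; exact: xK.
have Rew i t : 0 < complex.Re (w i t).
  have : `|complex.Re (eps%:C * e t / (x K - x i))| <= eps * A i.
    apply: Re_le_norm; rewrite !normrM ne mulr1 norm_real (gtr0_norm eps0).
    by rewrite rmorphM /= -norm_real_ex lexx.
  rewrite /w cReD ler_norml => /andP[wl _]; have := epsA i.
  have -> : complex.Re 1 = 1 :> R by [].
  lra.
have w_neq0 i t : w i t != 0.
  by apply/eqP => w0; have := Rew i t; rewrite w0 ltxx.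
have avoid t i : 0 <= t <= 1 -> Pfin mu inf i -> gam t != x i.
  move=> _ Pi; rewrite -subr_eq0; have [->|iK] := eqVneq i K.
    rewrite /gam addrC addKr mulf_neq0 ?cexp_neq0 // (inj_eq (@complexI R)).
    by rewrite gt_eqF.
  by rewrite wE // mulf_neq0 ?xK.
have [g gE] := path_exists gamd dgamc avoid.
have gam01 : gam 1 = gam 0 by rewrite /gam e0 e1.
exists [:: (1, g)].
  by move=> q _ _; rewrite /boundary1_coef big_seq1 /= gE gam01 subrr mulr0.
rewrite /period big_seq1 /= mul1r (path_integral_lift gE) gam01 subrr add0r.
congr (_ * _); rewrite (bigD1 K) //= [X in _ + X]big1 ?addr0.
  rewrite -mulrA -/c2; congr (_ * _); rewrite (@logvarE _ _ (fun t => c2 * t%:C)).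
    by rewrite mulr1 mulr0 subr0.
  move=> t _; split; first by apply: ccontM; [exact: ccont_cst | exact: ccont_real].
  rewrite mulr0 subr0 /gam e0 !(addrC (x K)) !addrK mulr1 -/(e t).
  by rewrite [eps%:C * _]mulrC mulfK // (inj_eq (@complexI R)) gt_eqF.
move=> i /andP[Pi iK]; rewrite (@logvarE _ _ (fun t => clog (w i t))).
  by rewrite /w e0 e1 subrr mulr0.
move=> t _; split.
  apply: ccont_clog; first exact: Rew.
  apply: ccontD; first exact: ccont_cst.
  by apply: ccontM; [apply: ccontM => //; exact: ccont_cst | exact: ccont_cst].
by rewrite cexpD cexpN !clogK // !wE // mulrC -mulf_div divff ?xK // mul1r mulrC.
Qed.

(** The parabola t + i c t (1 - t) could meet a pole x_i only where Im x_i = c Re x_i (1 - Re x_i),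
    and c exceeds all the quotients this would require. Its ends 0 and 1 are zeros of omega, not
    poles, so it is a relative cycle. *)
Lemma arc_integral : exists2 c : chain1 D, rel_cycle c &
  exists W : 'I_l -> R[i], (forall i, Pfin mu inf i -> cexp (W i) = (1 - x i) / (0 - x i)) /\
  period c = dcst inf z1 z2 D * (pf_prim x E 1 - pf_prim x E 0 +
    \sum_(i | Pfin mu inf i) pf_res x E i * W i).
Proof.
pose a i := complex.Re (x i); pose b i := complex.Im (x i).
pose c := 1 + \sum_i `|b i / (a i * (1 - a i))|.
have c_gt i : b i / (a i * (1 - a i)) < c.
  rewrite (le_lt_trans (ler_norm _)) // /c (bigD1 i) //= addrCA ltr_pwDr //.
  by rewrite ltr_pwDl // sumr_ge0.
pose c1 : R[i] := c%:C * 'i%C.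
pose gam (t : R) := t%:C + c1 * (t%:C * (1 + (-1) * t%:C)).
pose dgam (t : R) := 1 + c1 * (1 + (-2) * t%:C).
have gamd t : is_cderive gam t (dgam t).
  have d1 := is_cderive_real t.
  apply: is_cderive_eq (is_cderiveD d1 (is_cderiveZ c1 (is_cderiveM d1
    (is_cderiveD (is_cderive_cst 1 t) (is_cderiveZ (-1) d1))))) _.
  by rewrite /dgam; ring.
have dgamc t : ccont (dgam : R^o -> _) t.
  apply: ccontD; first exact: ccont_cst.
  apply: ccontM; first exact: ccont_cst.
  apply: ccontD; first exact: ccont_cst.
  by apply: ccontM; [exact: ccont_cst | exact: ccont_real].
have avoid t i : 0 <= t <= 1 -> Pfin mu inf i -> gam t != x i.
  move=> t01 /andP[ii mi]; apply/eqP => gx.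
  have iz1 : x i != x z1.
    by apply: cfg_inj => //; [rewrite eq_sym | exact: (pole_zero mi mu_z1)].
  have iz2 : x i != x z2.
    by apply: cfg_inj => //; [rewrite eq_sym | exact: (pole_zero mi mu_z2)].
  rewrite cfg_z1 in iz1; rewrite (cfg_z2 inf_z2 z1_z2) in iz2.
  have ta : a i = t.
    rewrite /a -gx /gam /c1 !(cReD, cReM, cImD, cImM) /=; ring.
  have tb : b i = c * (t * (1 - t)).
    rewrite /b -gx /gam /c1 !(cReD, cReM, cImD, cImM) /=; ring.
  have t0 : t != 0.
    apply: contraNneq iz1 => t0; rewrite -gx /gam t0; apply/eqP; ring.
  have t1 : 1 - t != 0.
    apply: contraNneq iz2 => /eqP; rewrite subr_eq0 => /eqP t1.
    by rewrite -gx /gam -t1; apply/eqP; ring.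
  by have := c_gt i; rewrite ta tb mulfK ?ltxx // mulf_neq0.
have [g gE] := path_exists gamd dgamc avoid.
have gam0 : gam 0 = 0 by rewrite /gam; ring.
have gam1 : gam 1 = 1 by rewrite /gam; ring.
have lift0 : coord_lift 0 = pt z1 by rewrite /coord_lift mul0r scale0r subr0.
have lift1 : det2 (pt z2) (coord_lift 1) = 0.
  have -> : det2 (pt z2) (coord_lift 1) = det2 (pt z2) (pt z1) - kappa^-1 * det2 (pt z2) (pt inf).
    by rewrite /det2 !mxE; ring.
  rewrite /kap; field.
  by rewrite !pt_det // eq_sym.
exists [:: (1, g)].
  move=> q q0 qZ; rewrite /boundary1_coef big_seq1 /= gE gam0 gam1 lift0.
  have -> : (det2 (pt z1) q == 0) = false.
    by apply/eqP => qz; apply: qZ; exists z1; split=> //; rewrite det2C qz oppr0.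
  have -> : (det2 (coord_lift 1) q == 0) = false.
    apply/eqP => qz; apply: qZ; exists z2; split=> //.
    rewrite det2C (_ : det2 _ _ = 0) ?oppr0 //.
    exact: det2_trans (coord_lift_neq0 1) lift1 qz.
  by [].
exists (fun i => logvar (fun t => gam t - x i)); split.
  move=> i Pi; rewrite cexp_logvar ?gam0 ?gam1 //.
    by move=> t _; apply: ccontD; [exact: is_cderive_ccont (gamd t) | exact: ccont_cst].
  by move=> t t01; rewrite subr_eq0 avoid.
by rewrite /period big_seq1 /= mul1r (path_integral_lift gE) gam0 gam1.
Qed.

End Cycles.

(** * Arithmetic points satisfy the key equation *)

Section Algebraic.
Variables (R : realType) (l : nat) (mu : 'I_l -> int) (inf z1 z2 : 'I_l).
Variable D : differential R mu.
Hypothesis DQ : over_Qbar D.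
Local Notation alg := (@is_algebraic R).

Lemma algebraicXz (z : R[i]) (n : int) : alg z -> alg (z ^ n).
Proof.
move=> zA; have H k : alg (z ^+ k).
  elim: k => [|k IHk]; first by rewrite expr0; exact: algebraic1.
  by rewrite exprS; exact: algebraic_mul.
by case: n => n; [exact: H | apply: algebraic_inv; exact: H].
Qed.

Lemma algebraic_det2 i j : alg (det2 (pt D i) (pt D j)).
Proof.
have [_ pA] := DQ; rewrite /det2 !mxE.
by apply: algebraic_sub; apply: algebraic_mul; exact: pA.
Qed.

Lemma algebraic_kap : alg (kap inf z1 z2 D).
Proof. by apply: algebraic_div; exact: algebraic_det2. Qed.

Lemma algebraic_cfg i : alg (cfg inf z1 z2 D i).
Proof.
apply: algebraic_div; last exact: algebraic_det2.
by apply: algebraic_mul; [exact: algebraic_kap | exact: algebraic_det2].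
Qed.

Lemma algebraic_dcst : alg (dcst inf z1 z2 D).
Proof.
have kA := algebraic_kap; have [sA _] := DQ.
apply: algebraic_div; last by apply: algebraic_mul => //; exact: algebraic_det2.
apply: algebraic_mul => //; elim/big_ind: _ => [|u v uA vA|i _].
- exact: algebraic1.
- exact: algebraic_mul.
apply: algebraicXz; apply: algebraic_div; last exact: algebraic_det2.
by apply: algebraic_mul => //; exact: algebraic_det2.
Qed.

End Algebraic.

Section Arithmetic.
Variables (R : realType) (l : nat) (mu : 'I_l -> int) (inf K z1 z2 : 'I_l).
Hypotheses (mu0 : forall i, mu i != 0) (mu_inf : mu inf < 0) (mu_K : mu K < 0).
Hypotheses (mu_z1 : 0 < mu z1) (mu_z2 : 0 < mu z2) (inf_K : inf != K) (z1_z2 : z1 != z2).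
Hypothesis mu_sum : \sum_i mu i = -2.
Variable D : differential R mu.
Local Notation alg := (@is_algebraic R).
Local Notation E := (expansion mu inf K z1).
Local Notation x := (cfg inf z1 z2 D).

Let inf_z1 : inf != z1. Proof. exact: pole_zero mu_inf mu_z1. Qed.
Let inf_z2 : inf != z2. Proof. exact: pole_zero mu_inf mu_z2. Qed.

Lemma rwf_key : rwf (Jfin inf) (key_exp mu inf K z1 z2).
Proof.
have gE := good_expansion mu_inf mu_K mu_z1 inf_K.
have zP z : 0 < mu z -> ~~ Pfin mu inf z.
  by move=> mz; rewrite /Pfin /= negb_and -leNgt ltW ?orbT.
by rewrite /key_exp /= !(rwf_prim _ _ gE) ?(rwf_res _ gE) ?zP // /Jfin /= eq_sym.
Qed.

(** If r_K is nonzero, comparing the two periods gives b0 + S = q tau, with q algebraic and tau = 2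
    pi i. Then -b0 = S - q tau is an algebraic value of a linear form in logarithms of algebraic
    numbers, so [baker] makes it 0. *)
Lemma arithmetic_key : over_Qbar D -> algebraic_periods D ->
  reval x (key_exp mu inf K z1 z2) = 0.
Proof.
move=> DQ DP; rewrite reval_key cfg_z1 (cfg_z2 inf_z2 z1_z2).
have [->|rK] := eqVneq (pf_res x E K) 0; first by rewrite mulr0.
set C := dcst inf z1 z2 D; set r := pf_res x E in rK *.
set b0 := _ - _; suff -> : b0 = 0 by rewrite mul0r.
have C0 : C != 0 by exact: dcst_neq0.
have CA : alg C := algebraic_dcst _ _ _ DQ.
have xA i : Jfin inf i -> alg (x i) by move=> _; exact: algebraic_cfg.
have gE := good_expansion mu_inf mu_K mu_z1 inf_K.
have rA i : alg (r i).
  by rewrite /r -reval_res; apply: reval_algebraic (rwf_res _ gE) xA.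
have b0A : alg b0.
  have zP z : 0 < mu z -> ~~ Pfin mu inf z.
    by move=> mz; rewrite /Pfin /= negb_and -leNgt ltW ?orbT.
  rewrite /b0 -(cfg_z2 inf_z2 z1_z2 D) -(cfg_z1 inf z1 z2 D) -!reval_prim.
  by apply: algebraic_sub; apply: reval_algebraic (rwf_prim _ _ gE) xA;
    rewrite ?zP // /Jfin /= eq_sym.
have [a a0 aP] := algebraic_period_cycle mu0 mu_inf mu_K mu_z1 mu_z2 inf_K z1_z2 mu_sum DP.
have [c1 /aP + c1E] := loop_integral mu0 mu_inf mu_K mu_z1 mu_z2 inf_K z1_z2 mu_sum D.
have [c2 /aP + [W [WP c2E]]] := arc_integral mu0 mu_inf mu_K mu_z1 mu_z2 inf_K z1_z2 mu_sum D.
rewrite {}c1E {}c2E -/C -/r -/b0; set S := \sum_(i | _) _ => eta_A bA.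
pose tau : R[i] := (2 * pi)%:C * 'i%C.
pose b := a * tau; pose eta := a * (C * (b0 + S)).
have {}bA : alg b.
  have -> : b = a * (C * (r K * (2 * pi)%:C * 'i%C)) / (C * r K).
    rewrite /b -[_ * 'i%C]mulrA -/tau; move: (r K) rK (C) C0 (tau) => r0 rK' c0 c0' t0.
    by field; rewrite c0' rK'.
  by apply: algebraic_div; [exact: bA | apply: algebraic_mul; [exact: CA | exact: rA]].
have tau0 : tau != 0.
  apply: mulf_neq0; last by rewrite -normr_eq0 norm_i oner_eq0.
  by rewrite (inj_eq (@complexI R)) mulf_neq0 ?pnatr_eq0 // gt_eqF // pi_gt0.
have b_neq0 : b != 0 by rewrite mulf_neq0.
pose q := eta / (b * C).
have qA : alg q by apply: algebraic_div => //; exact: algebraic_mul.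
have qE : b0 + S = q * tau.
  rewrite /q /eta /b; move: (b0 + S) => z; move: (C) C0 (tau) tau0 => c0 c0' t0 t0'.
  by field; rewrite c0' a0 t0'.
(* Index 0 carries tau, a logarithm of 1; indices that are not finite poles are padded with the
   logarithm 0. *)
pose lam (k : 'I_l.+1) := if unlift ord0 k is Some i then
  if Pfin mu inf i then W i else 0 else tau.
pose bet (k : 'I_l.+1) := if unlift ord0 k is Some i then
  if Pfin mu inf i then r i else 0 else - q.
have sE : \sum_k bet k * lam k = - b0.
  rewrite big_ord_recl /bet /lam unlift_none mulNr -qE.
  have -> : \sum_(i < l) (if unlift ord0 (lift ord0 i) is Some i then
        if Pfin mu inf i then r i else 0 else - q) *
      (if unlift ord0 (lift ord0 i) is Some i then if Pfin mu inf i then W i else 0 else tau) = S.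
    rewrite /S [RHS]big_mkcond; apply: eq_bigr => i _; rewrite liftK.
    by case: ifP => _; rewrite ?mulr0.
  by rewrite opprD subrK.
have : \sum_k bet k * lam k = 0.
  apply: baker => [k|k|]; last by rewrite sE; exact: algebraic_opp.
    rewrite /bet; case: unliftP => [i _|_]; last exact: algebraic_opp.
    by case: ifP => _; [exact: rA | exact: algebraic0].
  rewrite /lam; case: unliftP => [i _|_].
    case: ifP => [Pi|_]; last by rewrite cexp0; exact: algebraic1.
    rewrite WP //; have /andP[ii _] := Pi; have xi := xA i ii.
    apply: algebraic_div; apply: algebraic_sub; try exact: xi.
      exact: algebraic1.
    exact: algebraic0.
  have -> : tau = 0 +i* (pi *+ 2) by rewrite -mulr_natl /tau; apply: complex_eq => /=; ring.
  by rewrite /cexp /= expR0 cos2pi sin2pi !mul1r; exact: algebraic1.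
by rewrite sE => /eqP; rewrite oppr_eq0 => /eqP.
Qed.

End Arithmetic.

(** * The key equation as a closed condition on the stratum *)

Lemma det2_eq0P (F : fieldType) (a b : 'rV[F]_2) :
  a != 0 -> det2 a b = 0 -> exists c, b = c *: a.
Proof.
move=> a0 ab.
have rowE (v w : 'rV[F]_2) : v 0 0 = w 0 0 -> v 0 1 = w 0 1 -> v = w.
  move=> e0 e1; apply/rowP => -[[|[|//]] p].
    by rewrite (_ : Ordinal p = 0) //; apply: val_inj.
  by rewrite (_ : Ordinal p = 1) //; apply: val_inj.
have E : a 0 0 * b 0 1 = a 0 1 * b 0 0 by apply/eqP; rewrite -subr_eq0; apply/eqP.
have [a00|a00] := eqVneq (a 0 0) 0.
  have a01 : a 0 1 != 0 by apply: contraNneq a0 => a01; apply/eqP/rowE; rewrite mxE.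
  exists (b 0 1 / a 0 1); apply: rowE; rewrite mxE ?divfK // a00 mulr0.
  by move/esym/eqP: E; rewrite a00 mul0r mulf_eq0 (negPf a01) => /eqP.
exists (b 0 0 / a 0 0); apply: rowE; rewrite mxE ?divfK //.
by apply: (mulfI a00); rewrite E; field.
Qed.

Section Isomorphism.
Variables (R : realType) (l : nat) (mu : 'I_l -> int).
Implicit Types D : differential R mu.

Lemma diff_iso_refl D : diff_iso D D.
Proof.
exists 1%:M; split=> [|i|w v]; first exact: unitmx1.
  by rewrite mulmx1 det2_id.
by rewrite !mulmx1.
Qed.

Lemma iso_class_eq D D' : iso_class D = iso_class D' -> diff_iso D D'.
Proof.
move=> /(congr1 (@proj1_sig _ _)) /= /seteqP[_ /(_ D')]; apply; exact: diff_iso_refl.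
Qed.

(** [cfg] is the cross-ratio of p_i with the three normalising points: the factors of the lifts and
    the determinant of the Moebius map cancel. *)
Lemma cfg_iso (inf z1 z2 : 'I_l) D D' i : i != inf -> inf != z2 -> z2 != z1 ->
  diff_iso D D' -> cfg inf z1 z2 D i = cfg inf z1 z2 D' i.
Proof.
move=> ii iz2 z21 [g [gU gP _]].
have g0 : \det g != 0 by rewrite -unitfE -unitmxE.
have /choice[c cP] k : exists c, c != 0 /\ pt D' k = c *: (pt D k *m g).
  have pg0 : pt D k *m g != 0.
    apply: contra_neq (diff_pt_neq0 D k) => pg.
    by rewrite -[LHS](mulmxK gU) -/(pt D k) pg mul0mx.
  have [c cE] := det2_eq0P pg0 (gP k); exists c; split=> //.
  by apply: contra_neq (diff_pt_neq0 D' k) => c0; rewrite -/(pt D' k) /pt cE c0 scale0r.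
have dE j k : det2 (pt D' j) (pt D' k) = c j * c k * \det g * det2 (pt D j) (pt D k).
  have [_ ->] := cP j; have [_ ->] := cP k.
  have -> (a b : R[i]) (v w : 'rV[R[i]]_2) : det2 (a *: v) (b *: w) = a * b * det2 v w.
    by rewrite /det2 !mxE; ring.
  by rewrite det2_mul mulrA.
rewrite /cfg /coord /kap !dE.
have [ci _] := cP i; have [c1 _] := cP z1; have [c2 _] := cP z2; have [cinf _] := cP inf.
have d1 : det2 (pt D z2) (pt D z1) != 0 by exact: pt_det.
have d2 : det2 (pt D i) (pt D inf) != 0 by exact: pt_det.
by field; rewrite ci c1 c2 cinf g0 d1 d2.
Qed.

Definition polyfun (f : differential R mu -> R[i]) :=
  exists p : mpoly.mpoly (1 + l * 2) R[i], forall D, f D = mpoly.meval (diff_coord D 0) p.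

Lemma polyfun_cst c : polyfun (fun=> c).
Proof. by exists (mpoly.mpolyC _ c) => D; rewrite mpoly.mevalC. Qed.

Lemma polyfunD f g : polyfun f -> polyfun g -> polyfun (fun D => f D + g D).
Proof. by move=> [p fp] [q gq]; exists (p + q) => D; rewrite mpoly.mevalD fp gq. Qed.

Lemma polyfunM f g : polyfun f -> polyfun g -> polyfun (fun D => f D * g D).
Proof. by move=> [p fp] [q gq]; exists (p * q) => D; rewrite mpoly.mevalM fp gq. Qed.

Lemma polyfun_pt i j : polyfun (fun D => diff_pt D i j).
Proof.
exists (mpoly.mpolyX R[i] (mpoly.mnm1 (rshift 1 (mxvec_index i j)))) => D.
by rewrite mpoly.mevalXU /diff_coord row_mxEr mxvecE.
Qed.

Lemma polyfun_det2 i j : polyfun (fun D => det2 (pt D i) (pt D j)).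
Proof.
have [p pE] := polyfunD (polyfunM (polyfun_pt i 0) (polyfun_pt j 1))
  (polyfunM (polyfun_cst (-1)) (polyfunM (polyfun_pt i 1) (polyfun_pt j 0))).
by exists p => D; rewrite -pE /det2 !mxE mulN1r.
Qed.

(** The denominator vanishes nowhere on the space of differentials, so the zero locus is that of the
    polynomial p, as [zariski_closed] demands. *)
Definition fracfun (f : differential R mu -> R[i]) := exists p q,
  [/\ polyfun p, polyfun q & forall D, q D != 0 /\ f D = p D / q D].

Lemma fracfun_poly p : polyfun p -> fracfun p.
Proof.
move=> pP; exists p, (fun=> 1); split=> //; first exact: polyfun_cst.
by move=> D; rewrite oner_neq0 divr1.
Qed.

Lemma fracfunD f g : fracfun f -> fracfun g -> fracfun (fun D => f D + g D).
Proof.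
move=> [p [q [pP qP fE]]] [r [s [rP sP gE]]].
exists (fun D => p D * s D + r D * q D), (fun D => q D * s D); split.
- by apply: polyfunD; exact: polyfunM.
- exact: polyfunM.
move=> D; have [q0 ->] := fE D; have [s0 ->] := gE D.
by rewrite mulf_neq0 //; split=> //; field; rewrite q0 s0.
Qed.

Lemma fracfunM f g : fracfun f -> fracfun g -> fracfun (fun D => f D * g D).
Proof.
move=> [p [q [pP qP fE]]] [r [s [rP sP gE]]].
exists (fun D => p D * r D), (fun D => q D * s D); split; try exact: polyfunM.
move=> D; have [q0 ->] := fE D; have [s0 ->] := gE D.
by rewrite mulf_neq0 //; split=> //; field; rewrite q0 s0.
Qed.

Lemma fracfunV f : (forall D, f D != 0) -> fracfun f -> fracfun (fun D => (f D)^-1).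
Proof.
move=> f0 [p [q [pP qP fE]]]; exists q, p; split=> // D.
have [q0 E] := fE D; have := f0 D; rewrite E => pq0.
split; last by rewrite invf_div.
by apply: contraNneq pq0 => ->; rewrite mul0r.
Qed.

Lemma fracfun_cfg (inf z1 z2 : 'I_l) i : inf != z1 -> inf != z2 -> z1 != z2 -> i != inf ->
  fracfun (fun D => cfg inf z1 z2 D i).
Proof.
move=> iz1 iz2 z12 ii; have det j k := fracfun_poly (polyfun_det2 j k).
apply: fracfunM; last by apply: fracfunV => // D; exact: pt_det.
apply: fracfunM => //; apply: fracfunM => //; apply: fracfunV => // D.
by apply: pt_det; rewrite eq_sym.
Qed.

Lemma fracfun_reval (inf z1 z2 : 'I_l) e : inf != z1 -> inf != z2 -> z1 != z2 ->
  rwf (Jfin inf) e -> fracfun (fun D => reval (cfg inf z1 z2 D) e).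
Proof.
move=> iz1 iz2 z12; elim: e => [q|i|a IHa b IHb|a IHa b IHb|i j] /=.
- by move=> _; apply: fracfun_poly; exact: polyfun_cst.
- by move=> ii; exact: fracfun_cfg.
- by case/andP => /IHa ? /IHb ?; exact: fracfunD.
- by case/andP => /IHa ? /IHb ?; exact: fracfunM.
case/and3P => ii ji ij; apply: fracfunV.
  by move=> D; rewrite subr_eq0; exact: cfg_inj.
have [p [q [pP qP H]]] := fracfunD (fracfun_cfg iz1 iz2 z12 ii)
  (fracfunM (fracfun_poly (polyfun_cst (-1))) (fracfun_cfg iz1 iz2 z12 ji)).
by exists p, q; split=> // D; have [q0 E] := H D; rewrite -E mulN1r.
Qed.

End Isomorphism.

(** * Realising a configuration by a differential, and the conclusion *)

Section Realization.
Variables (R : realType) (l : nat) (mu : 'I_l -> int) (inf : 'I_l) (x : 'I_l -> R[i]).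
Hypothesis x_inj : injective x.

Definition conf_mx : 'M[R[i]]_(l, 2) :=
  \matrix_(i, j) if i == inf then (j == 0)%:R else if j == 0 then x i else 1.

Lemma det2_conf i j : det2 (row i conf_mx) (row j conf_mx) =
  if i == inf then (if j == inf then 0 else 1)
  else if j == inf then -1 else x i - x j.
Proof.
by rewrite /det2 !mxE /=; case: ifP => _; case: ifP => _ /=; ring.
Qed.

Lemma conf_neq0 i : row i conf_mx != 0.
Proof.
apply/eqP => /rowP H; have [iE|ii] := eqVneq i inf.
  by have := H 0; rewrite !mxE iE eqxx => /eqP; rewrite oner_eq0.
by have := H 1; rewrite !mxE (negPf ii) => /eqP; rewrite oner_eq0.
Qed.

Lemma conf_distinct i j : i != j -> det2 (row i conf_mx) (row j conf_mx) != 0.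
Proof.
move=> ij; rewrite det2_conf.
have [ii|ii] := eqVneq i inf; have [ji|ji] := eqVneq j inf.
- by rewrite ii ji eqxx in ij.
- exact: oner_neq0.
- by rewrite oppr_eq0 oner_neq0.
- by rewrite subr_eq0 (inj_eq x_inj).
Qed.

Definition conf_diff : differential R mu :=
  Differential mu (oner_neq0 _) conf_neq0 conf_distinct.

Lemma cfg_conf (z1 z2 i : 'I_l) : inf != z1 -> inf != z2 -> x z1 = 0 -> x z2 = 1 ->
  i != inf -> cfg inf z1 z2 conf_diff i = x i.
Proof.
move=> iz1 iz2 x1 x2 ii; rewrite /cfg /coord /kap /pt /= !det2_conf eqxx.
rewrite !(eq_sym _ inf) (negPf iz1) (negPf iz2) eq_sym (negPf ii) x1 x2.
by rewrite !subr0 divr1; field.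
Qed.

End Realization.

(** Each excluded alternative provides an index: a pole that is not simple, another pole, another
    zero. A first zero exists because otherwise the sum would be at most mu inf + mu K < -2. *)
Lemma exists_indices (l : nat) (mu : 'I_l -> int) :
  (forall i, mu i != 0) -> \sum_(i < l) mu i = -2 ->
  ~ [\/ only_simple_poles mu, single_pole mu | single_zero mu] ->
  exists inf K z1 z2 : 'I_l,
    [/\ mu inf <= -2, mu K < 0, 0 < mu z1 & 0 < mu z2] /\ inf != K /\ z1 != z2.
Proof.
move=> mu0 mu_sum H.
have [inf [mi1 mi2]] : exists inf, mu inf < 0 /\ mu inf <> -1.
  apply: contrapT => N; apply: H; apply: Or31 => i mi.
  by apply: contrapT => m1; apply: N; exists i.
have mi : mu inf <= -2 by move: mi1 mi2; clear; lia.
have two (P : pred 'I_l) (a : 'I_l) : P a -> #|P| != 1%N -> exists2 b, P b & a != b.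
  move=> Pa P1; have : (1 < #|P|)%N.
    by rewrite ltn_neqAle eq_sym P1; apply/card_gt0P; exists a.
  rewrite (cardD1 a) (_ : a \in P) // add1n ltnS.
  by case/card_gt0P => b; rewrite !inE => /andP[ba Pb]; exists b; rewrite // eq_sym.
have [K mK iK] : exists2 K, mu K < 0 & inf != K.
  by apply: (two [pred i | mu i < 0]) => //; apply/eqP => c1; apply: H; exact: Or32.
have [z1 mz1] : exists z1, 0 < mu z1.
  apply: contrapT => N.
  have : \sum_(i < l) mu i < -2.
    rewrite (bigD1 inf) //= (bigD1 K) 1?eq_sym //=.
    have : \sum_(i < l | (i != inf) && (i != K)) mu i <= 0.
      rewrite sumr_le0 // => i _; rewrite leNgt; apply/negP => m0; apply: N; by exists i.
    by move: mi mK; clear; move: (\sum_(_ | _) _) => s; lia.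
  by rewrite mu_sum ltxx.
have [z2 mz2 z12] : exists2 z2, 0 < mu z2 & z1 != z2.
  by apply: (two [pred i | 0 < mu i]) => //; apply/eqP => c1; apply: H; exact: Or33.
by exists inf, K, z1, z2.
Qed.

Local Close Scope complex_scope.

Theorem corollary1p10 (R : realType) (l : nat) (mu : 'I_l -> int)
  (mu_neq0 : forall i, mu i != 0) (mu_sum : \sum_(i < l) mu i = -2) :
  (exists S : set (stratum R mu),
      S `<=` [set x | arithmetic_point x] /\ zariski_dense S) ->
  [\/ only_simple_poles mu, single_pole mu | single_zero mu].
Proof.
move=> [S [Sarith Sdense]]; apply: contrapT => H.
have [inf [K [z1 [z2 [[mi2 mK mz1 mz2] [iK z12]]]]]] := exists_indices mu_neq0 mu_sum H.
have mi : mu inf < 0 by move: mi2; clear; lia.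
have iz1 : inf != z1 := pole_zero mi mz1.
have iz2 : inf != z2 := pole_zero mi mz2.
pose e := key_exp mu inf K z1 z2.
have eJ : rwf (Jfin inf) e by exact: rwf_key.
(* The locus of the key equation is closed and contains all arithmetic points; density would make it
   everything, against the configuration given by [nonvanishing]. *)
pose Y : set (stratum R mu) :=
  [set y | exists D, y = iso_class D /\ reval (cfg inf z1 z2 D) e = 0].
have YE D : Y (iso_class D) <-> reval (cfg inf z1 z2 D) e = 0.
  split=> [[D' [/iso_class_eq DD' D'0]]|D0]; last by exists D.
  rewrite -[RHS]D'0; apply: reval_local eJ _ => i ii.
  by apply: cfg_iso => //; rewrite eq_sym.
have Yclosed : zariski_closed Y.
  have [p [q [[P PE] _ pq]]] := fracfun_reval R mu iz1 iz2 z12 eJ.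
  exists [set P] => D; rewrite YE; have [q0 ->] := pq D; rewrite PE.
  split=> [/eqP|/(_ _ erefl) ->]; last by rewrite mul0r.
  by rewrite mulf_eq0 invr_eq0 (negPf q0) orbF => /eqP P0 f ->.
have SY : S `<=` Y.
  move=> y /Sarith[D [-> DQ DP]]; apply/YE; exact: arithmetic_key.
have YT := Sdense Y Yclosed SY.
have [x [xinj x1 x2 /eqP]] := nonvanishing R mu_neq0 mi2 mK mz1 mz2 iK z12 mu_sum.
apply; have xcinj : injective (real_complex R \o x).
  by move=> i j /= /complexI /xinj.
apply: (@complexI R); rewrite -reval_morph rmorph0.
rewrite -(proj1 (YE (conf_diff mu inf xcinj))); last by rewrite YT.
apply: reval_local eJ _ => i ii; rewrite cfg_conf //=; first by rewrite x1.
by rewrite x2.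
Qed.
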